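(* Let $\mathcal L$: $L[u]=0$ be a differential equation of order $r$ in two independent variables $x=(x_1,x_2)$ and one dependent variable $u$, and let $Q$ be a reduction operator of $\mathcal L$. Then the weak singularity co-order of $Q$ for $\mathcal L$ equals the essential order of the corresponding reduced ordinary differential equation.
   Context: All considerations are local; functions are smooth. $J^r$ is the jet space with coordinates $x$ and $u_\alpha$, $|\alpha|\le r$; $D_1,D_2$ are the total derivatives. A differential function of order $r$ is a smooth function on (a subset of) $J^r$ involving derivatives of maximal order $r$; the identically zero function has order $-1$. For a vector field $Q=\xi^1\partial_1+\xi^2\partial_2+\eta\partial_u$ (coefficients functions of $(x,u)$, $(\xi^1,\xi^2)\ne(0,0)$) put $Q[u]=\eta-\xi^1u_1-\xi^2u_2$ and $\mathcal Q_{(r)}=\{D_1^{a}D_2^{b}Q[u]=0,\ a+b<r\}\subset J^r$. $Q$ is a reduction operator (operator of nonclassical/conditional symmetry) of $\mathcal L$ if the $r$th prolongation of $Q$ applied to $L$ vanishes on $\{L=0\}\cap\mathcal Q_{(r)}$. Weak singularity co-order of $Q$ for $\mathcal L$: the minimal order $k$ of differential functions $\tilde L[u]$ for which there is a nonvanishing differential function $\lambda[u]$ of order not greater than $r$ with $L|_{\mathcal Q_{(r)}}=\lambda\tilde L|_{\mathcal Q_{(r)}}$. (It equals $r$ if $Q$ is weakly regular, and $-1$ if $L|_{\mathcal Q_{(r)}}\equiv0$.) Ansatz and reduced equation: let $\zeta(x,u),\omega(x,u)$ be functionally independent solutions (integrals) of the first-order equation $Q[u]=0$, with $\zeta_u\neq0$;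 the ansatz is $\zeta=\varphi(\omega)$ (an implicit representation of $u$), with $\varphi$ a new unknown function of one variable. It is known (and may be used) that $Q$ is a reduction operator of $\mathcal L$ if and only if the ansatz reduces $\mathcal L$ to an ordinary differential equation, i.e. there are differential functions $\check\lambda[\varphi]$ and $\check L[\varphi]$ of order not greater than $r$ (functions of $\omega$ and derivatives of $\varphi$) such that substituting the ansatz into $L$ gives $\check\lambda\check L$, where $\check\lambda$ is nonvanishing and may additionally depend on a function $\theta(x,u)$, functionally independent of $\zeta$ and $\omega$, as a parameter. The function $\check L$ is chosen of the minimal order $\check r$ that can be attained up to multiplication by nonvanishing differential functions; the reduced equation is $\check L[\varphi]=0$, and $\check r$ is its essential order. *)

(* Defs.v *)
From HB Require Import structures.
From mathcomp Require Import all_boot all_order all_algebra.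
From mathcomp Require Import boolp classical_sets functions reals.
From mathcomp Require Import topology normedtype derive.

Set Implicit Arguments.
Unset Strict Implicit.
Unset Printing Implicit Defensive.
Import Order.TTheory GRing.Theory Num.Theory.
Import numFieldNormedType.Exports.
Local Open Scope classical_set_scope.
Local Open Scope ring_scope.

(* Everything is local: functions are total, but only their germs at the base
   point under consideration matter. *)

Section Smooth.
Context {R : realType} {V : normedModType R}.
Implicit Types (f : V -> R) (p : V).

Definition iter_derive (vs : seq V) f : V -> R :=
  foldr (fun v g => 'D_v g) f vs.

(* C^oo on some neighbourhood of p (V is always finite-dimensional below, so
   it is enough to control the iterated directional derivatives). *)
Definition smooth_near f p : Prop :=
  \forall q \near p, forall vs : seq V, differentiable (iter_derive vs f) q.

(* The germ of f at p is not locally constant along v. *)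
Definition involves (v : V) f p : Prop := ~ \forall q \near p, 'D_v f q = 0.

(* Order of the germ of f at p, where the derivative coordinates of V are
   indexed by I: dir i is the coordinate direction i, and wt i the order of the
   derivative it stands for.  The zero germ has order -1. *)
Definition germ_order (I : finType) (dir : I -> V) (wt : I -> nat) f p : int :=
  if `[< \forall q \near p, f q = 0 >] then -1
  else Posz (\max_(i | `[< involves (dir i) f p >]) wt i).

Definition least (S : set int) (k : int) : Prop := S k /\ lbound S k.

End Smooth.

Section Jets.
Context {R : realType}.

(* Multi-indices (a, b) with a + b <= r. *)
Definition midx (r : nat) := {p : 'I_r.+1 * 'I_r.+1 | (p.1 + p.2 <= r)%N}.

Definition mi1 r (al : midx r) : nat := (val al).1.
Definition mi2 r (al : midx r) : nat := (val al).2.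
Definition mi_abs r (al : midx r) : nat := (mi1 al + mi2 al)%N.

(* J^r, as pairs (x, (u_al)_{|al| <= r}); J 0 is the space of (x, u). *)
Definition J (r : nat) : normedModType R := ('rV[R]_2 * 'rV[R]_#|{: midx r}|)%type.

Definition mkjet r (x : 'rV[R]_2) (c : nat -> nat -> R) : J r :=
  (x, \row_k c (mi1 (enum_val k)) (mi2 (enum_val k))).

(* The coordinate u_(a,b), and 0 if a + b > r. *)
Definition jcoord r (j : J r) (a b : nat) : R :=
  \sum_(al : midx r | (mi1 al == a) && (mi2 al == b)) j.2 0 (enum_rank al).

(* The projection J^r -> J^m for m <= r. *)
Definition trunc m r (j : J r) : J m := mkjet m j.1 (jcoord j).

Definition ddx r (i : 'I_2) : J r := mkjet r (delta_mx 0 i) (fun _ _ => 0).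
Definition ddu r (al : midx r) : J r := (0, delta_mx 0 (enum_rank al)).

Definition diff_order r (f : J r -> R) (j0 : J r) : int :=
  germ_order (@ddu r) (@mi_abs r) f j0.

Definition jet r (u : 'rV[R]_2 -> R) (x : 'rV[R]_2) : J r :=
  mkjet r x (fun a b =>
    iter a (fun g => 'D_(delta_mx 0 0) g) (iter b (fun g => 'D_(delta_mx 0 1) g) u) x).

(* D_i f = d_i f + sum_al u_(al + e_i) df/du_al, i.e. the derivative of f in
   the direction whose components are e_i and (u_(al + e_i))_al. *)
Definition tdir r (i : 'I_2) (j : J r.+1) : J r :=
  mkjet r (delta_mx 0 i) (fun a b => jcoord j (a + (i == 0%R)) (b + (i == 1%R))).

Definition TD (i : 'I_2) r (f : J r -> R) : J r.+1 -> R :=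
  fun j => 'D_(tdir i j) f (trunc r j).

Fixpoint TDn (i : 'I_2) n r (f : J r -> R) : J (n + r) -> R :=
  match n return J (n + r) -> R with
  | 0 => f
  | n'.+1 => TD i (@TDn i n' r f)
  end.
Arguments TDn i n {r} f.

(* xi^1 d_1 + xi^2 d_2 + eta d_u *)
Record vfield := VField { xi : 'I_2 -> J 0 -> R; eta : J 0 -> R }.

Definition smooth_vfield (Q : vfield) (p : J 0) : Prop :=
  (forall i, smooth_near (xi Q i) p) /\ smooth_near (eta Q) p.

Definition vfield_dir (Q : vfield) (p : J 0) : J 0 :=
  mkjet 0 (\row_i xi Q i p) (fun _ _ => eta Q p).

(* Q[u] *)
Definition characteristic (Q : vfield) (j : J 1) : R :=
  eta Q (trunc 0 j) - xi Q 0 (trunc 0 j) * jcoord j 1 0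
                    - xi Q 1 (trunc 0 j) * jcoord j 0 1.

(* Q_(r); only a + b + 1 <= r occurs, so no coordinate is lost in trunc. *)
Definition invariant_set r (Q : vfield) : set (J r) :=
  [set j | forall a b : nat, (a + b < r)%N ->
     TDn 0 a (TDn 1 b (characteristic Q)) (trunc (a + (b + 1)) j) = 0].

(* Coefficients eta^(a,b) of the prolongation, through the recursion (which,
   unlike D^al Q[u] + xi^1 u_(al + e_1) + xi^2 u_(al + e_2), does not leave J^|al|)
   eta^(al + e_i) = D_i eta^al - (D_i xi^1) u_(al + e_1) - (D_i xi^2) u_(al + e_2). *)
Definition pr_step (Q : vfield) (i : 'I_2) (a b : nat) r (f : J r -> R) :
    J r.+1 -> R :=
  fun j => TD i f j - TD i (xi Q 0) (trunc 1 j) * jcoord j a.+1 b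
                    - TD i (xi Q 1) (trunc 1 j) * jcoord j a b.+1.

Fixpoint pr_coef2 (Q : vfield) (b : nat) : J b -> R :=
  match b return J b -> R with
  | 0 => eta Q
  | b'.+1 => pr_step Q 1 0 b' (@pr_coef2 Q b')
  end.

Fixpoint pr_coef (Q : vfield) (a b : nat) : J (a + b) -> R :=
  match a return J (a + b) -> R with
  | 0 => @pr_coef2 Q b
  | a'.+1 => pr_step Q 0 a' b (@pr_coef Q a' b)
  end.
Arguments pr_coef Q a b : clear implicits.

Definition prolong r (Q : vfield) (L : J r -> R) (j : J r) : R :=
  'D_(mkjet r (\row_i xi Q i (trunc 0 j))
        (fun a b => pr_coef Q a b (trunc (a + b) j))) L j.

Definition reduction_operator r (Q : vfield) (L : J r -> R) (j0 : J r) : Prop :=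
  \forall j \near j0, L j = 0 -> invariant_set Q j -> prolong Q L j = 0.

(* lam is nonvanishing near j0 as soon as lam j0 != 0. *)
Definition weak_singularity_coorder r (Q : vfield) (L : J r -> R) (j0 : J r) :
    set int :=
  least [set k | exists lam Lt : J r -> R,
    [/\ smooth_near lam j0, lam j0 != 0, smooth_near Lt j0,
        diff_order Lt j0 = k &
        \forall j \near j0, invariant_set Q j -> L j = lam j * Lt j]].

Definition gradient (f : J 0 -> R) (p : J 0) : 'rV[R]_3 :=
  row_mx (\row_(i < 2) 'D_(ddx 0 i) f p)
         (\row_(i < 1) 'D_(mkjet 0 0 (fun _ _ => 1)) f p).

Definition functionally_independent (fs : seq (J 0 -> R)) (p : J 0) : Prop :=
  row_free (\matrix_(i < size fs) gradient (nth (cst 0) fs i) p).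

Definition integral_of (Q : vfield) (f : J 0 -> R) (p : J 0) : Prop :=
  \forall q \near p, 'D_(vfield_dir Q q) f q = 0.

Definition is_ansatz (Q : vfield) (zeta omega : J 0 -> R) (p : J 0) : Prop :=
  [/\ smooth_near zeta p /\ smooth_near omega p,
      integral_of Q zeta p, integral_of Q omega p,
      functionally_independent [:: zeta; omega] p &
      'D_(mkjet 0 0 (fun _ _ => 1)) zeta p != 0].

Definition ansatz_solution (zeta omega : J 0 -> R) (u : 'rV[R]_2 -> R)
    (phi : R -> R) (x : 'rV[R]_2) : Prop :=
  [/\ smooth_near u x, smooth_near phi (omega (jet 0 u x)) &
      \forall y \near x, zeta (jet 0 u y) = phi (omega (jet 0 u y))].

(* Jets of functions phi(omega) of one variable: (omega, (phi^(i))_{i <= r}). *)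
Definition JO (r : nat) : normedModType R := (R * 'rV[R]_r.+1)%type.

Definition ojet r (phi : R -> R) (w : R) : JO r := (w, \row_(i < r.+1) derive1n i phi w).

Definition ddphi r (i : 'I_r.+1) : JO r := (0, delta_mx 0 i).

Definition odiff_order r (f : JO r -> R) (o0 : JO r) : int :=
  germ_order (@ddphi r) (fun i : 'I_r.+1 => i : nat) f o0.

(* Substituting the ansatz into L gives lam * Lc, where lam may depend on the
   parameter theta: the equality holds at x for all u and phi related by the
   ansatz near x and with jets close to j0 and o0. *)
Definition substitution_gives r (zeta omega theta : J 0 -> R) (L : J r -> R)
    (lam : R * JO r -> R) (Lc : JO r -> R) (j0 : J r) (o0 : JO r) : Prop :=
  \forall j \near j0 & o \near o0,
    forall (u : 'rV[R]_2 -> R) (phi : R -> R) (x : 'rV[R]_2),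
      ansatz_solution zeta omega u phi x ->
      jet r u x = j -> ojet r phi (omega (jet 0 u x)) = o ->
      L j = lam (theta (jet 0 u x), o) * Lc o.

(* Lc[phi] = 0 is the reduced equation: Lc arises from L through the ansatz, and
   its order is minimal up to nonvanishing multipliers mu[phi]. *)
Definition reduced_equation r (zeta omega theta : J 0 -> R) (L : J r -> R)
    (Lc : JO r -> R) (j0 : J r) (o0 : JO r) : Prop :=
  [/\ smooth_near Lc o0,
      exists lam : R * JO r -> R,
        [/\ smooth_near lam (theta (trunc 0 j0), o0),
            lam (theta (trunc 0 j0), o0) != 0 &
            substitution_gives zeta omega theta L lam Lc j0 o0] &
      forall mu Lc' : JO r -> R,
        smooth_near mu o0 -> mu o0 != 0 -> smooth_near Lc' o0 ->
        (\forall o \near o0, Lc o = mu o * Lc' o) ->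
        odiff_order Lc o0 <= odiff_order Lc' o0].

End Jets.


Arguments TDn {R} i n {r} f _.
Arguments pr_coef {R} Q a b _.

(* Main.v *)
(* Idea: the ansatz gives two smooth maps between the space of jets o of phi and
   J^r.  A section jsec sends o to the r-jet of the function u solving the ansatz
   zeta = phi(omega), at a point where omega has the value prescribed by o; it
   takes values in Q_(r).  A retraction oret sends a jet j to the jet of the
   function phi with zeta = phi(omega) along a line transversal to omega, and on
   Q_(r) the jet j is recovered from oret j because the invariant surface
   condition determines u from its values on the line.  Both maps are triangular:
   coordinates of order k depend only on coordinates of order at most k, hence
   composition with them does not raise the order of a differential function.
   Composing L = lam Lt with jsec gives a multiple of Lc, so that minimality of Lc
   bounds the order of Lt from below; the function Lc o oret attains the bound. *)
Require Import Defs.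
From HB Require Import structures.
From mathcomp Require Import all_boot all_order all_algebra.
From mathcomp Require Import boolp classical_sets functions reals.
From mathcomp Require Import topology normedtype landau derive prodnormedzmodule.
From mathcomp Require Import ring lra.
Import Order.TTheory GRing.Theory Num.Theory.
Import numFieldNormedType.Exports.
Local Open Scope classical_set_scope.
Local Open Scope ring_scope.

Set Implicit Arguments.
Unset Strict Implicit.
Unset Printing Implicit Defensive.

(** * Germs of smooth maps *)

Section SmoothMaps.
Context {R : realType}.
Implicit Types V W Z : normedModType R.

(** An r-jet of phi at w fixes the solution u, but not the point of the level set omega = w at which
    the jet of u is taken. A section must choose one, and the line x0 + R e, transversal to the
    level sets of omega along u0, makes the choice. Hence the section composed with the retraction
    need not be the identity on Q_(r): a jet j is recovered as the jet of [U (oret j, .)] at its own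
    base point j.1. This does no harm, since the multiplier may depend on theta, which becomes a
    smooth function of j or of o after composition.

    Triangularity comes from contact of finite order instead of explicit chain-rule formulas:
    changing a coordinate of order k adds a multiple of a monomial of degree k, flat to order k - 1
    at the base point, and contact survives composition and the implicit function theorem. To
    differentiate with respect to jets, u0 and phi0 are embedded in families depending smoothly on a
    jet (polynomial corrections of the two functions), so that each construction becomes an implicit
    function theorem with parameters. *)

Definition iterD V W (vs : seq V) (f : V -> W) : V -> W :=
  foldr (fun v g => 'D_v g) f vs.

(** Vector-valued form of [smooth_near]; for real-valued functions the two are convertible. *)
Definition smooth V W (f : V -> W) (p : V) : Prop :=
  \forall q \near p, forall vs : seq V, differentiable (iterD vs f) q.

(* Smoothness on a common neighbourhood, stratified by the number of
   derivatives, so that closure properties can be proved by induction. *)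
Fixpoint Ck n V W (U : set V) (f : V -> W) : Prop :=
  (forall q, U q -> differentiable f q) /\
  if n is n'.+1 then forall v, Ck n' U ('D_v f) else True.

Lemma iterD_cat V W (vs ws : seq V) (f : V -> W) :
  iterD (vs ++ ws) f = iterD vs (iterD ws f).
Proof. by rewrite /iterD foldr_cat. Qed.

Lemma Ck_diff n V W (U : set V) (f : V -> W) q :
  Ck n U f -> U q -> differentiable f q.
Proof. by case: n => [|n] [H _]; apply: H. Qed.

Lemma near_open V (U : set V) q : open U -> U q -> \forall x \near q, U x.
Proof. by move=> oU Uq; apply: open_nbhs_nbhs. Qed.

(** The interior of the set in the definition of [smooth] serves all orders at once. Conversely,
    words of derivatives are peeled from the innermost letter, which is how [Ck] recurses. *)
Lemma smoothP V W (f : V -> W) p :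
  smooth f p <-> exists2 U : set V, open U /\ U p & forall n, Ck n U f.
Proof.
split=> [sf|[U [oU Up] H]].
  exists (interior [set q | forall vs, differentiable (iterD vs f) q]).
    by split; [exact: open_interior | exact: sf].
  move=> n; have : forall q, interior [set q | forall vs, differentiable (iterD vs f) q] q ->
    forall vs, differentiable (iterD vs f) q by move=> q /interior_subset.
  move: (interior _) => U; elim: n f {sf} => [|n IH] f H; split.
  - by move=> q /H /(_ [::]).
  - by [].
  - by move=> q /H /(_ [::]).
  - by move=> v; apply: IH => q Uq vs; have := H q Uq (vs ++ [:: v]); rewrite iterD_cat.
have {}H : forall q, U q -> forall vs, differentiable (iterD vs f) q.
  move=> q Uq vs; elim/last_ind: vs f H => [|vs v IH] f H.
    by apply: (Ck_diff (H 0%N)).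
  by rewrite -cats1 iterD_cat; apply: IH => n; case: (H n.+1) => _ /(_ v).
by apply: filterS (near_open oU Up) => q /H.
Qed.

Lemma Ck_sub n V W (U U' : set V) (f : V -> W) : U' `<=` U -> Ck n U f -> Ck n U' f.
Proof.
move=> sU; elim: n f => [|n IH] f [H1 H2]; split=> //.
- by move=> q /sU/H1.
- by move=> q /sU/H1.
by move=> v; apply/IH/H2.
Qed.

Lemma CkS n V W (U : set V) (f : V -> W) : Ck n.+1 U f -> Ck n U f.
Proof. by elim: n f => [|n IH] f [H1 H2]; split=> // v; apply: IH; apply: H2. Qed.

Lemma differentiable_bound V W (f : V -> W) x (df : {linear V -> W}) :
  continuous df ->
  (forall e, 0 < e -> \forall h \near 0, `|f (h + x) - f x - df h| <= e * `|h|) ->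
  differentiable f x /\ 'd f x = df :> (V -> W).
Proof.
move=> cdf H.
have E : f \o shift x = cst (f x) + df +o_ 0 id.
  apply/eqaddoP => e e0; near=> h => /=.
  rewrite [X in `|X|](_ : _ = f (h + x) - f x - df h); first by near: h; exact: H.
  by rewrite /= opprD addrA.
have E2 := diff_unique cdf E.
split=> //; apply/diff_locallyP; rewrite E2; split=> //.
Unshelve. all: by end_near. Qed.

Lemma differentiable_near V W (f : V -> W) x : differentiable f x ->
  forall e, 0 < e -> \forall h \near 0, `|f (h + x) - f x - 'd f x h| <= e * `|h|.
Proof.
move=> /diff_locally/eqaddoP H e e0; have := H e e0.
by apply: filterS => h /=; rewrite [X in `|X|](_ : _ = f (h + x) - f x - 'd f x h) // !fctE /= opprD addrA.
Qed.

Lemma eq_near_differentiable V W (f g : V -> W) q : (\forall x \near q, f x = g x) ->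
  differentiable f q -> differentiable g q.
Proof.
move=> fg df; have [c _] := (diff_locallyP _ _).1 df.
apply: (differentiable_bound c _).1 => e e0.
have H := differentiable_near df e0.
have fg' : \forall h \near (0 : V), f (h + q) = g (h + q).
  by have := fg; rewrite (near_shift 0 q) /=; apply: filterS => h; rewrite subr0.
near=> h; rewrite -(nbhs_singleton fg) -(near fg' h) //.
by near: h; exact: H.
Unshelve. all: by end_near. Qed.

Lemma CkE n V W (U : set V) (f : V -> W) :
  Ck n.+1 U f = ((forall q, U q -> differentiable f q) /\ forall v, Ck n U ('D_v f)).
Proof. by []. Qed.

Lemma eq_Ck n V W (U : set V) (f g : V -> W) : open U ->
  (forall q, U q -> f q = g q) -> Ck n U f -> Ck n U g.
Proof.
move=> oU; elim: n f g => [|n IH] f g fg.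
  case=> H1 _; split=> // q Uq; apply: (eq_near_differentiable (f := f)); last exact: H1.
  by apply: filterS (near_open oU Uq).
rewrite !CkE => -[H1 H2]; split=> [q Uq|v].
  apply: (eq_near_differentiable (f := f)); last exact: H1.
  by apply: filterS (near_open oU Uq).
apply: (IH ('D_v f)) => // q Uq; apply: near_eq_derive.
by apply: filterS (near_open oU Uq).
Qed.

Lemma derive_D V W (f g : V -> W) q v : differentiable f q -> differentiable g q ->
  'D_v (fun x => f x + g x) q = 'D_v f q + 'D_v g q.
Proof. by move=> df dg; apply: deriveD; apply: diff_derivable. Qed.

Lemma derive_M V (f g : V -> R) q v : differentiable f q -> differentiable g q ->
  'D_v (fun x => f x * g x) q = f q * 'D_v g q + g q * 'D_v f q.
Proof. by move=> df dg; apply: deriveM; apply: diff_derivable. Qed.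

Lemma derive_N V W (f : V -> W) q v : differentiable f q ->
  'D_v (fun x => - f x) q = - 'D_v f q.
Proof. by move=> df; apply: deriveN; apply: diff_derivable. Qed.

Lemma derive_B V W (f g : V -> W) q v : differentiable f q -> differentiable g q ->
  'D_v (fun x => f x - g x) q = 'D_v f q - 'D_v g q.
Proof. by move=> df dg; apply: deriveB; apply: diff_derivable. Qed.

Lemma derive_V V (f : V -> R) q v : f q != 0 -> differentiable f q ->
  'D_v (fun x => (f x)^-1) q = - (f q) ^- 2 * 'D_v f q.
Proof. by move=> f0 df; apply: deriveV => //; apply: diff_derivable. Qed.

Lemma Ck_cst n V W (U : set V) (c : W) : Ck n U (fun _ => c).
Proof.
elim: n c => [|n IH] c; first by split=> // q _; exact: differentiable_cst.
rewrite CkE; split=> [q _|v]; first exact: differentiable_cst.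
rewrite (_ : 'D_v _ = fun _ => 0) //.
by apply: funext => x; rewrite derive_cst.
Qed.

Lemma Ck_D n V W (U : set V) (f g : V -> W) : open U ->
  Ck n U f -> Ck n U g -> Ck n U (fun q => f q + g q).
Proof.
move=> oU; elim: n f g => [|n IH] f g.
  by move=> [f1 _] [g1 _]; split=> // q Uq; apply: differentiableD; auto.
rewrite !CkE => -[f1 f2] [g1 g2]; split.
  by move=> q Uq; apply: differentiableD; auto.
move=> v; apply: (@eq_Ck _ _ _ _ (fun q => 'D_v f q + 'D_v g q)) => //; last by apply: IH.
by move=> q Uq; rewrite derive_D //; [apply: f1|apply: g1].
Qed.

Lemma Ck_sum n V W (U : set V) (I : Type) (r : seq I) (P : pred I) (F : I -> V -> W) : open U ->
  (forall i, P i -> Ck n U (F i)) -> Ck n U (fun q => \sum_(i <- r | P i) F i q).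
Proof.
move=> oU H; elim: r => [|i r IH].
  rewrite (_ : (fun _ => _) = fun _ => 0) //; first exact: Ck_cst.
  by apply: funext => q; rewrite big_nil.
case Pi: (P i).
  rewrite (_ : (fun _ => _) = fun q => F i q + \sum_(i <- r | P i) F i q).
    by apply: Ck_D => //; apply: H.
  by apply: funext => q; rewrite big_cons Pi.
by rewrite (_ : (fun _ => _) = fun q => \sum_(i <- r | P i) F i q) //; apply: funext => q; rewrite big_cons Pi.
Qed.

Lemma derive_lin V W Z (l : {linear W -> Z}) (f : V -> W) q v :
  continuous l -> differentiable f q -> 'D_v (fun x => l (f x)) q = l ('D_v f q).
Proof.
move=> cl df.
have dl : differentiable l (f q) by apply: linear_differentiable.
rewrite [LHS](deriveE _ (differentiable_comp df dl)) (diff_comp df dl) /=.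
by rewrite (diff_lin _ cl) deriveE.
Qed.

Lemma Ck_lin n V W Z (l : {linear W -> Z}) (U : set V) (f : V -> W) : open U ->
  continuous l -> Ck n U f -> Ck n U (fun q => l (f q)).
Proof.
move=> oU cl; elim: n f => [|n IH] f.
  case=> f1 _; split=> // q Uq; apply: (differentiable_comp (f1 _ Uq)).
  exact: linear_differentiable.
rewrite !CkE => -[f1 f2]; split=> [q Uq|v].
  by apply: (differentiable_comp (f1 _ Uq)); apply: linear_differentiable.
apply: (@eq_Ck _ _ _ _ (fun q => l ('D_v f q))) => //; last exact: IH.
by move=> q Uq; rewrite derive_lin //; apply: f1.
Qed.

Lemma Ck_Zl n V W (U : set V) (k : V -> R) (w : W) : open U ->
  Ck n U k -> Ck n U (fun q => k q *: w).
Proof.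
move=> oU; elim: n k => [|n IH] k.
  by case=> f1 _; split=> // q Uq; apply: differentiableZl; apply: f1.
rewrite !CkE => -[f1 f2]; split=> [q Uq|v].
  by apply: differentiableZl; apply: f1.
apply: (@eq_Ck _ _ _ _ (fun q => 'D_v k q *: w)) => //; last exact: IH.
move=> q Uq; rewrite !deriveE; first by rewrite diffZl //; apply: f1.
  by apply: differentiableZl; apply: f1.
by apply: f1.
Qed.

Lemma Ck_M n V (U : set V) (f g : V -> R) : open U ->
  Ck n U f -> Ck n U g -> Ck n U (fun q => f q * g q).
Proof.
move=> oU; elim: n f g => [|n IH] f g.
  by move=> [f1 _] [g1 _]; split=> // q Uq; apply: differentiableM; auto.
(* The product rule multiplies derivatives, of order n, by f and g themselves, which are therefore
   lowered to order n as well. *)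
move=> fS gS; move: (CkS fS) (CkS gS) => fn gn; move: fS gS.
rewrite !CkE => -[f1 f2] [g1 g2]; split.
  by move=> q Uq; apply: differentiableM; auto.
move=> v; apply: (@eq_Ck _ _ _ _ (fun q => f q * 'D_v g q + g q * 'D_v f q)) => //.
  by move=> q Uq; rewrite derive_M //; [apply: f1|apply: g1].
by apply: Ck_D => //; apply: IH.
Qed.

Lemma Ck_V n V (U : set V) (f : V -> R) : open U ->
  (forall q, U q -> f q != 0) -> Ck n U f -> Ck n U (fun q => (f q)^-1).
Proof.
move=> oU f0; elim: n => [|n IH].
  by case=> f1 _; split=> // q Uq; apply: differentiableV; auto.
move=> fS; have fn := CkS fS; move: fS; rewrite !CkE => -[f1 f2]; split.
  by move=> q Uq; apply: differentiableV; auto.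
move=> v; apply: (@eq_Ck _ _ _ _ (fun q => (-1) * (((f q)^-1 * (f q)^-1) * 'D_v f q))) => //.
  move=> q Uq; rewrite (derive_V _ (f0 _ Uq) (f1 _ Uq)).
  by rewrite mulN1r -mulNr expr2 invfM.
do ![apply: Ck_M => //]; by [exact: Ck_cst | exact: IH].
Qed.

(* Finite dimension in coordinates: with it, the iterated derivatives of f \o g
   are finite sums of products of partial derivatives of f and of g. *)
Definition findim V := exists (I : finType) (e : I -> V) (c : I -> {linear V -> R^o}),
  (forall i, continuous (c i)) /\ forall v, v = \sum_i c i v *: e i.

Lemma derive_comp V W Z (f : W -> Z) (g : V -> W) q v :
  differentiable g q -> differentiable f (g q) ->
  'D_v (fun x => f (g x)) q = 'D_('D_v g q) f (g q).
Proof.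
move=> dg df; rewrite [LHS](deriveE _ (differentiable_comp dg df)) (diff_comp dg df) /=.
by rewrite !deriveE.
Qed.

Lemma derive_sumv V W (f : V -> W) q (I : Type) (r : seq I) (P : pred I) (k : I -> R) (e : I -> V) :
  differentiable f q ->
  'D_(\sum_(i <- r | P i) k i *: e i) f q = \sum_(i <- r | P i) k i *: 'D_(e i) f q.
Proof.
move=> df; rewrite deriveE // linear_sum; apply: eq_bigr => i _.
by rewrite linearZ deriveE.
Qed.

Lemma derive_dirD V W (f : V -> W) q (u v : V) (k : R) : differentiable f q ->
  'D_(u + k *: v) f q = 'D_u f q + k *: 'D_v f q.
Proof. by move=> df; rewrite !deriveE // linearD linearZ. Qed.

Lemma Ck_comp n V W (U : set V) (U' : set W) (f : W -> R) (g : V -> W) : findim W ->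
  open U -> open U' -> (forall q, U q -> U' (g q)) ->
  Ck n U' f -> Ck n U g -> Ck n U (fun q => f (g q)).
Proof.
move=> [I [e [c [cc ec]]]] oU oU' UU'; elim: n f g UU' => [|n IH] f g UU'.
  by move=> [f1 _] [g1 _]; split=> // q Uq; apply: differentiable_comp; auto.
move=> fS gS; move: (CkS fS) (CkS gS) => fn gn; move: fS gS.
rewrite !CkE => -[f1 f2] [g1 g2]; split.
  by move=> q Uq; apply: differentiable_comp; auto.
move=> v; apply: (@eq_Ck _ _ _ _ (fun q => \sum_i c i ('D_v g q) * 'D_(e i) f (g q))) => //.
  move=> q Uq; rewrite (derive_comp _ (g1 _ Uq) (f1 _ (UU' _ Uq))).
  by rewrite [in RHS](ec ('D_v g q)) derive_sumv //; apply/f1/UU'.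
apply: Ck_sum => // i _; apply: Ck_M => //; last exact: (IH ('D_(e i) f)).
exact: Ck_lin.
Qed.

(** * Closure properties of smooth germs *)

Lemma smooth_nbhs V W (f : V -> W) p : smooth f p -> \forall q \near p, smooth f q.
Proof. by move=> H; apply: near_join. Qed.

Lemma smooth_diff V W (f : V -> W) p : smooth f p -> differentiable f p.
Proof. by move=> H; have := nbhs_singleton H [::]. Qed.

Lemma smooth_diff_nbhs V W (f : V -> W) p : smooth f p -> \forall q \near p, differentiable f q.
Proof. by apply: filterS => q /(_ [::]). Qed.

Lemma smooth_continuous V W (f : V -> W) p : smooth f p -> {for p, continuous f}.
Proof. by move/smooth_diff; apply: differentiable_continuous. Qed.

Lemma smooth_derive V W (f : V -> W) p v : smooth f p -> smooth ('D_v f) p.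
Proof. by apply: filterS => q H vs; have := H (vs ++ [:: v]); rewrite iterD_cat. Qed.

Lemma smooth_iterD V W (f : V -> W) p vs : smooth f p -> smooth (iterD vs f) p.
Proof. by move=> sf; elim: vs => //= v vs; apply: smooth_derive. Qed.

Lemma eq_near_derive V W (f g : V -> W) (p v : V) : (\forall q \near p, f q = g q) ->
  \forall q \near p, 'D_v f q = 'D_v g q.
Proof. by move/near_join; apply: filterS => q /near_eq_derive ->. Qed.

Lemma eq_near_iterD V W (f g : V -> W) (p : V) vs : (\forall q \near p, f q = g q) ->
  \forall q \near p, iterD vs f q = iterD vs g q.
Proof. by move=> fg; elim: vs => //= v vs; apply: eq_near_derive. Qed.

Lemma eq_smooth V W (f g : V -> W) p : (\forall q \near p, f q = g q) ->
  smooth f p -> smooth g p.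
Proof.
move=> fg /smoothP[U [oU Up] H]; apply/smoothP.
exists (U `&` interior [set q | f q = g q]).
  by split; [apply: openI => //; exact: open_interior | split].
move=> n; apply: (@eq_Ck _ _ _ _ f).
- by apply: openI => //; exact: open_interior.
- by move=> q [_ /interior_subset].
- by apply: Ck_sub (H n) => q [].
Qed.

Lemma smooth_cst V W (c : W) (p : V) : smooth (fun _ => c) p.
Proof. by apply/smoothP; exists setT => [|n]; [split=> //; exact: openT|exact: Ck_cst]. Qed.

Lemma smooth_D V W (f g : V -> W) p : smooth f p -> smooth g p -> smooth (fun q => f q + g q) p.
Proof.
move=> /smoothP[U [oU Up] Hf] /smoothP[U' [oU' Up'] Hg]; apply/smoothP.
exists (U `&` U') => [|n]; first by split; [exact: openI|].
by apply: Ck_D; [exact: openI|apply: Ck_sub (Hf n)|apply: Ck_sub (Hg n)] => q [].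
Qed.

Lemma smooth_M V (f g : V -> R) p : smooth f p -> smooth g p -> smooth (fun q => f q * g q) p.
Proof.
move=> /smoothP[U [oU Up] Hf] /smoothP[U' [oU' Up'] Hg]; apply/smoothP.
exists (U `&` U') => [|n]; first by split; [exact: openI|].
by apply: Ck_M; [exact: openI|apply: Ck_sub (Hf n)|apply: Ck_sub (Hg n)] => q [].
Qed.

Lemma smooth_sum V W (I : Type) (r : seq I) (P : pred I) (F : I -> V -> W) p :
  (forall i, P i -> smooth (F i) p) -> smooth (fun q => \sum_(i <- r | P i) F i q) p.
Proof.
move=> H; elim: r => [|i r IH].
  apply: (eq_smooth (f := fun _ => 0)); last exact: smooth_cst.
  by near=> q; rewrite big_nil.
case Pi: (P i).
  apply: (eq_smooth (f := fun q => F i q + \sum_(i <- r | P i) F i q)).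
    by near=> q; rewrite big_cons Pi.
  by apply: smooth_D => //; apply: H.
by apply: eq_smooth IH; near=> q; rewrite big_cons Pi.
Unshelve. all: by end_near. Qed.

Lemma smooth_lin V W Z (l : {linear W -> Z}) (f : V -> W) p :
  continuous l -> smooth f p -> smooth (fun q => l (f q)) p.
Proof.
move=> cl /smoothP[U [oU Up] H]; apply/smoothP; exists U => // n.
exact: Ck_lin.
Qed.

Lemma smooth_Zl V W (k : V -> R) (w : W) p : smooth k p -> smooth (fun q => k q *: w) p.
Proof.
by move=> /smoothP[U [oU Up] H]; apply/smoothP; exists U => // n; apply: Ck_Zl.
Qed.

Lemma smooth_N V (f : V -> R) p : smooth f p -> smooth (fun q => - f q) p.
Proof.
move=> sf; apply: (eq_smooth (f := fun q => (-1) * f q)).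
  by near=> q; rewrite mulN1r.
by apply: smooth_M => //; apply: smooth_cst.
Unshelve. all: by end_near. Qed.

Lemma smooth_B V (f g : V -> R) p : smooth f p -> smooth g p -> smooth (fun q => f q - g q) p.
Proof. by move=> sf sg; apply: smooth_D => //; apply: smooth_N. Qed.

Lemma near_neq0 V (f : V -> R) p : {for p, continuous f} -> f p != 0 -> \forall q \near p, f q != 0.
Proof.
move=> cf f0; have o : open [set x : R | x != 0] by exact: open_neq.
by apply: (cf [set x | x != 0]); apply: open_nbhs_nbhs.
Qed.

Lemma smooth_V V (f : V -> R) p : f p != 0 -> smooth f p -> smooth (fun q => (f q)^-1) p.
Proof.
move=> f0 sf; have n0 := near_neq0 (smooth_continuous sf) f0.
move/smoothP: sf => [U [oU Up] H]; apply/smoothP.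
exists (U `&` interior [set q | f q != 0]) => [|n].
  by split; [apply: openI => //; exact: open_interior|split].
apply: Ck_V; first by apply: openI => //; exact: open_interior.
  by move=> q [_ /interior_subset].
by apply: Ck_sub (H n) => q [].
Qed.

Lemma smooth_comp V W (f : W -> R) (g : V -> W) p : findim W ->
  smooth f (g p) -> smooth g p -> smooth (fun q => f (g q)) p.
Proof.
move=> fW /smoothP[U' [oU' Up'] Hf] sg; have cg := smooth_continuous sg.
move/smoothP: sg => [U [oU Up] Hg].
have i1 : \forall q \near p, U' (g q) by apply: cg; apply: near_open.
apply/smoothP; exists (U `&` interior [set q | U' (g q)]) => [|n].
  by split; [apply: openI => //; exact: open_interior|split].
apply: (@Ck_comp _ _ _ _ U') => //.
- by apply: openI => //; exact: open_interior.
- by move=> q [_ /interior_subset].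
- by apply: Ck_sub (Hg n) => q [].
Qed.

Lemma smooth_findim V W (f : V -> W) p : findim W ->
  (forall l : {linear W -> R^o}, continuous l -> smooth (fun q => l (f q)) p) -> smooth f p.
Proof.
move=> [I [e [c [cc ec]]]] H.
apply: (eq_smooth (f := fun q => \sum_i c i (f q) *: e i)); first by near=> q; rewrite -ec.
by apply: smooth_sum => i _; apply: smooth_Zl; apply: H.
Unshelve. all: by end_near. Qed.

Lemma smooth_compv V W Z (f : W -> Z) (g : V -> W) p : findim W -> findim Z ->
  smooth f (g p) -> smooth g p -> smooth (fun q => f (g q)) p.
Proof.
move=> fW fZ sf sg; apply: smooth_findim => // l cl.
by apply: (smooth_comp (f := fun w => l (f w))) => //; apply: smooth_lin.
Qed.

Lemma smooth_linear V W (l : {linear V -> W}) p : continuous l -> smooth l p.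
Proof.
move=> cl; apply/smoothP; exists setT; first by split=> //; exact: openT.
case=> [|n]; first by split=> // q _; exact: linear_differentiable.
rewrite CkE; split=> [q _|v]; first exact: linear_differentiable.
rewrite (_ : 'D_v l = fun _ => l v); first exact: Ck_cst.
apply: funext => x; rewrite deriveE; last exact: linear_differentiable.
by rewrite diff_lin.
Qed.

Lemma smooth_id V (p : V) : smooth id p.
Proof. by apply: (smooth_linear (l := idfun)) => x; exact: cvg_id. Qed.

Lemma fst_linear V W : linear (@fst V W).
Proof. by []. Qed.
Lemma snd_linear V W : linear (@snd V W).
Proof. by []. Qed.
Lemma inl_linear V W : linear (fun x : V => (x, 0 : W)).
Proof. by move=> k x y; congr (_, _) => /=; rewrite scaler0 addr0. Qed.
Lemma inr_linear V W : linear (fun x : W => (0 : V, x)).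
Proof. by move=> k x y; congr (_, _) => /=; rewrite scaler0 addr0. Qed.

Definition linF V W (f : V -> W) (lf : linear f) : {linear V -> W} :=
  HB.pack f (GRing.isLinear.Build _ _ _ _ _ lf).

Lemma smooth_linear_fun V W (l : V -> W) p : linear l -> continuous l -> smooth l p.
Proof. by move=> ll cl; apply: (smooth_linear (l := linF ll)). Qed.

Lemma smooth_fst V W (p : V * W) : smooth fst p.
Proof. apply: smooth_linear_fun => [|x]; [exact: fst_linear|exact: cvg_fst]. Qed.

Lemma smooth_snd V W (p : V * W) : smooth snd p.
Proof. apply: smooth_linear_fun => [|x]; [exact: snd_linear|exact: cvg_snd]. Qed.

Lemma continuous_inl V W : continuous (fun x : V => (x, 0 : W)).
Proof. by move=> x; apply: cvg_pair; [exact: cvg_id|exact: cvg_cst]. Qed.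
Lemma continuous_inr V W : continuous (fun x : W => (0 : V, x)).
Proof. by move=> x; apply: cvg_pair; [exact: cvg_cst|exact: cvg_id]. Qed.

Lemma Ck_pair n V W Z (f : V -> W) (g : V -> Z) U : open U ->
  Ck n U f -> Ck n U g -> Ck n U (fun q => (f q, g q)).
Proof.
move=> oU sf sg; apply: (@eq_Ck _ _ _ _ (fun q => (f q, 0) + (0, g q))) => //.
  by move=> q _; congr (_, _) => /=; rewrite ?addr0 ?add0r.
apply: Ck_D => //.
  by apply: (Ck_lin (l := linF (@inl_linear W Z))) => //; exact: continuous_inl.
by apply: (Ck_lin (l := linF (@inr_linear W Z))) => //; exact: continuous_inr.
Qed.

Lemma smooth_pair V W Z (f : V -> W) (g : V -> Z) p :
  smooth f p -> smooth g p -> smooth (fun q => (f q, g q)) p.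
Proof.
move=> /smoothP[U [oU Up] Hf] /smoothP[U' [oU' Up'] Hg]; apply/smoothP.
exists (U `&` U') => [|n]; first by split; [exact: openI|].
by apply: Ck_pair; [exact: openI|apply: Ck_sub (Hf n)|apply: Ck_sub (Hg n)] => q [].
Qed.

Lemma smooth_row V n (f : 'I_n -> V -> R) p : (forall k, smooth (f k) p) ->
  smooth (fun q => \row_k f k q) p.
Proof.
move=> H; apply: (eq_smooth (f := fun q => \sum_k f k q *: (delta_mx 0 k : 'rV[R]_n))).
  by near=> q; rewrite [RHS]row_sum_delta; apply: eq_bigr => k _; rewrite mxE.
by apply: smooth_sum => k _; apply: smooth_Zl.
Unshelve. all: by end_near. Qed.

Lemma coord_linear n (k : 'I_n) : linear (fun x : 'rV[R]_n => x 0 k : R^o).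
Proof. by move=> a x y; rewrite !mxE. Qed.

Lemma smooth_coord n (k : 'I_n) p : smooth (fun x : 'rV[R]_n => x 0 k) p.
Proof.
by apply: (smooth_linear_fun (W := R^o)); [exact: coord_linear|exact: coord_continuous].
Qed.

Lemma findimR : findim R.
Proof.
exists 'I_1, (fun _ => 1), (fun _ => idfun); split; first by move=> _ x; exact: cvg_id.
by move=> v; rewrite big_ord1 /= [_ *: _]mulr1.
Qed.

Lemma findim_rV n : findim 'rV[R]_n.
Proof.
exists 'I_n, (fun k => delta_mx 0 k), (fun k => linF (coord_linear k)).
by split=> [k|v]; [exact: coord_continuous|exact: row_sum_delta].
Qed.

Lemma findim_prod V W : findim V -> findim W -> findim (V * W)%type.
Proof.
move=> [I [e [c [cc ec]]]] [I' [e' [c' [cc' ec']]]].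
have l1 i : linear (fun x : V * W => c i x.1) by move=> a x y; rewrite /= linearP.
have l2 i : linear (fun x : V * W => c' i x.2) by move=> a x y; rewrite /= linearP.
exists (I + I')%type,
  (fun s => match s with inl i => (e i, 0) | inr i => (0, e' i) end),
  (fun s => match s with inl i => linF (l1 i) | inr i => linF (l2 i) end).
split=> [[i|i] x|[v w]].
- by apply: (@continuous_comp _ _ _ fst (c i)); [exact: cvg_fst|exact: cc].
- by apply: (@continuous_comp _ _ _ snd (c' i)); [exact: cvg_snd|exact: cc'].
rewrite big_sumType /=.
have -> : \sum_i c i v *: (e i, 0 : W) = (v, 0).
  rewrite [X in (X, _)]ec -[RHS]/(linF (@inl_linear V W) _) linear_sum.
  by apply: eq_bigr => i _; rewrite linearZ.
have -> : \sum_i c' i w *: (0 : V, e' i) = (0, w).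
  rewrite [X in (_, X)]ec' -[RHS]/(linF (@inr_linear V W) _) linear_sum.
  by apply: eq_bigr => i _; rewrite linearZ.
by congr (_, _) => /=; rewrite ?addr0 ?add0r.
Qed.

(** * Symmetry of second derivatives *)

Lemma smooth_affine V (p v : V) t : smooth (fun t : R => p + t *: v) t.
Proof. by apply: smooth_D; [exact: smooth_cst|apply: smooth_Zl; exact: smooth_id]. Qed.

Lemma derive_affine V (p v : V) (t : R) : 'D_1 (fun t : R => p + t *: v) t = v.
Proof.
rewrite derive_D; [|exact: differentiable_cst|by apply: differentiableZl; exact: ex_diff].
rewrite derive_cst add0r deriveE; last by apply: differentiableZl; exact: ex_diff.
by rewrite diffZl //= diff_val scale1r.
Qed.

Lemma mvt_line V (f : V -> R) (p v : V) (s : R) : 0 < s ->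
  (forall t, 0 <= t <= s -> differentiable f (p + t *: v)) ->
  exists2 c, 0 < c < s & f (p + s *: v) - f p = s * 'D_v f (p + c *: v).
Proof.
move=> s0 df; pose h t := f (p + t *: v).
have dh t : 0 <= t <= s -> differentiable h t.
  move=> ts; apply: (differentiable_comp (f := fun t : R => p + t *: v)); last exact: df.
  exact/smooth_diff/smooth_affine.
have [|||c cs E] := @MVT R h (fun t => 'D_v f (p + t *: v)) 0 s => //.
- move=> x; rewrite in_itv /= => /andP[x0 xs].
  have xx : 0 <= x <= s by rewrite !ltW.
  apply: DeriveDef; first by apply/diff_derivable/dh.
  rewrite /h (@derive_comp _ _ _ f (fun t : R => p + t *: v)) ?derive_affine //.
  exact: df.
- apply: continuous_in_subspaceT => x; rewrite inE /= in_itv /= => xx.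
  exact/differentiable_continuous/dh.
exists c; first by move: cs; rewrite in_itv.
by move: E; rewrite /h scale0r addr0 subr0 mulrC.
Qed.

Lemma near_plane V (p v w : V) (P : V -> Prop) : (\forall q \near p, P q) ->
  exists2 e : R, 0 < e & forall a b, `|a| < e -> `|b| < e -> P (p + a *: v + b *: w).
Proof.
move=> HP; pose m (z : R * R) := p + z.1 *: v + z.2 *: w.
have cm : {for (0, 0), continuous m}.
  apply/smooth_continuous/smooth_D; last by apply/smooth_Zl/smooth_snd.
  by apply: smooth_D; [exact: smooth_cst|apply/smooth_Zl/smooth_fst].
have : \forall z \near ((0, 0) : R * R), P (m z).
  by apply: cm; rewrite /m /= !scale0r !addr0.
move=> /nbhs_ballP[e /= e0 H]; exists e => // a b ae be.
by apply: (H (a, b)); split; rewrite /= -ball_normE /= sub0r normrN.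
Qed.

(* Two applications of the mean value theorem to the second difference of f. *)
Lemma clairaut_aux V (f : V -> R) (p v w : V) : smooth f p ->
  exists2 e : R, 0 < e & forall s, 0 < s < e -> exists a b, [/\ 0 < a < s, 0 < b < s &
   f (p + s *: v + s *: w) - f (p + s *: v) - (f (p + s *: w) - f p) =
   s * (s * 'D_w ('D_v f) (p + a *: v + b *: w))].
Proof.
move=> sf.
have [e e0 H] := near_plane v w (smooth_nbhs sf).
exists e => // s /andP[s0 se]; pose g q := f (q + s *: w) - f q.
have sh q : smooth (fun q => q + s *: w) q by apply: smooth_D; [exact: smooth_id|exact: smooth_cst].
have ne t : 0 <= t <= s -> `|t| < e by move=> /andP[t0 ts]; rewrite ger0_norm // (le_lt_trans ts).
have df t : 0 <= t <= s -> differentiable f (p + t *: v).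
  move=> ts; have := H t 0 (ne _ ts); rewrite scale0r addr0 normr0 => /(_ e0).
  exact: smooth_diff.
have dfs t : 0 <= t <= s -> differentiable (fun q => f (q + s *: w)) (p + t *: v).
  move=> ts; apply: (differentiable_comp (f := fun q => q + s *: w)).
    exact/smooth_diff/sh.
  by apply/smooth_diff/H => //; apply: ne; rewrite // ltW //=.
have [||a as_ Ea] := @mvt_line V g p v s => //.
  by move=> t ts; apply: differentiableB; [exact: dfs|exact: df].
have as2 : 0 <= a <= s by case/andP: as_ => ??; rewrite !ltW.
have [||b bs Eb] := @mvt_line V ('D_v f) (p + a *: v) w s => //.
  by move=> t ts; apply/smooth_diff/smooth_derive/H; exact: ne.
exists a, b; split=> //; rewrite -Eb.
have -> : f (p + s *: v + s *: w) - f (p + s *: v) - (f (p + s *: w) - f p) = g (p + s *: v) - g p by [].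
rewrite Ea /g derive_B; [|exact: dfs|exact: df].
rewrite derive_comp; last 2 first.
- exact/smooth_diff/sh.
- by apply/smooth_diff/H => //; apply: ne; rewrite // ltW //=.
rewrite derive_D; [|exact: ex_diff|exact: differentiable_cst].
by rewrite derive_cst derive_id addr0.
Qed.

(** The equal values are taken at two different points, both arbitrarily close to p, as produced by
    two independent uses of the mean value theorem; continuity passes the equality to the limit. *)
Lemma limit_eq V (A B : V -> R) (p v w : V) :
  {for p, continuous A} -> {for p, continuous B} ->
  (forall d : R, 0 < d -> exists a b a' b' : R,
     [/\ `|a| < d, `|b| < d, `|a'| < d & `|b'| < d] /\
     A (p + a *: v + b *: w) = B (p + a' *: v + b' *: w)) -> A p = B p.
Proof.
move=> cA cB H; apply/eqP; rewrite -subr_eq0 -normr_le0; apply/ler_addgt0Pr => e e0; rewrite add0r.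
have eh : 0 < e / 2 by rewrite divr_gt0.
have [dA dA0 HA] := @near_plane V p v w (fun q => `|A p - A q| < e / 2) ((cvgrPdist_lt _ _).1 cA _ eh).
have [dB dB0 HB] := @near_plane V p v w (fun q => `|B p - B q| < e / 2) ((cvgrPdist_lt _ _).1 cB _ eh).
have [|a [b [a' [b' [[]]]]]] := H (Num.min dA dB); first by rewrite lt_min dA0.
rewrite !lt_min => /andP[h1 _] /andP[h2 _] /andP[_ h3] /andP[_ h4] E.
rewrite [A p - B p](_ : _ = (A p - A (p + a *: v + b *: w)) - (B p - B (p + a' *: v + b' *: w))); last first.
  by rewrite -E opprB addrA subrK.
rewrite (le_trans (ler_normB _ _)) // (splitr e) ltW // ltrD //; [exact: HA|exact: HB].
Qed.

(** The second difference of f over the parallelogram with sides s v and s w is symmetric in v and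
    w. Each order of differencing writes it as s^2 times one mixed derivative at an intermediate
    point. *)
Lemma clairaut V (f : V -> R) (p v w : V) : smooth f p ->
  'D_v ('D_w f) p = 'D_w ('D_v f) p.
Proof.
move=> sf; have sA := smooth_derive v (smooth_derive w sf).
have sB := smooth_derive w (smooth_derive v sf).
apply: (@limit_eq _ _ _ _ v w (smooth_continuous sA) (smooth_continuous sB)) => d d0.
have [e1 e10 H1] := clairaut_aux v w sf.
have [e2 e20 H2] := clairaut_aux w v sf.
pose s := Num.min e1 (Num.min e2 d) / 2.
have m0 : 0 < Num.min e1 (Num.min e2 d) by rewrite !lt_min e10 e20.
have s0 : 0 < s by rewrite divr_gt0.
have : s < Num.min e1 (Num.min e2 d) by rewrite /s ltr_pdivrMr // mulr2n mulrDr mulr1 ltrDl.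
rewrite !lt_min => /and3P[se1 se2 sd].
have [|a [b [/andP[a0 as_] /andP[b0 bs] E]]] := H1 s; first by rewrite s0.
have [|a' [b' [/andP[a0' as_'] /andP[b0' bs'] E']]] := H2 s; first by rewrite s0.
have nd x : 0 < x -> x < s -> `|x| < d by move=> x0 xs; rewrite gtr0_norm // (lt_trans xs).
exists b', a', a, b; split; first by split; apply: nd.
have s1 : s != 0 by rewrite gt_eqF.
have pe : p + s *: w + s *: v = p + s *: v + s *: w by exact: addrAC.
rewrite pe in E'.
have key (X Y x y z t : R) : x - y - (z - t) = s * (s * X) -> x - z - (y - t) = s * (s * Y) -> Y = X.
  by move=> h1 h2; apply: (mulfI s1); apply: (mulfI s1); rewrite -h1 -h2; ring.
rewrite [p + b' *: v + _]addrAC; exact: (key _ _ _ _ _ _ E E').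
Qed.

(** * The implicit function theorem *)

(** The expansion of F at (q, g q), with increments h of q and k of g, gives A h + k B up to c (|h|
    + |k|). A crude bound |k| <= K |h| comes out of it first and then turns the error into a
    multiple of |h|, so the differential of g is - A / B. *)
Lemma implicit_differentiable V (F : V * R -> R) (g : V -> R) (q : V) :
  differentiable F (q, g q) -> 'D_(0, 1) F (q, g q) != 0 -> {for q, continuous g} ->
  (\forall x \near q, F (x, g x) = 0) -> differentiable g q.
Proof.
move=> dF B0 cg F0; set B := 'D_(0, 1) F (q, g q) in B0.
pose A (h : V) : R := 'd F (q, g q) (h, 0).
have [cdF _] := (diff_locallyP _ _).1 dF.
have lA : linear (fun h => - B^-1 * A h : R^o).
  move=> a x y; rewrite /A -[(_, 0)]/(linF (@inl_linear V R) _) !linearP /=.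
  by rewrite mulrDr scalerAr.
have cA : continuous A.
  move=> h; apply: (@continuous_comp _ _ _ (fun x : V => (x, 0 : R)) ('d F (q, g q))); last exact: cdF.
  exact: continuous_inl.
have cA' : continuous (fun h => - B^-1 * A h) by move=> h; apply: cvgM; [exact: cvg_cst|exact: cA].
have [M M0 HM] : exists2 M : R, M > 0 & forall h, `|A h| <= M * `|h|.
  have lA1 : linear (A : V -> R^o) by move=> a x y; rewrite /A -[(_, 0)]/(linF (@inl_linear V R) _) !linearP.
  exact: (@linear_lipschitz _ _ _ (linF lA1) cA).
have Bp : 0 < `|B| by rewrite normr_gt0.
apply: (differentiable_bound (df := linF lA) cA' _).1 => e e0.
(* The bound c <= |B| / 2 lets c |k| be absorbed into |k| |B|, which yields |k| <= K |h|; the other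
   bound on c gives c (1 + K) |h| <= e |B| |h|. *)
pose K := 2 * M / `|B| + 1.
have K0 : 0 < K by rewrite addr_gt0 // !mulr_gt0 ?invr_gt0.
pose c := Num.min (`|B| / 2) (e * `|B| / (1 + K)).
have K10 : 0 < 1 + K by rewrite addr_gt0.
have c0 : 0 < c by rewrite lt_min !divr_gt0 ?mulr_gt0.
have := differentiable_near dF c0.
move=> /nbhs_ballP[d /= d0 Hd].
have n1 : \forall h \near (0 : V), `|h| < d by apply: nbhs0_lt.
have n2 : \forall h \near (0 : V), `|g (h + q) - g q| < d.
  have : \forall t \near q, `|g q - g t| < d by move/cvgrPdist_lt: cg; apply.
  rewrite (near_shift 0 q); by apply: filterS => h /=; rewrite subr0 distrC.
have n3 : \forall h \near (0 : V), F (h + q, g (h + q)) = 0.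
  by move: F0; rewrite (near_shift 0 q); apply: filterS => h /=; rewrite subr0.
near=> h.
have hd : `|h| < d by near: h.
have kd : `|g (h + q) - g q| < d by near: h.
have Fh : F (h + q, g (h + q)) = 0 by near: h.
rewrite /=; set k := g (h + q) - g q in kd *.
have := Hd (h, k); rewrite -ball_normE /= sub0r normrN prod_normE /= gt_max hd kd => /(_ isT).
have -> : (h, k) + (q, g q) = (h + q, g (h + q)) by congr (_, _); rewrite /k subrK.
rewrite Fh (nbhs_singleton F0) subrr sub0r normrN.
have -> : 'd F (q, g q) (h, k) = A h + k * B.
  rewrite /A /B deriveE // -[k * _]linearZ -linearD; congr ('d F _ _).
  by congr (_, _) => /=; rewrite ?scaler0 ?addr0 // add0r [_ *: _]mulr1.
move=> HH.
have HH2 : `|A h + k * B| <= c * (`|h| + `|k|).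
  apply: (le_trans HH); rewrite ler_pM2l // ge_max lerDl normr_ge0 lerDr normr_ge0 //.
have cB : c <= `|B| / 2 by rewrite ge_min lexx.
have cE : c <= e * `|B| / (1 + K) by rewrite ge_min lexx orbT.
have kB : `|k| * `|B| <= M * `|h| + c * (`|h| + `|k|).
  rewrite -normrM (_ : k * B = (A h + k * B) - A h); last by rewrite addrAC subrr add0r.
  by rewrite (le_trans (ler_normB _ _)) // addrC lerD.
have kK : `|k| <= K * `|h|.
  have : `|k| * `|B| <= M * `|h| + `|B| / 2 * (`|h| + `|k|).
    by rewrite (le_trans kB) // lerD2l ler_wpM2r // addr_ge0.
  rewrite mulrDr addrA -lerBlDr (_ : _ - _ = `|k| * (`|B| / 2)); last first.
    by rewrite {1}(splitr `|B|) mulrDr [_ / 2 * `|k|]mulrC addrK.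
  rewrite -ler_pdivlMr ?divr_gt0 // => /le_trans; apply.
  rewrite -mulrDl mulrAC ler_wpM2r //.
  by rewrite mulrDl divff ?gt_eqF ?divr_gt0 // invf_div /K mulrA [M * 2]mulrC.
rewrite (_ : k - _ = B^-1 * (A h + k * B)); last first.
  by rewrite mulNr opprK mulrDr addrC mulrCA mulVf // mulr1.
rewrite normrM normfV ler_pdivrMl //.
apply: (le_trans HH2); apply: (@le_trans _ _ (c * ((1 + K) * `|h|))).
  by rewrite ler_pM2l // mulrDl mul1r lerD2l.
rewrite mulrA [leRHS]mulrA ler_wpM2r //.
by rewrite -ler_pdivlMr // [`|B| * e]mulrC.
Unshelve. all: by end_near. Qed.

Lemma continuous_graph V W (g : V -> W) x : {for x, continuous g} -> {for x, continuous (fun q => (q, g q))}.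
Proof.
move=> c P [[A B] /= [nA nB] AB]; have nB' : nbhs x (g @^-1` B) by apply: c.
by apply: filterS2 nA nB' => y Ay By; apply: (AB (y, g y)).
Qed.

Lemma near_fst V W (p : V) (q : W) (P : V -> Prop) : (\forall x \near p, P x) ->
  \forall z \near (p, q), P z.1.
Proof. by move=> H; exists (P, setT) => [|x []] //; split=> //; exact: filterT. Qed.

Lemma near_snd V W (p : V) (q : W) (P : W -> Prop) : (\forall x \near q, P x) ->
  \forall z \near (p, q), P z.2.
Proof. by move=> H; exists (setT, P) => [|x []] //; split=> //; exact: filterT. Qed.

(* F is increasing in its last variable near (p, s0), so each slice has a single
   zero near s0, found by the intermediate value theorem. *)
Lemma ift_cont V (F : V * R -> R) (p : V) (s0 : R) :
  smooth F (p, s0) -> F (p, s0) = 0 -> 'D_(0, 1) F (p, s0) != 0 ->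
  exists2 g : V -> R, {for p, continuous g} &
    \forall z \near (p, s0), F z = 0 <-> z.2 = g z.1.
Proof.
move=> sF F0 D0.
wlog Dp : F sF F0 D0 / 0 < 'D_(0, 1) F (p, s0).
  move=> H; have [D1|D1] := ltP 0 ('D_(0, 1) F (p, s0)); first exact: H.
  have DN : 'D_(0, 1) (fun z => - F z) (p, s0) = - 'D_(0, 1) F (p, s0).
    by apply: derive_N; exact: smooth_diff.
  have [||||g cg Hg] := H (fun z => - F z).
  - exact: smooth_N.
  - by rewrite F0 oppr0.
  - by rewrite DN oppr_eq0.
  - by rewrite DN oppr_gt0 lt_neqAle D0.
  exists g => //; apply: filterS Hg => z <-.
  by split=> [->|/eqP]; rewrite ?oppr0 // oppr_eq0 => /eqP.
have n1 : \forall z \near (p, s0), differentiable F z /\ 0 < 'D_(0, 1) F z.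
  have h1 := smooth_diff_nbhs sF.
  have c := smooth_continuous (smooth_derive ((0, 1) : V * R) sF).
  have h2 : \forall z \near (p, s0), 0 < 'D_(0, 1) F z.
    by apply: (c [set x | 0 < x]); apply: open_nbhs_nbhs; split=> //; exact: open_gt.
  by near=> z; split; near: z.
move: n1 => /nbhs_ballP[e2 /= e20 H2].
(* Half the radius, so that the closed interval |s - s0| <= e stays inside the ball where F is
   increasing in s. *)
pose e := e2 / 2; have e0 : 0 < e by rewrite divr_gt0.
have ee2 : e < e2 by rewrite /e ltr_pdivrMr // mulr2n mulrDr mulr1 ltrDl.
have Hb q s : ball p e2 q -> `|s - s0| <= e -> differentiable F (q, s) /\ 0 < 'D_(0, 1) F (q, s).
  by move=> bq bs; apply: (H2 (q, s)); split=> //=; rewrite -ball_normE /= distrC (le_lt_trans bs).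
have mono q s t : ball p e2 q -> `|s - s0| <= e -> `|t - s0| <= e -> s < t -> F (q, s) < F (q, t).
  move=> bq bs bt st.
  have Hx x : 0 <= x <= t - s -> differentiable F ((q, s) + x *: (0, 1)) /\
       0 < 'D_(0, 1) F ((q, s) + x *: (0, 1)).
    move=> /andP[x0 xt].
    rewrite (_ : _ + _ = (q, s + x)); last by congr (_, _) => /=; rewrite ?scaler0 ?addr0 // [_ *: _]mulr1.
    apply: Hb => //; rewrite ler_norml; move: bs bt; rewrite !ler_norml => /andP[h1 h2] /andP[h3 h4].
    apply/andP; split; first by rewrite (le_trans h1) // lerD2r lerDl.
    by rewrite (le_trans _ h4) // lerD2r -lerBrDl.
  have [||c /andP[c0 ct]] := @mvt_line _ F (q, s) (0, 1) (t - s).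
  - by rewrite subr_gt0.
  - by move=> x /Hx[].
  rewrite (_ : (q, s) + (t - s) *: _ = (q, t)); last first.
    by congr (_, _) => /=; rewrite ?scaler0 ?addr0 // [_ *: _]mulr1 addrCA subrr addr0.
  move=> E; rewrite -subr_gt0 E mulr_gt0 ?subr_gt0 //.
  by apply: (Hx c _).2; rewrite !ltW.
have inj q s t : ball p e2 q -> `|s - s0| <= e -> `|t - s0| <= e -> F (q, s) = F (q, t) -> s = t.
  move=> bq bs bt E; case: (ltgtP s t) => // h.
    by have := mono q s t bq bs bt h; rewrite E ltxx.
  by have := mono q t s bq bt bs h; rewrite E ltxx.
(* The signs of F at s0 - d and s0 + d persist for q near p. The case d = e makes the zero exist,
   small d gives the continuity of the zero at p. *)
have good d : 0 < d -> d <= e -> \forall q \near p, exists2 s, `|s - s0| <= d & F (q, s) = 0.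
  move=> d0 de.
  have bp : ball p e2 p by exact: ballxx.
  have m1 : F (p, s0 - d) < 0.
    rewrite -F0; apply: mono => //; last by rewrite ltrBlDr ltrDl.
      by rewrite addrAC subrr add0r normrN gtr0_norm.
    by rewrite subrr normr0 ltW.
  have m2 : 0 < F (p, s0 + d).
    rewrite -F0; apply: mono => //; last by rewrite ltrDl.
      by rewrite subrr normr0 ltW.
    by rewrite addrAC subrr add0r gtr0_norm.
  have cF s : `|s - s0| <= e -> {for p, continuous (fun q => F (q, s))}.
    move=> hs; apply: (@continuous_comp _ _ _ (fun q => (q, s)) F).
      by apply: smooth_continuous; apply: smooth_pair; [exact: smooth_id|exact: smooth_cst].
    by apply: differentiable_continuous; exact: (Hb p s bp hs).1.
  have c1 : \forall q \near p, F (q, s0 - d) < 0.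
    apply: (cF (s0 - d) _ [set x | x < 0]); first by rewrite addrAC subrr add0r normrN gtr0_norm.
    by apply: open_nbhs_nbhs; split=> //; exact: open_lt.
  have c2 : \forall q \near p, 0 < F (q, s0 + d).
    apply: (cF (s0 + d) _ [set x | 0 < x]); first by rewrite addrAC subrr add0r gtr0_norm.
    by apply: open_nbhs_nbhs; split=> //; exact: open_gt.
  have c3 : \forall q \near p, ball p e2 q by exact: nbhsx_ballx.
  near=> q.
  have h1 : F (q, s0 - d) < 0 by near: q.
  have h2 : 0 < F (q, s0 + d) by near: q.
  have h3 : ball p e2 q by near: q.
  have [|||s sd Fs] := @IVT R (fun s => F (q, s)) (s0 - d) (s0 + d) 0.
  - by rewrite lerD2l (le_trans _ (ltW d0)) // oppr_le0 ltW.
  - apply: continuous_in_subspaceT => x; rewrite inE /= in_itv /= => /andP[x1 x2].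
    apply: (@continuous_comp _ _ _ (fun s => (q, s)) F).
      by apply: smooth_continuous; apply: smooth_pair; [exact: smooth_cst|exact: smooth_id].
    apply: differentiable_continuous; apply: (Hb q x h3 _).1.
    by rewrite (le_trans _ de) // ler_norml; apply/andP; split; lra.
  - by rewrite ge_min (ltW h1) /= le_max (ltW h2) orbT.
  exists s => //; move: sd; rewrite in_itv /= => /andP[x1 x2].
  by rewrite ler_norml; apply/andP; split; lra.
(* The default s0 is taken only at those q that have no zero in the interval; [good] excludes them
   near p, and [inj] makes the chosen zero the only one. *)
pose g q := xget s0 [set s | `|s - s0| <= e /\ F (q, s) = 0].
have gP q s : ball p e2 q -> `|s - s0| <= e -> F (q, s) = 0 -> g q = s.
  move=> bq bs Fs; rewrite /g; case: xgetP => [y _ [y1 y2]|/(_ s)]; last by case.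
  by apply: (inj q) => //; rewrite Fs.
have bn : \forall q \near p, ball p e2 q by exact: nbhsx_ballx.
have gp : g p = s0 by apply: gP => //; [exact: ballxx|rewrite subrr normr0 ltW].
exists g.
  apply/cvgrPdist_le => d d0; pose d' := Num.min d e.
  have d'0 : 0 < d' by rewrite lt_min d0.
  have := good d' d'0; rewrite ge_min lexx orbT => /(_ isT) G.
  near=> q.
  have [s sd Fs] : exists2 s, `|s - s0| <= d' & F (q, s) = 0 by near: q.
  have bq : ball p e2 q by near: q.
  move: sd; rewrite le_min => /andP[sd se].
  by rewrite gp (gP q s) // distrC.
have G := good e e0 (lexx e).
have n1 : \forall z \near (p, s0), ball p e2 z.1 /\ exists2 s, `|s - s0| <= e & F (z.1, s) = 0.
  apply: (near_fst s0 (P := fun q => ball p e2 q /\ exists2 s, `|s - s0| <= e & F (q, s) = 0)).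
  by near=> q; split; near: q.
have n2 : \forall z \near (p, s0), `|z.2 - s0| <= e.
  apply: (near_snd p (P := fun x => `|x - s0| <= e)).
  by apply/nbhs_ballP; exists e => // x; rewrite -ball_normE /= distrC => /ltW.
near=> z.
have [bz [s se Fs]] : ball p e2 z.1 /\ exists2 s, `|s - s0| <= e & F (z.1, s) = 0 by near: z.
have ze : `|z.2 - s0| <= e by near: z.
rewrite (gP z.1 s) //; split=> [Fz|zs]; last by rewrite (surjective_pairing z) zs.
by apply: (inj z.1) => //; rewrite Fs -surjective_pairing.
Unshelve. all: by end_near. Qed.

(** [ift_cont] yields continuity at p alone. Used again at nearby zeros it yields continuity around
    p, hence differentiability there. The formula D_v g = - D_(v,0) F / D_(0,1) F expresses the
    derivatives of g through g itself, so each order of smoothness of g gives the next one. *)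
Lemma ift V (F : V * R -> R) (p : V) (s0 : R) : findim V ->
  smooth F (p, s0) -> F (p, s0) = 0 -> 'D_(0, 1) F (p, s0) != 0 ->
  exists2 g : V -> R, smooth g p &
    \forall z \near (p, s0), F z = 0 <-> z.2 = g z.1.
Proof.
move=> fV sF F0 D0; have [g cg Hg] := ift_cont sF F0 D0.
exists g => //; have fVR := findim_prod fV findimR.
have gp : g p = s0 by symmetry; apply: (nbhs_singleton Hg).1.
have cpg := @continuous_graph V R g.
have pull (P : V * R -> Prop) : (\forall z \near (p, s0), P z) -> \forall q \near p, P (q, g q).
  by move=> HP; apply: (cpg p cg P); rewrite gp.
have sB := smooth_derive ((0, 1) : V * R) sF.
have n0 : \forall q \near p, F (q, g q) = 0.
  by apply: filterS (pull _ Hg) => q /= H; apply/H.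
have n1 := pull _ (smooth_nbhs sF).
have n2 : \forall q \near p, 'D_(0, 1) F (q, g q) != 0.
  by apply: (pull (fun z => 'D_(0, 1) F z != 0)); apply: near_neq0 => //; exact: smooth_continuous.
(* The implicit function obtained at (q, g q) coincides with g near q by local uniqueness, and so
   transfers its continuity at q. *)
have n3 : \forall q \near p, {for q, continuous g}.
  have n4 := pull _ (near_join Hg).
  have n0' := n0; near=> q.
  have [|||g' cg' Hg'] := @ift_cont V F q (g q).
  - by near: q.
  - by near: q.
  - by near: q.
  have g'q : g' q = g q by symmetry; apply: (nbhs_singleton Hg').1; near: q.
  have h : \forall z \near (q, g q), F z = 0 <-> z.2 = g z.1 by near: q.
  have e : \forall x \near q, g' x = g x.
    have c' : {for q, continuous (fun q => (q, g' q))} by exact: continuous_graph.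
    have h1 : \forall x \near q, F (x, g' x) = 0 <-> g' x = g x.
      by apply: (c' (fun z => F z = 0 <-> z.2 = g z.1)); rewrite g'q.
    have h2 : \forall x \near q, F (x, g' x) = 0 <-> g' x = g' x.
      by apply: (c' (fun z => F z = 0 <-> z.2 = g' z.1)); rewrite g'q.
    by near=> x; apply: (near h1 x _).1 => //; apply: (near h2 x _).2.
  rewrite /prop_for /continuous_at -g'q; apply: cvg_trans (cg').
  exact: near_eq_cvg.
have n4 : \forall q \near p, differentiable g q.
  have n0' := near_join n0; near=> q; apply: (@implicit_differentiable V F).
  - by apply: smooth_diff; near: q.
  - by near: q.
  - by near: q.
  - by near: q.
have dg : \forall q \near p, forall v, 'D_v g q =
    - ('D_(v, 0) F (q, g q) * ('D_(0, 1) F (q, g q))^-1).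
  have n0' := near_join n0; near=> q => v.
  have dgq : differentiable g q by near: q.
  have sFq : smooth F (q, g q) by near: q.
  have B0 : 'D_(0, 1) F (q, g q) != 0 by near: q.
  have dp : differentiable (fun q => (q, g q)) q by apply: differentiable_pair.
  have : 'D_v (fun x => F (x, g x)) q = 0.
    rewrite (near_eq_derive (g := fun _ => 0)) ?derive_cst //.
    by near: q.
  rewrite derive_comp //; last exact: smooth_diff.
  have -> : 'D_v (fun x => (x, g x)) q = (v, 0) + 'D_v g q *: (0, 1).
    rewrite deriveE // diff_pair //= diff_val -deriveE //.
    by congr (_, _) => /=; rewrite ?scaler0 ?addr0 // add0r [_ *: _]mulr1.
  rewrite derive_dirD; last exact: smooth_diff.
  have key (a b c : R) : c != 0 -> a + b * c = 0 -> b = - (a * c^-1).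
    by move=> c0 /eqP; rewrite addr_eq0 => /eqP ->; rewrite mulNr opprK mulfK.
  exact: key.
have [U [oU Up] CU] := (smoothP _ _).1 sF.
pose U' := U `&` interior [set z | 'D_(0, 1) F z != 0].
have oU' : open U' by apply: openI => //; exact: open_interior.
have n5 : \forall q \near p, U' (q, g q).
  apply: (pull U'); apply: near_open => //; split; first exact: Up.
  exact: (near_neq0 (smooth_continuous sB) D0).
apply/smoothP; exists (interior [set q | [/\ differentiable g q, U' (q, g q) &
   forall v, 'D_v g q = - ('D_(v, 0) F (q, g q) * ('D_(0, 1) F (q, g q))^-1)]]).
  split; first exact: open_interior.
  by near=> q; split; near: q.
set G := interior _; have oG : open G by exact: open_interior.
have GP q : G q -> [/\ differentiable g q, U' (q, g q) &
   forall v, 'D_v g q = - ('D_(v, 0) F (q, g q) * ('D_(0, 1) F (q, g q))^-1)].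
  by move=> /interior_subset.
elim=> [|n IH]; first by split=> // q /GP[].
rewrite CkE; split=> [q /GP[]//|v].
apply: (@eq_Ck _ _ _ _ (fun q => (-1) * ('D_(v, 0) F (q, g q) * ('D_(0, 1) F (q, g q))^-1))) => //.
  by move=> q /GP[_ _ ->]; rewrite mulN1r.
have Cp : Ck n G (fun q => (q, g q)).
  apply: Ck_pair => //; have [W [oW Wp] HW] := (smoothP _ _).1 (smooth_id p).
  by have := @smooth_id V; move=> si; case: n {IH} => [|n]; [split=> // q _; exact: ex_diff|rewrite CkE; split=> [q _|w]; [exact: ex_diff|rewrite (_ : 'D_w _ = fun _ => w); [exact: Ck_cst|apply: funext => x; rewrite derive_id]]].
apply: Ck_M => //; first exact: Ck_cst.
have CC w : Ck n U' ('D_w F) by have [_ /(_ w) h] := CU n.+1; apply: Ck_sub h => q [].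
apply: Ck_M => //; first by apply: (@Ck_comp _ _ _ _ U' ('D_(v, 0) F)) => // q /GP[].
apply: Ck_V => //; first by move=> q /GP[_ [_ /interior_subset]].
by apply: (@Ck_comp _ _ _ _ U' ('D_(0, 1) F)) => // q /GP[].
Unshelve. all: by end_near. Qed.

End SmoothMaps.

(** * Contact of finite order *)

Section Flat.
Context {R : realType}.
Implicit Types V W Z : normedModType R.

(* Contact of order m: f and g have the same m-jet at p iff f - g is flat. *)
Definition flat m V W (f : V -> W) (p : V) : Prop :=
  forall vs : seq V, (size vs <= m)%N -> iterD vs f p = 0.

Lemma near_comp V W (g : V -> W) p (P : W -> Prop) : {for p, continuous g} ->
  (\forall z \near g p, P z) -> \forall q \near p, P (g q).
Proof. by move=> cg HP; apply: cg. Qed.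

Lemma flatS m V W (f : V -> W) p :
  flat m.+1 f p <-> f p = 0 /\ forall v, flat m ('D_v f) p.
Proof.
split=> [H|[H0 H] vs].
  split=> [|v vs sv]; first exact: (H [::]).
  by have := H (rcons vs v); rewrite size_rcons -cats1 iterD_cat; apply.
case/lastP: vs => // vs v; rewrite size_rcons -cats1 iterD_cat => sv.
exact: H.
Qed.

Lemma flat0 V W (f : V -> W) p : flat 0 f p <-> f p = 0.
Proof. by split=> [H|H [|//]]; first exact: (H [::]). Qed.

Lemma flat_val m V W (f : V -> W) p : flat m f p -> f p = 0.
Proof. by move=> /(_ [::]); apply. Qed.

Lemma flat_le m n V W (f : V -> W) p : (n <= m)%N -> flat m f p -> flat n f p.
Proof. by move=> nm H vs sv; apply: H; apply: leq_trans nm. Qed.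

Lemma eq_flat m V W (f g : V -> W) p : (\forall q \near p, f q = g q) -> flat m f p -> flat m g p.
Proof. by move=> fg H vs sv; rewrite -(nbhs_singleton (eq_near_iterD vs fg)); apply: H. Qed.

Lemma flat_zero m V W (p : V) : flat m (fun _ => 0 : W) p.
Proof.
elim: m => [|m IH]; first exact/flat0.
apply/flatS; split=> // v; apply: eq_flat IH; near=> q; by rewrite derive_cst.
Unshelve. all: by end_near. Qed.

Lemma flat_D m V W (f g : V -> W) p : smooth f p -> smooth g p ->
  flat m f p -> flat m g p -> flat m (fun q => f q + g q) p.
Proof.
elim: m f g => [|m IH] f g sf sg; first by move=> /flat0 f0 /flat0 g0; apply/flat0; rewrite f0 g0 addr0.
move=> /flatS[f0 Df] /flatS[g0 Dg]; apply/flatS; split=> [|v]; first by rewrite f0 g0 addr0.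
apply: (@eq_flat _ _ _ (fun q => 'D_v f q + 'D_v g q)).
  have df := smooth_diff_nbhs sf; have dg := smooth_diff_nbhs sg.
  by near=> q; rewrite derive_D //; near: q.
by apply: IH => //; apply: smooth_derive.
Unshelve. all: by end_near. Qed.

Lemma flat_M m V (k f : V -> R) p : smooth k p -> smooth f p ->
  flat m f p -> flat m (fun q => k q * f q) p.
Proof.
elim: m k f => [|m IH] k f sk sf; first by move=> /flat0 f0; apply/flat0; rewrite f0 mulr0.
move=> ff; have [f0 Df] := (flatS _ _ _).1 ff; apply/flatS; split=> [|v]; first by rewrite f0 mulr0.
apply: (@eq_flat _ _ _ (fun q => k q * 'D_v f q + 'D_v k q * f q)).
  have df := smooth_diff_nbhs sf; have dk := smooth_diff_nbhs sk.
  by near=> q; rewrite derive_M ?[f q * _]mulrC //; near: q.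
have sDf := smooth_derive v sf; have sDk := smooth_derive v sk.
apply: flat_D; try exact: smooth_M; first exact: IH.
by apply: IH => //; apply: flat_le ff.
Unshelve. all: by end_near. Qed.

Lemma flat_N m V (f : V -> R) p : smooth f p -> flat m f p -> flat m (fun q => - f q) p.
Proof.
move=> sf ff; apply: (@eq_flat _ _ _ (fun q => (-1) * f q)); first by near=> q; rewrite mulN1r.
by apply: flat_M => //; exact: smooth_cst.
Unshelve. all: by end_near. Qed.

Lemma flat_B m V (f g : V -> R) p : smooth f p -> smooth g p ->
  flat m f p -> flat m g p -> flat m (fun q => f q - g q) p.
Proof. by move=> sf sg ff fg; apply: flat_D => //; [exact: smooth_N|exact: flat_N]. Qed.

Lemma flat_sum m V (I : Type) (r : seq I) (P : pred I) (F : I -> V -> R) p :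
  (forall i, P i -> smooth (F i) p) -> (forall i, P i -> flat m (F i) p) ->
  flat m (fun q => \sum_(i <- r | P i) F i q) p.
Proof.
move=> sF fF; elim: r => [|i r IH].
  by apply: eq_flat (@flat_zero m V R p); near=> q; rewrite big_nil.
case Pi: (P i); last by apply: eq_flat IH; near=> q; rewrite big_cons Pi.
apply: (@eq_flat _ _ _ (fun q => F i q + \sum_(i <- r | P i) F i q)).
  by near=> q; rewrite big_cons Pi.
by apply: flat_D => //; [exact: sF|exact: smooth_sum|exact: fF].
Unshelve. all: by end_near. Qed.

Lemma flat_lin m V W Z (l : {linear W -> Z}) (f : V -> W) p : continuous l ->
  smooth f p -> flat m f p -> flat m (fun q => l (f q)) p.
Proof.
move=> cl; elim: m f => [|m IH] f sf; first by move=> /flat0 f0; apply/flat0; rewrite f0 linear0.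
move=> /flatS[f0 Df]; apply/flatS; split=> [|v]; first by rewrite f0 linear0.
apply: (@eq_flat _ _ _ (fun q => l ('D_v f q))); last by apply: IH => //; exact: smooth_derive.
have df := smooth_diff_nbhs sf.
by near=> q; rewrite derive_lin //; near: q.
Unshelve. all: by end_near. Qed.

Lemma smooth_Bv V W (f g : V -> W) p : smooth f p -> smooth g p -> smooth (fun q => f q - g q) p.
Proof.
move=> sf sg; apply: smooth_D => //.
apply: (smooth_lin (l := [the {linear W -> W} of -%R]) _ sg) => x.
by apply: cvgN; exact: cvg_id.
Qed.

Lemma derive_compE V W (I : finType) (e : I -> W) (c : I -> {linear W -> R^o}) (f : W -> R) (g : V -> W) p v :
  (forall w, w = \sum_i c i w *: e i) ->
  smooth f (g p) -> smooth g p ->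
  \forall q \near p, 'D_v (fun x => f (g x)) q = \sum_i c i ('D_v g q) * 'D_(e i) f (g q).
Proof.
move=> ec sf sg; have dg := smooth_diff_nbhs sg.
have df : \forall q \near p, differentiable f (g q).
  exact: (near_comp (smooth_continuous sg) (smooth_diff_nbhs sf)).
near=> q.
have dfq : differentiable f (g q) by near: q.
have dgq : differentiable g q by near: q.
by rewrite derive_comp // [in LHS](ec ('D_v g q)) derive_sumv.
Unshelve. all: by end_near. Qed.

(** By the chain rule, a derivative of the difference is a sum of products of derivatives of f and
    of g. Telescoping each product leaves one factor covered by induction on the partial derivatives
    of f and one covered by the contact of g and g'. *)
Lemma agree_comp m V W (f : W -> R) (g g' : V -> W) p : findim W ->
  smooth f (g p) -> smooth g p -> smooth g' p ->
  flat m (fun q => g q - g' q) p -> flat m (fun q => f (g q) - f (g' q)) p.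
Proof.
move=> fW; have [I [e [c [cc ec]]]] := fW; elim: m f => [|m IH] f sf sg sg' Hg.
all: have e0 : g p = g' p by apply/eqP; rewrite -subr_eq0; apply/eqP; exact: flat_val Hg.
  by apply/flat0; rewrite e0 subrr.
have sf' : smooth f (g' p) by rewrite -e0.
have sfg := smooth_comp fW sf sg; have sfg' := smooth_comp fW sf' sg'.
apply/flatS; split=> [|v]; first by rewrite e0 subrr.
pose T i q := c i ('D_v g q) * ('D_(e i) f (g q) - 'D_(e i) f (g' q)) +
   'D_(e i) f (g' q) * c i ('D_v g q - 'D_v g' q).
apply: (@eq_flat _ _ _ (fun q => \sum_i T i q)).
  have E1 := derive_compE v ec sf sg; have E2 := derive_compE v ec sf' sg'.
  have d1 := smooth_diff_nbhs sfg; have d2 := smooth_diff_nbhs sfg'.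
  near=> q.
  rewrite derive_B; [|by near: q|by near: q].
  rewrite (near E1 q) // (near E2 q) // -sumrB; apply: eq_bigr => i _.
  by rewrite /T linearB /=; ring.
have sDg := smooth_derive v sg; have sDg' := smooth_derive v sg'.
have sDf i : smooth (fun q => 'D_(e i) f (g q)) p by apply: (smooth_comp (f := 'D_(e i) f)) => //; exact: smooth_derive.
have sDf' i : smooth (fun q => 'D_(e i) f (g' q)) p by apply: (smooth_comp (f := 'D_(e i) f)) => //; exact: smooth_derive.
have s1 i : smooth (fun q => 'D_(e i) f (g q) - 'D_(e i) f (g' q)) p by exact: smooth_B.
have s2 i : smooth (fun q => c i ('D_v g q)) p by exact: smooth_lin.
have s3 i : smooth (fun q => c i ('D_v g q - 'D_v g' q)) p by apply: smooth_lin => //; exact: smooth_Bv.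
apply: flat_sum => i _; first by apply: smooth_D; exact: smooth_M.
apply: flat_D; try exact: smooth_M.
  apply: flat_M => //; apply: (IH ('D_(e i) f)) => //; first exact: smooth_derive.
  exact: flat_le Hg.
apply: flat_M => //; apply: flat_lin => //; first exact: smooth_Bv.
have [_ /(_ v)] := (flatS _ _ _).1 Hg; apply: eq_flat.
have d1 := smooth_diff_nbhs sg; have d2 := smooth_diff_nbhs sg'.
by near=> q; rewrite derive_B //; near: q.
Unshelve. all: by end_near. Qed.

Lemma flat_comp m V W (f : W -> R) (g : V -> W) p : findim W ->
  smooth f (g p) -> smooth g p -> flat m f (g p) -> flat m (fun q => f (g q)) p.
Proof.
move=> fW; have [I [e [c [cc ec]]]] := fW; elim: m f => [|m IH] f sf sg.
  by move=> /flat0 f0; apply/flat0.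
move=> /flatS[f0 Df]; apply/flatS; split=> // v.
apply: (@eq_flat _ _ _ (fun q => \sum_i c i ('D_v g q) * 'D_(e i) f (g q))).
  by apply: filterS (derive_compE v ec sf sg) => q ->.
have sDg := smooth_derive v sg.
have sDf i : smooth (fun q => 'D_(e i) f (g q)) p by apply: (smooth_comp (f := 'D_(e i) f)) => //; exact: smooth_derive.
have s2 i : smooth (fun q => c i ('D_v g q)) p by exact: smooth_lin.
apply: flat_sum => i _; first exact: smooth_M.
by apply: flat_M => //; apply: (IH ('D_(e i) f)) => //; exact: smooth_derive.
Qed.

Lemma derive_graph V (g : V -> R) q v : differentiable g q ->
  'D_v (fun x => (x, g x)) q = (v, 0) + 'D_v g q *: (0, 1).
Proof.
move=> dg; rewrite deriveE; last exact: differentiable_pair.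
rewrite diff_pair //= diff_val -deriveE //.
by congr (_, _) => /=; rewrite ?scaler0 ?addr0 // add0r [_ *: _]mulr1.
Qed.

Lemma derive_comp_graph V (F : V * R -> R) (g : V -> R) q v : differentiable g q ->
  differentiable F (q, g q) ->
  'D_v (fun x => F (x, g x)) q = 'D_(v, 0) F (q, g q) + 'D_v g q * 'D_(0, 1) F (q, g q).
Proof.
move=> dg dF; rewrite derive_comp //; last exact: differentiable_pair.
by rewrite derive_graph // derive_dirD.
Qed.

(** Finite-order uniqueness of implicit functions: if g' satisfies the equation of g up to a flat
    defect, it has contact with g to the same order. The differentiated defect is solved for D_v g -
    D_v g' on dividing by D_(0,1) F; by induction the differences A and B of the coefficients are
    flat to order m. *)
Lemma agree_implicit m V (F : V * R -> R) (g g' : V -> R) p : findim V ->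
  smooth F (p, g p) -> 'D_(0, 1) F (p, g p) != 0 ->
  smooth g p -> smooth g' p -> g p = g' p ->
  flat m (fun q => F (q, g q) - F (q, g' q)) p -> flat m (fun q => g q - g' q) p.
Proof.
move=> fV sF B0 sg sg' e0; have fVR := findim_prod fV (@findimR R).
elim: m => [|m IH] Hm; first by apply/flat0; rewrite e0 subrr.
have IHm := IH (flat_le (leqnSn m) Hm).
have si := @smooth_id R V p.
have sG : smooth (fun q => (q, g q)) p by exact: smooth_pair.
have sG' : smooth (fun q => (q, g' q)) p by exact: smooth_pair.
have sF' : smooth F (p, g' p) by rewrite -e0.
have B0' : 'D_(0, 1) F (p, g' p) != 0 by rewrite -e0.
have agG : flat m (fun q => (q, g q) - (q, g' q)) p.
  apply: (@eq_flat _ _ _ (fun q => (0, g q - g' q))).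
    by near=> q; congr (_, _) => /=; rewrite subrr.
  apply: (flat_lin (l := linF (@inr_linear R V R))) => //; first exact: continuous_inr.
  exact: smooth_B.
have agF w : flat m (fun q => 'D_w F (q, g q) - 'D_w F (q, g' q)) p.
  by apply: (agree_comp (f := 'D_w F)) => //; apply: smooth_derive.
have sFG w : smooth (fun q => 'D_w F (q, g q)) p.
  by apply: (smooth_comp (f := 'D_w F)) => //; exact: smooth_derive.
have sFG' w : smooth (fun q => 'D_w F (q, g' q)) p.
  by apply: (smooth_comp (f := 'D_w F)) => //; exact: smooth_derive.
have sC : smooth (fun q => F (q, g q)) p by exact: smooth_comp.
have sC' : smooth (fun q => F (q, g' q)) p by exact: smooth_comp.
apply/flatS; split=> [|v]; first by rewrite e0 subrr.
have [_ /(_ v) HD] := (flatS _ _ _).1 Hm.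
pose D q := 'D_v (fun q => F (q, g q) - F (q, g' q)) q.
pose A q := 'D_(v, 0) F (q, g q) - 'D_(v, 0) F (q, g' q).
pose B q := 'D_(0, 1) F (q, g q) - 'D_(0, 1) F (q, g' q).
have sA : smooth A p by exact: smooth_B.
have sB : smooth B p by exact: smooth_B.
have sD : smooth D p by apply: smooth_derive; exact: smooth_B.
have sDg := smooth_derive v sg; have sDg' := smooth_derive v sg'.
have sBg : smooth (fun q => 'D_v g q * B q) p by exact: smooth_M.
have sDA : smooth (fun q => D q - A q) p by exact: smooth_B.
apply: (@eq_flat _ _ _ (fun q => ('D_(0, 1) F (q, g' q))^-1 * ((D q - A q) - 'D_v g q * B q))).
  have d1 := smooth_diff_nbhs sg; have d2 := smooth_diff_nbhs sg'.
  have d3 := smooth_diff_nbhs sC; have d4 := smooth_diff_nbhs sC'.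
  have d5 : \forall q \near p, differentiable F (q, g q).
    exact: (near_comp (smooth_continuous sG) (smooth_diff_nbhs sF)).
  have d6 : \forall q \near p, differentiable F (q, g' q).
    exact: (near_comp (smooth_continuous sG') (smooth_diff_nbhs sF')).
  have d7 : \forall q \near p, 'D_(0, 1) F (q, g' q) != 0.
    exact: (near_neq0 (smooth_continuous (sFG' (0, 1))) B0').
  near=> q.
  have h7 : 'D_(0, 1) F (q, g' q) != 0 by near: q.
  rewrite derive_B; [|by near: q|by near: q].
  rewrite /D derive_B; [|by near: q|by near: q].
  rewrite derive_comp_graph; [|by near: q|by near: q].
  rewrite derive_comp_graph; [|by near: q|by near: q].
  by rewrite /A /B; move: h7; move: ('D_(0, 1) F (q, g' q)) ('D_(0, 1) F (q, g q)) ('D_v g q) ('D_v g' q) ('D_(v, 0) F (q, g q)) ('D_(v, 0) F (q, g' q)) => a b c d x y a0; field.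
apply: flat_M; [exact: smooth_V|exact: smooth_B|].
have fA : flat m A p := agF (v, 0).
have fB : flat m B p := agF (0, 1).
exact: (flat_B sDA sBg (flat_B sD sA HD fA) (flat_M sDg sB fB)).
Unshelve. all: by end_near. Qed.

Lemma nseq_rcons k (T : Type) (v : T) : nseq k.+1 v = nseq k v ++ [:: v].
Proof. by rewrite cats1; elim: k => //= k ->. Qed.

(* Uniqueness of formal solutions of the noncharacteristic Cauchy problem
   X D_v H + Y D_w H = 0 with zero data on the line R v. *)
Lemma flat_transport m V (v w : V) (X Y H : V -> R) p :
  (forall u, exists a b, u = a *: v + b *: w) ->
  smooth X p -> smooth Y p -> smooth H p -> Y p != 0 ->
  (forall k, (k <= m)%N -> iterD (nseq k v) H p = 0) ->
  (forall n, (n < m)%N -> flat n (fun q => X q * 'D_v H q + Y q * 'D_w H q) p) ->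
  flat m H p.
Proof.
move=> span sX sY sH Y0; elim: m H sH => [|m IH] H sH Hline HY.
  by apply/flat0; exact: (Hline 0%N).
have fH : flat m H p by apply: IH => // [k km|n nm]; [apply: Hline|apply: HY]; exact: leqW.
have sv := smooth_derive v sH; have sw := smooth_derive w sH.
have svv := smooth_derive v sv; have swv := smooth_derive w sv.
have sDX := smooth_derive v sX; have sDY := smooth_derive v sY.
have sE : smooth (fun q => X q * 'D_v H q + Y q * 'D_w H q) p by apply: smooth_D; exact: smooth_M.
(* D_v H satisfies the same transport equation up to the terms in which X and Y are differentiated,
   and these are flat because H already is to order m. *)
have fv : flat m ('D_v H) p.
  apply: IH => // [k km|n nm].
    by rewrite -[iterD _ _]/(iterD (nseq k v) (iterD [:: v] H)) -iterD_cat -nseq_rcons; apply: Hline.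
  have fn z : flat n ('D_z H) p.
    by have /flatS[_ h] := flat_le nm fH; exact: h.
  pose T q := ('D_v (fun q => X q * 'D_v H q + Y q * 'D_w H q) q - 'D_v X q * 'D_v H q) - 'D_v Y q * 'D_w H q.
  apply: (@eq_flat _ _ _ T).
    have d1 := smooth_diff_nbhs sX; have d2 := smooth_diff_nbhs sY.
    have d3 := smooth_diff_nbhs sv; have d4 := smooth_diff_nbhs sw.
    have d5 := smooth_nbhs sH.
    near=> q.
    have h1 : differentiable X q by near: q.
    have h2 : differentiable Y q by near: q.
    have h3 : differentiable ('D_v H) q by near: q.
    have h4 : differentiable ('D_w H) q by near: q.
    have h5 : 'D_v ('D_w H) q = 'D_w ('D_v H) q by apply: clairaut; near: q.
    rewrite /T derive_D; [|exact: differentiableM|exact: differentiableM].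
    rewrite (derive_M v h1 h3) (derive_M v h2 h4) h5.
    move: ('D_w ('D_v H) q) ('D_v ('D_v H) q) ('D_v X q) ('D_v Y q) ('D_v H q) ('D_w H q) (X q) (Y q) => a b c d x y z t.
    by ring.
  have sT1 : smooth (fun q => 'D_v X q * 'D_v H q) p by exact: smooth_M.
  have sT2 : smooth (fun q => 'D_v Y q * 'D_w H q) p by exact: smooth_M.
  have sT3 := smooth_derive v sE.
  apply: flat_B; [exact: smooth_B|by []| |exact: flat_M].
  apply: flat_B; [by []|by []| |exact: flat_M].
  by have /flatS[_ h] := flat_le nm (HY m (ltnSn m)); exact: h.
(* Here the line is noncharacteristic: since Y does not vanish, the equation itself determines D_w H
   from D_v H. *)
have fw : flat m ('D_w H) p.
  apply: (@eq_flat _ _ _ (fun q => (Y q)^-1 * ((X q * 'D_v H q + Y q * 'D_w H q) - X q * 'D_v H q))).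
    have n0 := near_neq0 (smooth_continuous sY) Y0.
    near=> q; rewrite addrAC subrr add0r mulKf //; by near: q.
  have sT : smooth (fun q => X q * 'D_v H q) p by exact: smooth_M.
  apply: flat_M; [exact: smooth_V|exact: smooth_B|].
  apply: flat_B => //; [exact: HY|exact: flat_M].
apply/flatS; split=> [|u]; first exact: (Hline 0%N).
have [a [b ->]] := span u.
apply: (@eq_flat _ _ _ (fun q => a * 'D_v H q + b * 'D_w H q)).
  have d1 := smooth_diff_nbhs sH; near=> q.
  have h : differentiable H q by near: q.
  by rewrite derive_dirD // [in RHS]deriveE // linearZ -deriveE.
have sa := smooth_cst a p; have sb := smooth_cst b p.
by apply: flat_D; try exact: smooth_M; exact: flat_M.
Unshelve. all: by end_near. Qed.

Lemma flat_line m (f : R -> R) p : smooth f p ->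
  (forall k, (k <= m)%N -> iterD (nseq k (1 : R)) f p = 0) -> flat m f p.
Proof.
elim: m f => [|m IH] f sf H; first by apply/flat0; exact: (H 0%N).
have s1 := smooth_derive (1 : R) sf.
apply/flatS; split=> [|v]; first exact: (H 0%N).
apply: (@eq_flat _ _ _ (fun q => v * 'D_1 f q)).
  have d1 := smooth_diff_nbhs sf; near=> q.
  have h : differentiable f q by near: q.
  by rewrite -[v in RHS]mulr1 [in RHS]deriveE // linearZ -deriveE.
apply: flat_M => //; first exact: smooth_cst.
apply: IH => // k km.
by rewrite -[iterD _ _]/(iterD (nseq k (1 : R)) (iterD [:: (1 : R)] f)) -iterD_cat -nseq_rcons; apply: H.
Unshelve. all: by end_near. Qed.

Lemma iterD_B V W vs (f g : V -> W) p : smooth f p -> smooth g p ->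
  \forall q \near p, iterD vs (fun q => f q - g q) q = iterD vs f q - iterD vs g q.
Proof.
move=> sf sg; elim: vs => [|v vs IH]; first by near=> q.
have := eq_near_derive v IH.
have d1 := smooth_diff_nbhs (smooth_iterD vs sf); have d2 := smooth_diff_nbhs (smooth_iterD vs sg).
by move=> h; near=> q; rewrite /= (near h q) // derive_B //; near: q.
Unshelve. all: by end_near. Qed.

Lemma iterD_nseq_comm V b (v w : V) (f : V -> R) p : smooth f p ->
  \forall q \near p, iterD (nseq b w) ('D_v f) q = 'D_v (iterD (nseq b w) f) q.
Proof.
move=> sf; elim: b => [|b IH]; first by near=> q.
have h := eq_near_derive w IH; have s1 := smooth_nbhs (smooth_iterD (nseq b w) sf).
by apply: filterS2 h s1 => q hq sq; exact: (etrans hq (clairaut _ _ sq)).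
Unshelve. all: by end_near. Qed.

(** By symmetry of second derivatives only words with all v before all w need testing; with v and w
    the unit vectors these are the coordinates of a jet. *)
Lemma flat_ordered m V (v w : V) (f : V -> R) p :
  (forall u, exists a b, u = a *: v + b *: w) -> smooth f p ->
  (forall a b, (a + b <= m)%N -> iterD (nseq a v ++ nseq b w) f p = 0) -> flat m f p.
Proof.
move=> span; elim: m f => [|m IH] f sf H; first by apply/flat0; exact: (H 0%N 0%N).
have sv := smooth_derive v sf; have sw := smooth_derive w sf.
have fw : flat m ('D_w f) p.
  apply: IH => // a b ab.
  rewrite -[iterD _ _]/(iterD (nseq a v ++ nseq b w) (iterD [:: w] f)) -iterD_cat -catA -nseq_rcons.
  by apply: H; rewrite addnS.
have fv : flat m ('D_v f) p.
  apply: IH => // a b ab.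
  rewrite iterD_cat (nbhs_singleton (eq_near_iterD (nseq a v) (iterD_nseq_comm b v w sf))).
  rewrite -[X in iterD (nseq a v) X]/(iterD [:: v] (iterD (nseq b w) f)) -iterD_cat -nseq_rcons -iterD_cat.
  exact: H.
apply/flatS; split=> [|u]; first exact: (H 0%N 0%N).
have [a [b ->]] := span u.
apply: (@eq_flat _ _ _ (fun q => a * 'D_v f q + b * 'D_w f q)).
  have d1 := smooth_diff_nbhs sf; near=> q.
  have h : differentiable f q by near: q.
  by rewrite derive_dirD // [in RHS]deriveE // linearZ -deriveE.
have sa := smooth_cst a p; have sb := smooth_cst b p.
by apply: flat_D; try exact: smooth_M; exact: flat_M.
Unshelve. all: by end_near. Qed.

Lemma iterD_D V W vs (f g : V -> W) p : smooth f p -> smooth g p ->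
  \forall q \near p, iterD vs (fun q => f q + g q) q = iterD vs f q + iterD vs g q.
Proof.
move=> sf sg; elim: vs => [|v vs IH]; first by near=> q.
have d1 := smooth_diff_nbhs (smooth_iterD vs sf); have d2 := smooth_diff_nbhs (smooth_iterD vs sg).
apply: filterS3 (eq_near_derive v IH) d1 d2 => q hq q1 q2.
exact: (etrans hq (derive_D _ q1 q2)).
Unshelve. all: by end_near. Qed.

Lemma iterD_Ml V vs (c : R) (f : V -> R) p : smooth f p ->
  \forall q \near p, iterD vs (fun q => c * f q) q = c * iterD vs f q.
Proof.
move=> sf; elim: vs => [|v vs IH]; first by near=> q.
have d1 := smooth_diff_nbhs (smooth_iterD vs sf).
apply: filterS2 (eq_near_derive v IH) d1 => q hq q1.
apply: (etrans hq); rewrite (derive_M v (differentiable_cst c q) q1).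
by rewrite derive_cst mulr0 addr0.
Unshelve. all: by end_near. Qed.

Lemma iterD_cst0 V W vs : iterD vs (fun _ : V => 0 : W) = fun _ => 0.
Proof. by elim: vs => //= v vs ->; apply: funext => x; rewrite derive_cst. Qed.

Lemma iterD_sum V W vs (I : Type) (r : seq I) (P : pred I) (F : I -> V -> W) p :
  (forall i, P i -> smooth (F i) p) ->
  \forall q \near p, iterD vs (fun q => \sum_(i <- r | P i) F i q) q = \sum_(i <- r | P i) iterD vs (F i) q.
Proof.
move=> sF; elim: r => [|i r IH].
  near=> q; rewrite big_nil -[RHS](congr1 (fun f => f q) (@iterD_cst0 V W vs)).
  by congr (iterD vs _ q); apply: funext => x; rewrite big_nil.
case Pi: (P i).
  have h := iterD_D vs (sF i Pi) (@smooth_sum R V W I r P F p sF).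
  apply: filterS2 IH h => q q1 q2; rewrite big_cons Pi -q1 -q2.
  by congr (iterD vs _ q); apply: funext => x; rewrite big_cons Pi.
apply: filterS IH => q q1; rewrite big_cons Pi -q1.
by congr (iterD vs _ q); apply: funext => x; rewrite big_cons Pi.
Unshelve. all: by end_near. Qed.

(** The difference quotients coincide, so derivatives along slices, translates and lines are
    compared without any differentiability condition. *)
Lemma derive_eq_growth V Z W (f : V -> W) (g : Z -> W) x v y w :
  (forall h : R, f (h *: v + x) = g (h *: w + y)) -> f x = g y -> 'D_v f x = 'D_w g y.
Proof.
move=> H E; rewrite /derive.
suff -> : (fun h => h^-1 *: ((f \o shift x) (h *: v) - f x)) =
          (fun h => h^-1 *: ((g \o shift y) (h *: w) - g y)) by [].
by apply: funext => h /=; rewrite H E.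
Qed.

Lemma iterD_shift V W vs (f : V -> W) (c : V) :
  iterD vs (fun y => f (y + c)) = fun y => iterD vs f (y + c).
Proof.
elim: vs => //= v vs ->; apply: funext => x.
by apply: derive_eq_growth => // h; rewrite addrA.
Qed.

Lemma iterD_pairr V W Z vs (f : V * W -> Z) (a : V) :
  iterD vs (fun y => f (a, y)) = fun y => iterD [seq (0, v) | v <- vs] f (a, y).
Proof.
elim: vs => //= v vs ->; apply: funext => x.
apply: derive_eq_growth => // h; congr (iterD _ _ _).
by congr (_, _) => /=; rewrite ?scaler0 ?add0r.
Qed.

(** The direction varies with the point, as it does in a total derivative. *)
Lemma smooth_dir V W (f : W -> R) (g d : V -> W) p : findim W ->
  smooth f (g p) -> smooth g p -> smooth d p -> smooth (fun q => 'D_(d q) f (g q)) p.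
Proof.
move=> fW; have [I [e [c [cc ec]]]] := fW => sf sg sd.
apply: (@eq_smooth _ _ _ (fun q => \sum_i c i (d q) * 'D_(e i) f (g q))).
  have df := near_comp (smooth_continuous sg) (smooth_diff_nbhs sf).
  by apply: filterS df => q dq; rewrite [in RHS](ec (d q)) derive_sumv.
apply: smooth_sum => i _; apply: smooth_M; first exact: smooth_lin.
by apply: (smooth_comp (f := 'D_(e i) f)) => //; exact: smooth_derive.
Qed.

Lemma derive_pair V W Z (f : V -> W) (g : V -> Z) q v : differentiable f q -> differentiable g q ->
  'D_v (fun x => (f x, g x)) q = ('D_v f q, 'D_v g q).
Proof.
move=> df dg; rewrite deriveE; last exact: differentiable_pair.
by rewrite diff_pair //= -!deriveE.
Qed.

Lemma derive_row V n (f : 'I_n -> V -> R) q v : (forall k, smooth (f k) q) ->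
  'D_v (fun x => \row_k f k x) q = \row_k 'D_v (f k) q.
Proof.
move=> sf; rewrite derive_mx; last by apply/diff_derivable/smooth_diff/smooth_row.
apply/rowP => k; rewrite !mxE; congr ('D_v _ q).
by apply: funext => x; rewrite mxE.
Qed.

End Flat.

(** * Jets *)

Section Monomials.
Context {R : realType}.

Notation e0 := (delta_mx 0 0 : 'rV[R]_2).
Notation e1 := (delta_mx 0 1 : 'rV[R]_2).

Lemma span2 (u : 'rV[R]_2) : exists a b : R, u = a *: e0 + b *: e1.
Proof.
exists (u 0 0), (u 0 1); rewrite {1}(row_sum_delta u) big_ord_recl big_ord1.
by congr (_ + _ *: delta_mx _ _); [congr (u _ _)|]; apply: val_inj.
Qed.

(** Divided powers: differentiation lowers the index without a factor, so that their derivatives at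
    0 form a Kronecker delta. *)
Definition pw (k : nat) (t : R) : R := t ^+ k / k`!%:R.

Lemma smooth_pw k t : smooth (pw k) t.
Proof.
apply: smooth_M; last exact: smooth_cst.
elim: k => [|k IH]; first exact: smooth_cst.
apply: (@eq_smooth R R R (fun t => t * t ^+ k)); first by near=> x; rewrite exprS.
by apply: smooth_M => //; exact: smooth_id.
Unshelve. all: by end_near. Qed.

Lemma derive_pw k (t : R) : 'D_1 (pw k) t = if k is k'.+1 then pw k' t else 0.
Proof.
have d : derivable (fun t : R => t ^+ k) t 1 by exact: exprn_derivable.
rewrite /pw derive_M; [|exact/derivable1_diffP|exact: differentiable_cst].
rewrite derive_cst mulr0 add0r exp_derive scaler1.
case: k {d} => [|k]; first by rewrite mulr0n scale0r mulr0.
rewrite factS natrM invfM -[k.+1%:R *: _]/(k.+1%:R * _) mulrACA mulVf ?pnatr_eq0 //.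
by rewrite mul1r mulrC.
Qed.

Lemma pw_at0 k : pw k 0 = (k == 0%N)%:R.
Proof. by rewrite /pw expr0n; case: k => [|k]; rewrite ?mul0r // fact0 divr1. Qed.

Definition mon (a b : nat) (y : 'rV[R]_2) : R := pw a (y 0 0) * pw b (y 0 1).

Lemma smooth_mon a b y : smooth (mon a b) y.
Proof.
apply: smooth_M.
  by apply: (smooth_comp (f := pw a)); [exact: findimR|exact: smooth_pw|exact: smooth_coord].
by apply: (smooth_comp (f := pw b)); [exact: findimR|exact: smooth_pw|exact: smooth_coord].
Qed.

End Monomials.

Section JetSpaces.
Context {R : realType}.

Local Notation J := (@Defs.J R).
Local Notation mkjet := (@Defs.mkjet R).
Local Notation jet := (@Defs.jet R).
Local Notation vfield := (@Defs.vfield R).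
Local Notation trunc := (@Defs.trunc R).
Local Notation tdir := (@Defs.tdir R).

Notation e0 := (delta_mx 0 0 : 'rV[R]_2).
Notation e1 := (delta_mx 0 1 : 'rV[R]_2).

(** [J 0] keeps u in a row with a single index; [jp] allows its points to be written as pairs (x,
    u). *)
Definition jp (z : 'rV[R]_2 * R) : J 0 := (z.1, \row_k z.2).

Lemma mi_le r (al : midx r) : (mi1 al + mi2 al <= r)%N.
Proof. exact: (valP al). Qed.

Lemma mkjet0E x c : mkjet 0 x c = jp (x, c 0%N 0%N).
Proof.
congr (_, _); apply/rowP => k; rewrite !mxE.
have := mi_le (enum_val k); rewrite leqn0 addn_eq0 => /andP[/eqP -> /eqP ->] //.
Qed.

Lemma jet0E u y : jet 0 u y = jp (y, u y).
Proof. exact: mkjet0E. Qed.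

Lemma midx_of_subproof1 r a b (h : (a + b <= r)%N) : (a < r.+1)%N.
Proof. by rewrite ltnS (leq_trans (leq_addr b a)). Qed.

Lemma midx_of_subproof2 r a b (h : (a + b <= r)%N) : (b < r.+1)%N.
Proof. by rewrite ltnS (leq_trans (leq_addl a b)). Qed.

Definition midx_of r a b (h : (a + b <= r)%N) : midx r :=
  exist _ (Ordinal (midx_of_subproof1 h), Ordinal (midx_of_subproof2 h)) h.

Lemma midx_inj r (al be : midx r) : mi1 al = mi1 be -> mi2 al = mi2 be -> al = be.
Proof.
move=> h1 h2; apply: val_inj; case: al be h1 h2 => [[a b] /= ?] [[c d] /= ?].
by rewrite /mi1 /mi2 /= => h1 h2; congr (_, _); apply: val_inj.
Qed.

Lemma jcoord_idx r (j : J r) (al : midx r) : jcoord j (mi1 al) (mi2 al) = j.2 0 (enum_rank al).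
Proof.
rewrite /jcoord (big_pred1 al) // => be /=.
Qed.

Lemma jcoordE r (j : J r) a b (h : (a + b <= r)%N) : jcoord j a b = j.2 0 (enum_rank (midx_of h)).
Proof. exact: (jcoord_idx j (midx_of h)). Qed.

Lemma jcoord_mkjet r x c a b : (a + b <= r)%N -> jcoord (mkjet r x c) a b = c a b.
Proof. by move=> h; rewrite (jcoordE _ h) /= mxE enum_rankK. Qed.

Lemma eq_mkjet r x c c' : (forall a b, (a + b <= r)%N -> c a b = c' a b) -> mkjet r x c = mkjet r x c'.
Proof.
by move=> H; congr (_, _); apply/rowP => k; rewrite !mxE; apply: H; exact: mi_le.
Qed.

Notation wd a b := (nseq a e0 ++ nseq b e1).

Lemma iter_iterD n (v : 'rV[R]_2) (f : 'rV[R]_2 -> R) : iter n (fun g => 'D_v g) f = iterD (nseq n v) f.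
Proof. by elim: n => //= n ->. Qed.

Lemma jetE r u x : jet r u x = mkjet r x (fun a b => iterD (wd a b) u x).
Proof. by apply: eq_mkjet => a b _; rewrite iterD_cat !iter_iterD. Qed.

Lemma jcoord_jet r u x a b : (a + b <= r)%N -> jcoord (jet r u x) a b = iterD (wd a b) u x.
Proof. by move=> h; rewrite jetE jcoord_mkjet. Qed.

Lemma trunc_jet m r u x : (m <= r)%N -> trunc m (jet r u x) = jet m u x.
Proof.
move=> mr; rewrite /trunc jetE [RHS]jetE; apply: eq_mkjet => a b ab.
by rewrite jcoord_mkjet // (leq_trans ab).
Qed.

Lemma findim_J r : findim (J r : normedModType R).
Proof. by apply: findim_prod; exact: findim_rV. Qed.

Lemma smooth_mkjet (V : normedModType R) r (x : V -> 'rV[R]_2) (c : nat -> nat -> V -> R) p :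
  smooth x p -> (forall a b, (a + b <= r)%N -> smooth (c a b) p) ->
  smooth (fun q => mkjet r (x q) (fun a b => c a b q)) p.
Proof.
move=> sx sc; apply: smooth_pair => //.
by apply: smooth_row => k; apply: sc; exact: mi_le.
Qed.

Lemma smooth_jcoord (V : normedModType R) r (j : V -> J r) a b p :
  smooth j p -> smooth (fun q => jcoord (j q) a b) p.
Proof.
move=> sj; apply: smooth_sum => al _.
apply: (smooth_comp (f := fun z : J r => z.2 0 (enum_rank al))) => //; first exact: findim_J.
apply: (smooth_comp (f := fun z : 'rV[R]_#|{: midx r}| => z 0 (enum_rank al))).
- exact: findim_rV.
- exact: smooth_coord.
- exact: smooth_snd.
Qed.

Lemma smooth_fst_comp (V W Z : normedModType R) (f : V -> W * Z) p : findim W -> findim Z ->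
  smooth f p -> smooth (fun q => (f q).1) p.
Proof.
move=> fW fZ sf; apply: (smooth_compv (f := fst)) => //; [exact: findim_prod|exact: smooth_fst].
Qed.

Lemma smooth_snd_comp (V W Z : normedModType R) (f : V -> W * Z) p : findim W -> findim Z ->
  smooth f p -> smooth (fun q => (f q).2) p.
Proof.
move=> fW fZ sf; apply: (smooth_compv (f := snd)) => //; [exact: findim_prod|exact: smooth_snd].
Qed.

Lemma smooth_trunc (V : normedModType R) m r (j : V -> J r) p :
  smooth j p -> smooth (fun q => trunc m (j q)) p.
Proof.
move=> sj; apply: (smooth_mkjet (c := fun a b q => jcoord (j q) a b)).
  by apply: smooth_fst_comp => //; exact: findim_rV.
by move=> a b _; exact: smooth_jcoord.
Qed.

Lemma smooth_jp (V : normedModType R) (x : V -> 'rV[R]_2) (s : V -> R) p :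
  smooth x p -> smooth s p -> smooth (fun q => jp (x q, s q)) p.
Proof. by move=> sx ss; apply: smooth_pair => //; apply: smooth_row. Qed.

Lemma smooth_jet r u x : smooth u x -> smooth (jet r u) x.
Proof.
move=> su; apply: (@eq_smooth R _ _ (fun x => mkjet r x (fun a b => iterD (wd a b) u x))).
  by near=> y; rewrite jetE.
apply: (smooth_mkjet (c := fun a b y => iterD (wd a b) u y)); first exact: smooth_id.
by move=> a b _; apply: smooth_iterD.
Unshelve. all: by end_near. Qed.

Notation ee i := (delta_mx 0 i : 'rV[R]_2).

Lemma I2 (i : 'I_2) : i = 0 \/ i = 1.
Proof. by case: i => [[|[|i]] h] //; [left|right]; apply: val_inj. Qed.

(** The identity behind the total derivative: moving x along e_i moves the jet of u in the direction
    [tdir]. *)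
Lemma derive_jet r u x i : smooth u x ->
  'D_(ee i) (jet r u) x = tdir i (jet r.+1 u x).
Proof.
move=> su; have -> : jet r u = fun x => mkjet r x (fun a b => iterD (wd a b) u x).
  by apply: funext => y; rewrite jetE.
have sr (k : 'I_#|{: midx r}|) : smooth (fun y => iterD (wd (mi1 (enum_val k)) (mi2 (enum_val k))) u y) x.
  exact: smooth_iterD.
rewrite derive_pair; [|exact: ex_diff|exact/smooth_diff/smooth_row].
rewrite derive_row // derive_id; congr (_, _); apply/rowP => k; rewrite !mxE.
set a := mi1 _; set b := mi2 _; have ab : (a + b <= r)%N by exact: mi_le.
have [->|->] := I2 i; rewrite /= ?addn0 ?addn1.
  by rewrite jcoord_jet.
rewrite jcoord_jet; last by rewrite addnS.
(* For i = 1 the new derivative has to pass the a derivatives along e_0 to restore the order of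
   differentiation fixed by [jet]. *)
have := nbhs_singleton (iterD_nseq_comm a e1 e0 (smooth_iterD (nseq b e1) su)).
move=> h; transitivity ('D_e1 (iterD (nseq a e0) (iterD (nseq b e1) u)) x).
  by rewrite -iterD_cat.
by rewrite -h iterD_cat.
Qed.

Lemma TD_jet m (f : J m -> R) u x i : smooth u x -> smooth f (jet m u x) ->
  TD i f (jet m.+1 u x) = 'D_(ee i) (fun y => f (jet m u y)) x.
Proof.
move=> su sf; rewrite /TD trunc_jet // (derive_comp (f := f) (g := jet m u)).
- by rewrite derive_jet.
- exact/smooth_diff/smooth_jet.
- exact: smooth_diff.
Qed.

Lemma smooth_TD m (f : J m -> R) i (j : J m.+1) : smooth f (trunc m j) -> smooth (TD i f) j.
Proof.
move=> sf; apply: (smooth_dir (g := trunc m (r := m.+1)) (d := @tdir m i)) => //; first exact: findim_J.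
  by apply: (@smooth_trunc _ m m.+1 id); exact: smooth_id.
apply: (smooth_mkjet (x := fun _ => ee i)
   (c := fun a b j => jcoord j (a + (i == 0%R)) (b + (i == 1%R)))); first exact: smooth_cst.
by move=> a b _; apply: (@smooth_jcoord _ _ id); exact: smooth_id.
Qed.

(** Total derivatives restricted to the jet of u are ordinary derivatives. The equality is needed on
    a neighbourhood, because the next step differentiates it. *)
Lemma TDn_jet i n r (f : J r -> R) u x : smooth u x -> smooth f (jet r u x) ->
  smooth (TDn i n f) (jet (n + r) u x) /\
  \forall y \near x, TDn i n f (jet (n + r) u y) = iterD (nseq n (ee i)) (fun y => f (jet r u y)) y.
Proof.
move=> su sf; elim: n => [|n [IH1 IH2]]; first by split=> //; near=> y.
split.
  by apply: (@smooth_TD (n + r)); rewrite trunc_jet.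
have h := eq_near_derive (ee i) IH2.
have s1 := near_comp (smooth_continuous (smooth_jet (n + r) su)) (smooth_nbhs IH1).
apply: filterS3 h s1 (smooth_nbhs su) => y hy sy uy.
by rewrite -[RHS]hy -(@TD_jet (n + r)).
Unshelve. all: by end_near. Qed.

Definition charfun (Q : vfield) (u : 'rV[R]_2 -> R) (y : 'rV[R]_2) : R :=
  Defs.eta Q (jp (y, u y)) - xi Q 0 (jp (y, u y)) * 'D_e0 u y - xi Q 1 (jp (y, u y)) * 'D_e1 u y.

Lemma characteristic_jet Q u y : characteristic Q (jet 1 u y) = charfun Q u y.
Proof. by rewrite /characteristic trunc_jet // jet0E !jcoord_jet. Qed.

Lemma smooth_characteristic (Q : vfield) (j : J 1) : smooth_vfield Q (trunc 0 j) ->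
  smooth (characteristic Q) j.
Proof.
case=> sxi seta; have st := smooth_trunc 0 (smooth_id j).
have sc a b : smooth (fun j : J 1 => jcoord j a b) j by apply: (@smooth_jcoord _ _ id); exact: smooth_id.
have fJ := findim_J 0.
have sx i : smooth (fun j : J 1 => xi Q i (trunc 0 j)) j by apply: smooth_comp => //; exact: sxi.
have se : smooth (fun j : J 1 => Defs.eta Q (trunc 0 j)) j by exact: smooth_comp.
by apply: smooth_B; [apply: smooth_B => //|]; apply: smooth_M.
Qed.

(** The equations of Q_(r) say that the derivatives of Q[u] of order below r vanish at x. The form
    with every n < r, rather than with r - 1, is void for r = 0 as it should be. *)
Lemma invariant_flat r (Q : vfield) u x : smooth u x -> smooth_vfield Q (jet 0 u x) ->
  invariant_set Q (jet r u x) -> forall n, (n < r)%N -> flat n (charfun Q u) x.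
Proof.
move=> su sQ inv n nr.
have sc : smooth (characteristic Q) (jet 1 u x) by apply: smooth_characteristic; rewrite trunc_jet.
have E : (fun y => characteristic Q (jet 1 u y)) = charfun Q u.
  by apply: funext => y; rewrite characteristic_jet.
have sq : smooth (charfun Q u) x.
  by rewrite -E; apply: smooth_comp; [exact: findim_J|by []|exact: smooth_jet].
apply: (flat_ordered (v := e0) (w := e1)) => // [u'|a b ab]; first exact: span2.
have abr : (a + b < r)%N by exact: leq_ltn_trans nr.
have := inv a b abr; rewrite trunc_jet; last by rewrite addn1 addnS.
have [s1 h1] := TDn_jet 1 b su sc.
have [s2 h2] := TDn_jet 0 a su s1.
rewrite (nbhs_singleton h2) (nbhs_singleton (eq_near_iterD (nseq a e0) h1)) E.
by rewrite -iterD_cat.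
Qed.

End JetSpaces.

Section MonomialJets.
Context {R : realType}.

Notation e0 := (delta_mx 0 0 : 'rV[R]_2).
Notation e1 := (delta_mx 0 1 : 'rV[R]_2).
Notation wd a b := (nseq a e0 ++ nseq b e1).

Lemma iterD_pw n k : iterD (nseq n (1 : R)) (pw k) = if (n <= k)%N then pw (k - n) else fun _ => 0 : R.
Proof.
elim: n => [|n IH]; first by rewrite subn0.
rewrite -[LHS]/('D_(1 : R) (iterD (nseq n (1 : R)) (pw k))) IH; apply: funext => t.
have [nk|kn] := leqP n k; last by rewrite derive_cst leqNgt ltnS (ltnW kn).
rewrite derive_pw; case: (ltngtP n k) nk => // [nk|->] _; last by rewrite subnn.
by rewrite -subnSK.
Qed.

Lemma derive_mon0 a b (y : 'rV[R]_2) : 'D_e0 (mon a b) y = if a is a'.+1 then mon a' b y else 0.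
Proof.
rewrite (@derive_eq_growth _ _ _ _ _ (fun t => pw a t * pw b (y 0 1)) _ _ (y 0 0) 1) //.
  rewrite derive_M; [|exact/smooth_diff/smooth_pw|exact: differentiable_cst].
  rewrite derive_cst derive_pw mulr0 add0r mulrC; case: a => [|a]; by rewrite ?mul0r.
by move=> h; rewrite /mon !mxE /= mulr0 add0r.
Qed.

Lemma derive_mon1 a b (y : 'rV[R]_2) : 'D_e1 (mon a b) y = if b is b'.+1 then mon a b' y else 0.
Proof.
rewrite (@derive_eq_growth _ _ _ _ _ (fun t => pw a (y 0 0) * pw b t) _ _ (y 0 1) 1) //.
  rewrite derive_M; [|exact: differentiable_cst|exact/smooth_diff/smooth_pw].
  rewrite derive_cst derive_pw mulr0 addr0; case: b => [|b]; by rewrite ?mulr0.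
by move=> h; rewrite /mon !mxE /= mulr0 add0r.
Qed.

Lemma iterD_mon1 n a b : iterD (nseq n e1) (mon a b) = if (n <= b)%N then mon a (b - n) else fun _ => 0 : R.
Proof.
elim: n => [|n IH]; first by rewrite subn0.
rewrite -[LHS]/('D_e1 (iterD (nseq n e1) (mon a b))) IH; apply: funext => t.
have [nk|kn] := leqP n b; last by rewrite derive_cst leqNgt ltnS (ltnW kn).
rewrite derive_mon1; case: (ltngtP n b) nk => // [nk|->] _; last by rewrite subnn.
by rewrite -subnSK.
Qed.

Lemma iterD_mon0 n a b : iterD (nseq n e0) (mon a b) = if (n <= a)%N then mon (a - n) b else fun _ => 0 : R.
Proof.
elim: n => [|n IH]; first by rewrite subn0.
rewrite -[LHS]/('D_e0 (iterD (nseq n e0) (mon a b))) IH; apply: funext => t.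
have [nk|kn] := leqP n a; last by rewrite derive_cst leqNgt ltnS (ltnW kn).
rewrite derive_mon0; case: (ltngtP n a) nk => // [nk|->] _; last by rewrite subnn.
by rewrite -subnSK.
Qed.

Lemma mon_at0 a b : mon a b (0 : 'rV[R]_2) = ((a == 0%N) && (b == 0%N))%:R.
Proof. by rewrite /mon !mxE !pw_at0 -natrM mulnb. Qed.

Lemma subn_eq0_leq n k : ((n <= k) && (k - n == 0) = (k == n))%N.
Proof. by rewrite subn_eq0 eqn_leq andbC. Qed.

Lemma iterD_mon a' b' a b : iterD (wd a' b') (mon a b) (0 : 'rV[R]_2) = ((a == a') && (b == b'))%:R.
Proof.
rewrite iterD_cat iterD_mon1 -(subn_eq0_leq a') -(subn_eq0_leq b').
case: (b' <= b)%N => /=; last by rewrite iterD_cst0 andbF.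
rewrite iterD_mon0; case: (a' <= a)%N => //=; exact: mon_at0.
Qed.

Lemma flat_mon m a b : (m < a + b)%N -> flat m (mon a b) (0 : 'rV[R]_2).
Proof.
move=> mab; apply: (flat_ordered (v := e0) (w := e1)); [exact: span2|exact: smooth_mon|].
move=> a' b' ab; rewrite iterD_mon; case: eqP => // ea; case: eqP => // eb.
by move: mab; rewrite ea eb ltnNge ab.
Qed.

Lemma iterD_pw_at0 n k : iterD (nseq n (1 : R)) (pw k) (0 : R) = (k == n)%:R.
Proof.
rewrite iterD_pw -(subn_eq0_leq n k); case: (n <= k)%N => //=; exact: pw_at0.
Qed.

Lemma flat_pw m k : (m < k)%N -> flat m (pw k) (0 : R).
Proof.
move=> mk; apply: flat_line; first exact: smooth_pw.
by move=> n nm; rewrite iterD_pw_at0 gtn_eqF // (leq_ltn_trans nm).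
Qed.

End MonomialJets.

(** * Smooth families of functions with prescribed jets *)

Section TaylorFamily.
Context {R : realType} {V : normedModType R} {n : nat}.
Variables (m : 'I_n -> V -> R) (w : 'I_n -> seq V).
Hypothesis fV : findim V.
Hypothesis sm : forall k y, smooth (m k) y.
Hypothesis mw : forall k l, iterD (w l) (m k) 0 = (k == l)%:R.
Variables (f0 : V -> R) (x0 : V).

(* f0 translated from x0 to z.1.1 and corrected by a polynomial, so that its
   derivatives w there are the coordinates of z.1.2. *)
Definition tayl (z : (V * 'rV[R]_n) * V) : R :=
  f0 (z.2 + (x0 - z.1.1)) +
  \sum_k (z.1.2 0 k - iterD (w k) f0 x0) * m k (z.2 + - z.1.1).

Lemma smooth_tayl z : smooth f0 (z.2 + (x0 - z.1.1)) -> smooth tayl z.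
Proof.
move=> sf; have fr := findim_rV (R := R) n; have fz := findim_prod (findim_prod fV fr) fV.
have s2 : smooth (fun z : (V * 'rV[R]_n) * V => z.2) z by exact: smooth_snd.
have s1 : smooth (fun z : (V * 'rV[R]_n) * V => z.1) z by exact: smooth_fst.
have s11 : smooth (fun z : (V * 'rV[R]_n) * V => z.1.1) z by exact: smooth_fst_comp s1.
have s12 : smooth (fun z : (V * 'rV[R]_n) * V => z.1.2) z by exact: smooth_snd_comp s1.
have sN : smooth (fun z : (V * 'rV[R]_n) * V => - z.1.1) z.
  apply: (@eq_smooth R _ _ (fun z => 0 - z.1.1)); first by near=> q; rewrite sub0r.
  by apply: smooth_Bv => //; exact: smooth_cst.
apply: smooth_D.
  apply: (smooth_comp (f := f0)) => //.
  by apply: smooth_D => //; apply: smooth_D => //; exact: smooth_cst.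
apply: smooth_sum => k _; apply: smooth_M.
  apply: smooth_B; last exact: smooth_cst.
  by apply: (smooth_comp (f := fun c : 'rV[R]_n => c 0 k)) => //; exact: smooth_coord.
by apply: (smooth_comp (f := m k)) => //; exact: smooth_D.
Unshelve. all: by end_near. Qed.

Lemma tayl_jet l x c : smooth f0 x0 -> iterD (w l) (fun y => tayl ((x, c), y)) x = c 0 l.
Proof.
move=> sf; have sh (f : V -> R) (d : V) y : smooth f (y + d) -> smooth (fun y => f (y + d)) y.
  move=> s; apply: (smooth_comp (f := f)) => //; apply: smooth_D; [exact: smooth_id|exact: smooth_cst].
have s1 : smooth (fun y => f0 (y + (x0 - x))) x by apply: sh; rewrite addrC subrK.
have s2 k : smooth (fun y => m k (y + - x)) x by apply: sh.
have s3 k : smooth (fun y => (c 0 k - iterD (w k) f0 x0) * m k (y + - x)) x.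
  by apply: smooth_M => //; exact: smooth_cst.
have s4 : smooth (fun y => \sum_k (c 0 k - iterD (w k) f0 x0) * m k (y + - x)) x by exact: smooth_sum.
rewrite (nbhs_singleton (iterD_D (w l) s1 s4)) iterD_shift [x + _]addrC subrK.
rewrite (nbhs_singleton (@iterD_sum R V R (w l) 'I_n (index_enum _) xpredT _ x (fun k _ => s3 k))) (bigD1 l) //= big1 ?addr0 => [|k kl].
  by rewrite (nbhs_singleton (iterD_Ml _ _ (s2 l))) iterD_shift subrr mw eqxx mulr1 addrC subrK.
by rewrite (nbhs_singleton (iterD_Ml _ _ (s2 k))) iterD_shift subrr mw (negbTE kl) mulr0.
Qed.

Lemma tayl_base y : tayl ((x0, \row_k iterD (w k) f0 x0), y) = f0 y.
Proof.
rewrite /tayl /= subrr addr0 big1 ?addr0 // => k _.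
by rewrite mxE subrr mul0r.
Qed.

(** The source of triangularity: one coordinate of the jet acts through one member of the dual
    family, centred at x. *)
Lemma tayl_shift x c k (s : R) y :
  tayl ((x, c + s *: delta_mx 0 k), y) - tayl ((x, c), y) = s * m k (y + - x).
Proof.
rewrite /tayl /= opprD addrACA subrr add0r -sumrB (bigD1 k) //= big1 ?addr0 => [|l lk].
  by rewrite !mxE !eqxx mulr1; ring.
by rewrite !mxE eqxx /= (negbTE lk) mulr0 addr0 subrr.
Qed.

End TaylorFamily.

(** * Orders of composed differential functions *)

Section GermOrder.
Context {R : realType}.
Implicit Types V W : normedModType R.

Lemma derive_const_dir V W (h : V -> W) q v : (\forall s \near (0 : R), h (q + s *: v) = h q) ->
  'D_v h q = 0.
Proof.
move=> H; rewrite (@derive_eq_growth _ _ _ _ _ (fun s : R => h (q + s *: v)) _ _ 0 1).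
- by rewrite (near_eq_derive (g := fun _ => h q)) ?derive_cst.
- by move=> s; rewrite addr0 [s *: 1]mulr1 addrC.
- by rewrite scale0r addr0.
Qed.

(** Components that are constant along the direction v drop out of the derivative. The bijection
    [rk] numbers the coordinates: it is [enum_rank] on J^r and the identity on jets of phi. *)
Lemma triangular_dir V W (I : finType) n (rk : I -> 'I_n) (wt : I -> nat) (g : V -> W * 'rV[R]_n) q v m :
  bijective rk -> differentiable g q ->
  (\forall s \near (0 : R), (g (q + s *: v)).1 = (g q).1) ->
  (forall i, (wt i < m)%N -> \forall s \near (0 : R), (g (q + s *: v)).2 0 (rk i) = (g q).2 0 (rk i)) ->
  exists k : I -> R, 'D_v g q = \sum_(i | (m <= wt i)%N) k i *: (0, delta_mx 0 (rk i)).
Proof.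
move=> brk dg H1 H2; exists (fun i => ('D_v g q).2 0 (rk i)).
have l2k k : linear (fun z : W * 'rV[R]_n => z.2 0 k : R^o) by move=> a x y; rewrite /= !mxE.
have c2k k : continuous (fun z : W * 'rV[R]_n => z.2 0 k).
  move=> z; apply: smooth_continuous; apply: (smooth_comp (f := fun c : 'rV[R]_n => c 0 k)).
  - exact: findim_rV.
  - exact: smooth_coord.
  - exact: smooth_snd.
have E1 : ('D_v g q).1 = 0.
  have := @derive_lin R V _ W (linF (@fst_linear R W 'rV[R]_n)) g q v (fun x => smooth_continuous (smooth_fst x)) dg.
  by move=> /= <-; apply: derive_const_dir.
have E2 i : (wt i < m)%N -> ('D_v g q).2 0 (rk i) = 0.
  move=> wi; have := @derive_lin R V _ R^o (linF (l2k (rk i))) g q v (c2k _) dg.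
  by move=> /= <-; apply: derive_const_dir; exact: H2.
rewrite [LHS]surjective_pairing E1.
have -> : \sum_(i | (m <= wt i)%N) ('D_v g q).2 0 (rk i) *: (0 : W, delta_mx 0 (rk i) : 'rV[R]_n) =
   (0, \sum_(i | (m <= wt i)%N) ('D_v g q).2 0 (rk i) *: delta_mx 0 (rk i)).
  rewrite -[RHS]/(linF (@inr_linear R W 'rV[R]_n) _) linear_sum.
  by apply: eq_bigr => i _; rewrite linearZ.
congr (_, _); rewrite {1}[('D_v g q).2]row_sum_delta (reindex rk) /=; last exact: onW_bij.
rewrite [RHS]big_mkcond; apply: eq_bigr => i _.
by case: leqP => // /E2 ->; rewrite scale0r.
Qed.

(* If moving along a coordinate of order k changes g only in coordinates of
   order at least k, then composition with g cannot raise the order. *)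
Lemma germ_order_comp V W (I I' : finType) (dir : I -> V) (wt : I -> nat)
    (dir' : I' -> W) (wt' : I' -> nat) (f : W -> R) (g : V -> W) p :
  smooth f (g p) -> smooth g p ->
  (forall i, (0 < wt i)%N -> \forall q \near p, exists k : I' -> R,
     'D_(dir i) g q = \sum_(i' | (wt i <= wt' i')%N) k i' *: dir' i') ->
  germ_order dir wt (fun q => f (g q)) p <= germ_order dir' wt' f (g p).
Proof.
move=> sf sg H; rewrite /germ_order; have cg := smooth_continuous sg.
case: asboolP => [_|n1]; first by case: asboolP.
case: asboolP => [z|n2]; first by case: n1; exact: (near_comp cg z).
rewrite lez_nat; apply/bigmax_leqP => i /asboolP inv.
(* Suppose that wt i exceeds the order of f. Then f has zero derivative along every coordinate of
   order at least wt i, hence so has the composite along dir i. An index with wt i = 0 cannot be in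
   this position, so triangularity is needed for positive order only. *)
rewrite leqNgt; apply/negP => lt; apply: inv.
have wi : (0 < wt i)%N by exact: leq_ltn_trans lt.
have z i' : (wt i <= wt' i')%N -> \forall z \near g p, 'D_(dir' i') f z = 0.
  move=> wi'; apply: contrapT => ninv.
  have := leq_trans lt wi'; rewrite ltnNge; move/negP; apply.
  by apply: leq_bigmax_cond; apply/asboolP.
have zall : \forall z \near g p, forall i', (wt i <= wt' i')%N -> 'D_(dir' i') f z = 0.
  apply: filter_forall => i'; case: (leqP (wt i) (wt' i')) => h; last by near=> x.
  by apply: filterS (z i' h).
have dfg := near_comp cg (smooth_diff_nbhs sf).
have zg := near_comp cg zall.
have dg := smooth_diff_nbhs sg.
apply: filterS3 (filterI zg dg) dfg (H i wi) => q [q1 q2] q3 [k E].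
rewrite derive_comp // E derive_sumv // big1 // => i' wi'.
by rewrite q1 // scaler0.
Unshelve. all: by end_near. Qed.

End GermOrder.

Lemma findim_JO (R : realType) r : findim (Defs.JO r : normedModType R).
Proof. by apply: findim_prod; [exact: findimR|exact: findim_rV]. Qed.

Ltac findim_tac := solve [repeat first
  [exact: findimR | exact: findim_rV | exact: findim_J | exact: findim_JO | apply: findim_prod]].
#[local] Hint Extern 0 (findim _) => findim_tac : core.

(** * Derivatives along graphs and transversality of the ansatz *)

Section Graph.
Context {R : realType}.
Local Notation J := (@Defs.J R).
Local Notation jp := (@jp R).
Notation ee i := (delta_mx 0 i : 'rV[R]_2).

Lemma jp_add (x y : 'rV[R]_2) (s t : R) : jp (x, s) + jp (y, t) = jp (x + y, s + t).
Proof. by congr (_, _); apply/rowP => k; rewrite !mxE. Qed.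

Lemma jp_sub (x y : 'rV[R]_2) (s t : R) : jp (x, s) - jp (y, t) = jp (x - y, s - t).
Proof. by congr (_, _); apply/rowP => k; rewrite !mxE. Qed.

Lemma jp_scale (a : R) (x : 'rV[R]_2) (s : R) : a *: jp (x, s) = jp (a *: x, a * s).
Proof. by congr (_, _); apply/rowP => k; rewrite !mxE. Qed.

Definition dx (i : 'I_2) (f : J 0 -> R) (p : J 0) : R := 'D_(jp (ee i, 0)) f p.
Definition du (f : J 0 -> R) (p : J 0) : R := 'D_(jp (0, 1)) f p.

Lemma derive_comp1 (V : normedModType R) (f : R -> R) (g : V -> R) q v :
  differentiable g q -> differentiable f (g q) ->
  'D_v (fun x => f (g x)) q = 'D_v g q * 'D_1 f (g q).
Proof.
move=> dg df; rewrite derive_comp //.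
transitivity ('D_('D_v g q *: (1 : R)) f (g q)); first by rewrite [_ *: 1]mulr1.
by rewrite [LHS]deriveE // linearZ -deriveE.
Qed.

Lemma derive_along (f : J 0 -> R) u y i : smooth u y -> differentiable f (jp (y, u y)) ->
  'D_(ee i) (fun y => f (jp (y, u y))) y = dx i f (jp (y, u y)) + 'D_(ee i) u y * du f (jp (y, u y)).
Proof.
move=> su df; have sg : smooth (fun y => jp (y, u y)) y.
  by apply: (smooth_jp (x := id)) => //; exact: smooth_id.
rewrite (derive_comp (f := f) (g := fun y => jp (y, u y))) //; last exact: smooth_diff.
have -> : 'D_(ee i) (fun y => jp (y, u y)) y = jp (ee i, 0) + 'D_(ee i) u y *: jp (0, 1).
  rewrite derive_pair; [|exact: ex_diff|by apply/smooth_diff/smooth_row].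
  rewrite (derive_row (f := fun _ => u)) // derive_id jp_scale jp_add scaler0 addr0 add0r mulr1.
  by congr (_, _).
by rewrite derive_dirD.
Qed.

Lemma derive_vert (f : J 0 -> R) x s : 'D_1 (fun s => f (jp (x, s))) s = du f (jp (x, s)).
Proof.
apply: derive_eq_growth => // h; congr f.
by rewrite jp_scale jp_add scaler0 add0r.
Qed.

(** The two indices are kept as an unordered pair because either component of xi may be the
    nonvanishing one. *)
Lemma derive_vfield (Q : vfield) (f : J 0 -> R) q i i' :
  (i = 0 /\ i' = 1) \/ (i = 1 /\ i' = 0) -> differentiable f q ->
  'D_(vfield_dir Q q) f q = xi Q i q * dx i f q + xi Q i' q * dx i' f q + Defs.eta Q q * du f q.
Proof.
move=> ii df.
have -> : vfield_dir Q q = (xi Q i q *: jp (ee i, 0) + xi Q i' q *: jp (ee i', 0)) + Defs.eta Q q *: jp (0, 1).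
  rewrite /vfield_dir mkjet0E !jp_scale !jp_add; congr jp; congr (_, _); last by ring.
  rewrite scaler0 addr0; apply/rowP => k; rewrite !mxE.
  by case: ii => -[-> ->]; have [->|->] := I2 k; rewrite /= ?mulr1 ?mulr0 ?addr0 ?add0r.
rewrite derive_dirD // derive_dirD //; congr (_ + _ + _).
by rewrite [LHS]deriveE // linearZ -deriveE.
Qed.

Lemma indep2 (f g : J 0 -> R) p (a b : R) : functionally_independent [:: f; g] p ->
  (forall i, a * dx i f p + b * dx i g p = 0) -> a * du f p + b * du g p = 0 -> a = 0 /\ b = 0.
Proof.
move=> free Hx Hu.
pose c : 'rV[R]_2 := \row_(k < 2) (if k == 0 then a else b).
set M : 'M[R]_(2, 3) := \matrix_(i < size [:: f; g]) gradient (nth (cst 0) [:: f; g] i) p.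
have fM : row_free M by exact: free.
have c0 : c = 0.
  apply: (row_free_inj fM); rewrite mul0mx; apply/rowP => l.
  rewrite !mxE big_ord_recl big_ord1 !mxE /=.
  by case: (fintype.split _) => k; rewrite !mxE /ddx !mkjet0E; [exact: Hx|exact: Hu].
split; [have := congr1 (fun c : 'rV_2 => c 0 0) c0|have := congr1 (fun c : 'rV_2 => c 0 1) c0].
  by rewrite !mxE.
by rewrite !mxE.
Qed.

End Graph.

(** Here (X, X', h) is Q, z and w stand for zeta and omega with their partial derivatives, ui and
    ui' are the derivatives of u, and c is phi'. Differentiating zeta = phi(omega) along u and
    applying Q gives (zu - c wu) Q[u] = 0, so Q is tangent to the graph of u. If the derivative of
    omega along the graph vanishes in the direction i, tangency and X' != 0 make it vanish in the
    direction i' too. The same then holds for zeta, and the two gradients are parallel. *)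
Lemma transversal_algebra (F : fieldType) (zu wu c zi wi zi' wi' ui ui' X X' h : F) :
  X * zi + X' * zi' + h * zu = 0 -> X * wi + X' * wi' + h * wu = 0 ->
  zi + ui * zu = c * (wi + ui * wu) -> zi' + ui' * zu = c * (wi' + ui' * wu) ->
  zu - c * wu != 0 -> wi + ui * wu = 0 -> X' != 0 ->
  wu * zi - zu * wi = 0 /\ wu * zi' - zu * wi' = 0.
Proof.
move=> Ez Eo s1 s2 k0 E X0.
have Q0 : h - X * ui - X' * ui' = 0.
  apply: (mulfI k0); rewrite mulr0.
  have -> : (zu - c * wu) * (h - X * ui - X' * ui') =
    (X * zi + X' * zi' + h * zu) - c * (X * wi + X' * wi' + h * wu)
    - X * (zi + ui * zu - c * (wi + ui * wu)) - X' * (zi' + ui' * zu - c * (wi' + ui' * wu)) by ring.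
  by rewrite Ez Eo s1 s2; ring.
have E' : wi' + ui' * wu = 0.
  apply: (mulfI X0); rewrite mulr0.
  have -> : X' * (wi' + ui' * wu) = (X * wi + X' * wi' + h * wu) - X * (wi + ui * wu) - (h - X * ui - X' * ui') * wu by ring.
  by rewrite Eo E Q0; ring.
have Z : zi + ui * zu = 0 by rewrite s1 E mulr0.
have Z' : zi' + ui' * zu = 0 by rewrite s2 E' mulr0.
split.
  have -> : wu * zi - zu * wi = wu * (zi + ui * zu) - zu * (wi + ui * wu) by ring.
  by rewrite Z E; ring.
have -> : wu * zi' - zu * wi' = wu * (zi' + ui' * zu) - zu * (wi' + ui' * wu) by ring.
by rewrite Z' E'; ring.
Qed.

(** For G = zeta - phi(omega) along the graph of u, the field (X, Y) applied to G is a multiple of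
    Q[u], because Q annihilates zeta and omega. This is where the invariant surface condition meets
    the ansatz. *)
Lemma transport_algebra (F : comPzRingType) (X Y h zi zi' zu wi wi' wu ti ti' c : F) :
  X * zi + Y * zi' + h * zu = 0 -> X * wi + Y * wi' + h * wu = 0 ->
  X * (zi + ti * zu - (wi + ti * wu) * c) + Y * (zi' + ti' * zu - (wi' + ti' * wu) * c) =
  (c * wu - zu) * (h - X * ti - Y * ti').
Proof.
move=> E1 E2; apply/eqP; rewrite -subr_eq0; apply/eqP.
rewrite (_ : _ - _ = (X * zi + Y * zi' + h * zu) - c * (X * wi + Y * wi' + h * wu)); last by ring.
by rewrite E1 E2 mulr0 subrr.
Qed.

Section Point.
Context {R : realType}.
Local Notation J := (@Defs.J R).
Local Notation jp := (@jp R).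
Notation ee i := (delta_mx 0 i : 'rV[R]_2).
Variables (Q : @vfield R) (zeta omega : J 0 -> R) (u0 : 'rV[R]_2 -> R) (phi0 : R -> R) (x0 : 'rV[R]_2).
Let p0 : J 0 := jp (x0, u0 x0).
Let w0 := omega p0.
Hypothesis sz : smooth zeta p0.
Hypothesis so : smooth omega p0.
Hypothesis su : smooth u0 x0.
Hypothesis sphi : smooth phi0 w0.
Hypothesis sol : \forall y \near x0, zeta (jp (y, u0 y)) = phi0 (omega (jp (y, u0 y))).
Hypothesis iz : 'D_(vfield_dir Q p0) zeta p0 = 0.
Hypothesis io : 'D_(vfield_dir Q p0) omega p0 = 0.
Hypothesis ind : functionally_independent [:: zeta; omega] p0.
Hypothesis zu0 : du zeta p0 != 0.
Variables (i i' : 'I_2).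
Hypothesis ii : (i = 0 /\ i' = 1) \/ (i = 1 /\ i' = 0).
Hypothesis xi0 : xi Q i' p0 != 0.

Lemma sol_derive k : dx k zeta p0 + 'D_(ee k) u0 x0 * du zeta p0 =
  'D_1 phi0 w0 * (dx k omega p0 + 'D_(ee k) u0 x0 * du omega p0).
Proof.
have := @near_eq_derive _ _ _ _ _ _ (ee k) sol.
rewrite derive_along //; last exact: smooth_diff.
have sg : smooth (fun y => jp (y, u0 y)) x0.
  by apply: (smooth_jp (x := id)) => //; exact: smooth_id.
have sog : smooth (fun y => omega (jp (y, u0 y))) x0 by apply: (smooth_comp (f := omega)).
rewrite (derive_comp1 (f := phi0) (g := fun y => omega (jp (y, u0 y)))); [|exact: smooth_diff|exact: smooth_diff].
rewrite derive_along //; last exact: smooth_diff.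
by move=> ->; rewrite mulrC.
Qed.

(** Otherwise the differentiated ansatz makes the whole gradient of zeta equal to phi' times that of
    omega, against their independence. This makes zeta = phi(omega) solvable for u. *)
Lemma transversal_u : du zeta p0 - 'D_1 phi0 w0 * du omega p0 != 0.
Proof.
apply/eqP => E.
have [||/eqP] := @indep2 _ _ _ _ 1 (- 'D_1 phi0 w0) ind; last by rewrite oner_eq0.
- move=> k; have := sol_derive k; move: E.
  move: (du zeta p0) (du omega p0) ('D_1 phi0 w0) (dx k zeta p0) (dx k omega p0) ('D_(ee k) u0 x0) => a b c x y t E1 E2.
  have E3 : x - c * y = - t * (a - c * b) by rewrite mulrBr; lra.
  by rewrite mul1r mulNr E3 E1 mulr0.
- by rewrite mul1r mulNr.
Qed.

(** Otherwise the gradients of zeta and omega are dependent with coefficients omega_u and - zeta_u,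
    the latter being nonzero. *)
Lemma transversal_omega : dx i omega p0 + 'D_(ee i) u0 x0 * du omega p0 != 0.
Proof.
apply/eqP => E.
have dz : differentiable zeta p0 by exact: smooth_diff.
have do' : differentiable omega p0 by exact: smooth_diff.
have := iz; rewrite (derive_vfield _ ii) // => Ez.
have := io; rewrite (derive_vfield _ ii) // => Eo.
have s1 := sol_derive i; have s2 := sol_derive i'.
have k0 := transversal_u.
have hk k : k = i \/ k = i' by case: ii => -[-> ->]; have [->|->] := I2 k; [left|right|right|left].
have [h1 h2] := transversal_algebra Ez Eo s1 s2 k0 E xi0.
have [k||_ /eqP] := @indep2 R zeta omega p0 (du omega p0) (- du zeta p0) ind.
- by rewrite mulNr; case: (hk k) => ->; [exact: h1|exact: h2].
- by rewrite mulNr [du zeta p0 * _]mulrC subrr.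
- by rewrite oppr_eq0 (negbTE zu0).
Qed.

End Point.

(** * Slices, lines and agreement of jets *)

Section Slices.
Context {R : realType}.
Local Notation J := (@Defs.J R).
Local Notation jp := (@jp R).
Implicit Types V W : normedModType R.

Lemma smooth_graph (f : J 0 -> R) u y : smooth f (jp (y, u y)) -> smooth u y ->
  smooth (fun y => f (jp (y, u y))) y.
Proof.
move=> sf su; apply: (smooth_comp (f := f)) => //.
by apply: (smooth_jp (x := id)) => //; exact: smooth_id.
Qed.

Lemma jp0_linear : linear (fun a : R => jp (0, a)).
Proof. by move=> k a b; rewrite jp_scale jp_add scaler0 addr0. Qed.

Lemma flat_graph m (f : J 0 -> R) u u' y : smooth f (jp (y, u y)) -> smooth u y -> smooth u' y ->
  flat m (fun y => u y - u' y) y -> flat m (fun y => f (jp (y, u y)) - f (jp (y, u' y))) y.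
Proof.
move=> sf su su' fl; have si := smooth_id y.
apply: (agree_comp (f := f) (g := fun y => jp (y, u y)) (g' := fun y => jp (y, u' y))) => //.
- exact: smooth_jp.
- exact: smooth_jp.
apply: (@eq_flat _ _ _ _ (fun y => jp (0, u y - u' y))).
  by near=> z; rewrite jp_sub subrr.
apply: (flat_lin (l := linF jp0_linear)) => //; last exact: smooth_B.
move=> a; apply: smooth_continuous; apply: (smooth_jp (x := fun _ => 0) (s := id)).
  exact: smooth_cst.
exact: smooth_id.
Unshelve. all: by end_near. Qed.

(** Statements about finite increments are proved below for pairs of points near the diagonal; this
    turns them into statements along a line through each point near p, which can be
    differentiated. *)
Lemma near_diag V (p v : V) (P : V * V -> Prop) : (\forall z \near (p, p), P z) ->
  \forall q \near p, \forall s \near (0 : R), P (q, q + s *: v).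
Proof.
move=> /near_join H.
have c1 : {for p, continuous (fun q => (q, q))}.
  by apply: smooth_continuous; apply: smooth_pair; exact: smooth_id.
have := near_comp (P := fun z => \forall z' \near z, P z') c1 H.
apply: filterS => q Hq.
apply: (near_comp (g := fun s : R => (q, q + s *: v)) (P := P)); last by rewrite scale0r addr0.
apply: smooth_continuous; apply: smooth_pair; [exact: smooth_cst|exact: smooth_affine].
Qed.

Lemma iterD_line V W (G : V -> W) (x e : V) k :
  iterD (nseq k (1 : R)) (fun s : R => G (x + s *: e)) = fun s => iterD (nseq k e) G (x + s *: e).
Proof.
elim: k => // k IH; apply: funext => s.
rewrite -[LHS]/('D_(1 : R) (iterD (nseq k (1 : R)) (fun s : R => G (x + s *: e))) s) IH.
apply: derive_eq_growth => // h; congr (iterD _ _ _).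
by rewrite [h *: 1]mulr1 scalerDl addrCA.
Qed.

Lemma flat_shift m V W (f : V -> W) c x : flat m f (x + c) -> flat m (fun y => f (y + c)) x.
Proof. by move=> H vs vm; rewrite iterD_shift; apply: H. Qed.

Lemma eq_near_jet r (u u' : 'rV[R]_2 -> R) x : (\forall y \near x, u y = u' y) -> jet r u x = jet r u' x.
Proof.
move=> H; rewrite !jetE; apply: eq_mkjet => a b _.
exact: (nbhs_singleton (eq_near_iterD _ H)).
Qed.

Lemma agree_jet r (u u' : 'rV[R]_2 -> R) x : smooth u x -> smooth u' x ->
  flat r (fun y => u y - u' y) x -> jet r u x = jet r u' x.
Proof.
move=> su su' fl; rewrite !jetE; apply: eq_mkjet => a b ab.
apply/eqP; rewrite -subr_eq0 -(nbhs_singleton (iterD_B _ su su')); apply/eqP; apply: fl.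
by rewrite size_cat !size_nseq.
Qed.

Lemma derive_snd V W (F : V * R -> W) a s : 'D_(0, 1) F (a, s) = 'D_1 (fun s => F (a, s)) s.
Proof.
symmetry; apply: derive_eq_growth => // h; congr F.
by congr (_, _) => /=; rewrite ?scaler0 ?add0r.
Qed.

Lemma derive1n_iterD n (f : R -> R) : derive1n n f = iterD (nseq n (1 : R)) f.
Proof.
elim: n => [|n IH]; first by rewrite derive1n0.
by rewrite derive1nS IH; apply: funext => t; rewrite derive1E.
Qed.

Lemma smooth_slice V W (F : V * W -> R) a b : findim V -> findim W -> smooth F (a, b) -> smooth (fun y => F (a, y)) b.
Proof.
move=> fV fW sF; apply: (smooth_comp (f := F)) => //; first exact: findim_prod.
by apply: smooth_pair; [exact: smooth_cst|exact: smooth_id].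
Qed.

Lemma near_slice V W (a : V) (b : W) (P : V * W -> Prop) : (\forall z \near (a, b), P z) ->
  \forall y \near b, P (a, y).
Proof.
move=> H; apply: (near_comp (g := fun y => (a, y))) => //.
by apply: smooth_continuous; apply: smooth_pair; [exact: smooth_cst|exact: smooth_id].
Qed.

Lemma triangular_pair V W (I : finType) n (rk : I -> 'I_n) (wt : I -> nat) (g : V -> W * 'rV[R]_n) p v m :
  bijective rk -> smooth g p ->
  (\forall z \near (p, p), forall s : R, z.2 = z.1 + s *: v ->
     (g z.2).1 = (g z.1).1 /\ forall i, (wt i < m)%N -> (g z.2).2 0 (rk i) = (g z.1).2 0 (rk i)) ->
  \forall q \near p, exists k : I -> R, 'D_v g q = \sum_(i | (m <= wt i)%N) k i *: (0, delta_mx 0 (rk i)).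
Proof.
move=> brk sg H; have dg := smooth_diff_nbhs sg.
apply: filterS2 (near_diag v H) dg => q Hq dq.
apply: triangular_dir => //.
  by apply: filterS Hq => s /(_ s erefl)[].
by move=> i wi; apply: filterS Hq => s /(_ s erefl)[_ ]; apply.
Qed.

End Slices.

Lemma smooth_near_smooth (R : realType) (V : normedModType R) (f : V -> R) p : smooth_near f p <-> smooth f p.
Proof. by []. Qed.

Lemma invariant_of_zero (R : realType) r (Q : @vfield R) u x : smooth u x -> smooth_vfield Q (Defs.jet 0 u x) ->
  (\forall y \near x, charfun Q u y = 0) -> invariant_set Q (Defs.jet r u x).
Proof.
move=> su sQ H a b ab.
have sc : smooth (characteristic Q) (Defs.jet 1 u x) by apply: smooth_characteristic; rewrite trunc_jet.
have E : (fun y => characteristic Q (Defs.jet 1 u y)) = charfun Q u.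
  by apply: funext => y; rewrite characteristic_jet.
have [s1 h1] := TDn_jet 1 b su sc.
have [s2 h2] := TDn_jet 0 a su s1.
rewrite trunc_jet; last by rewrite addn1 addnS.
rewrite (nbhs_singleton h2) (nbhs_singleton (eq_near_iterD _ h1)) E -iterD_cat.
rewrite (nbhs_singleton (@eq_near_iterD R _ _ _ (fun _ => 0) _ _ H)).
exact: (congr1 (fun f => f x) (@iterD_cst0 R _ _ _)).
Qed.

(** * Jets of ansatz solutions *)

Section Main.
Context {R : realType}.
Local Notation J := (@Defs.J R).
Local Notation jp := (@jp R).
Local Notation jet := (@Defs.jet R).
Local Notation JO := (@Defs.JO R).
Notation ee i := (delta_mx 0 i : 'rV[R]_2).
Notation wd a b := (nseq a (ee 0) ++ nseq b (ee 1)).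
Variable r : nat.
Variables (Q : @vfield R) (zeta omega : J 0 -> R) (u0 : 'rV[R]_2 -> R) (phi0 : R -> R) (x0 : 'rV[R]_2).
Let p0 : J 0 := jp (x0, u0 x0).
Let w0 : R := omega p0.
Let j0 : J r := jet r u0 x0.
Let o0 : JO r := ojet r phi0 w0.
Hypothesis sz : smooth zeta p0.
Hypothesis so : smooth omega p0.
Hypothesis su : smooth u0 x0.
Hypothesis sphi : smooth phi0 w0.
Hypothesis sol : \forall y \near x0, zeta (jp (y, u0 y)) = phi0 (omega (jp (y, u0 y))).
Hypothesis tru : du zeta p0 - 'D_1 phi0 w0 * du omega p0 != 0.
Variables (i i' : 'I_2).
(* i' is an index with xi^i' != 0 at p0; then D_i omega != 0, so that omega is a
   coordinate on the line through x0 in the direction e_i. *)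
Hypothesis ii : (i = 0 /\ i' = 1) \/ (i = 1 /\ i' = 0).
Hypothesis tro : dx i omega p0 + 'D_(ee i) u0 x0 * du omega p0 != 0.
Let e : 'rV[R]_2 := ee i.

Let mw (k : 'I_#|{: midx r}|) := wd (mi1 (enum_val k)) (mi2 (enum_val k)).
Let mm (k : 'I_#|{: midx r}|) := @mon R (mi1 (enum_val k)) (mi2 (enum_val k)).

Lemma mwP k l : iterD (mw l) (mm k) 0 = (k == l)%:R.
Proof.
rewrite iterD_mon; congr (_%:R); congr nat_of_bool.
apply/andP/eqP => [[/eqP h1 /eqP h2]|->] //.
by apply: enum_val_inj; exact: midx_inj.
Qed.

Let pm (k : 'I_r.+1) := @pw R k.
Let pwd (k : 'I_r.+1) := nseq k (1 : R).

Lemma pwP k l : iterD (pwd l) (pm k) 0 = (k == l)%:R.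
Proof. by rewrite iterD_pw_at0. Qed.

(* tay (j, .) is a function with r-jet j, and pol (o, .) one with jet o; they
   give back u0 and phi0 at j0 and o0. *)
Definition tay : J r * 'rV[R]_2 -> R := tayl mm mw u0 x0.
Definition pol : JO r * R -> R := tayl pm pwd phi0 w0.

Lemma j0E : j0 = (x0, \row_k iterD (mw k) u0 x0).
Proof. exact: jetE. Qed.

Lemma o0E : o0 = (w0, \row_k iterD (pwd k) phi0 w0).
Proof. by congr (_, _); apply/rowP => k; rewrite !mxE derive1n_iterD. Qed.

Lemma tay_base y : tay (j0, y) = u0 y.
Proof. by rewrite j0E; exact: tayl_base. Qed.

Lemma pol_base t : pol (o0, t) = phi0 t.
Proof. by rewrite o0E; exact: tayl_base. Qed.

Lemma pol_jet (o : JO r) (l : 'I_r.+1) : iterD (nseq l (1 : R)) (fun t => pol (o, t)) o.1 = o.2 0 l.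
Proof.
case: o => w c; apply: (@tayl_jet _ _ _ pm pwd _ _ pwP phi0 w0 l) => // k t; exact: smooth_pw.
Qed.

Lemma pol_val (o : JO r) : pol (o, o.1) = o.2 0 0.
Proof. exact: (pol_jet o 0). Qed.

Lemma ojet_pol (o : JO r) : ojet r (fun t => pol (o, t)) o.1 = o.
Proof.
case: o => w c; congr (_, _); apply/rowP => k; rewrite mxE derive1n_iterD.
exact: (pol_jet (w, c) k).
Qed.

Lemma jet_tay (j : J r) : jet r (fun y => tay (j, y)) j.1 = j.
Proof.
case: j => x c; rewrite jetE; congr (_, _); apply/rowP => k; rewrite mxE.
apply: (@tayl_jet _ _ _ mm mw _ _ mwP u0 x0 k) => // l t; exact: smooth_mon.
Qed.

Lemma smooth_tay z : smooth u0 (z.2 + (x0 - z.1.1)) -> smooth tay z.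
Proof. by move=> s; apply: smooth_tayl => // k y; exact: smooth_mon. Qed.

Lemma smooth_pol z : smooth phi0 (z.2 + (w0 - z.1.1)) -> smooth pol z.
Proof. by move=> s; apply: smooth_tayl => // k y; exact: smooth_pw. Qed.

Lemma smooth_tay0 : smooth tay (j0, x0).
Proof. by apply: smooth_tay; rewrite /= subrr addr0. Qed.

Lemma smooth_tay_diag (j : J r) : smooth tay (j, j.1).
Proof. by apply: smooth_tay; rewrite /= addrC subrK. Qed.

Lemma smooth_pol_diag (o : JO r) : smooth pol (o, o.1).
Proof. by apply: smooth_pol; rewrite /= addrC subrK. Qed.

Lemma smooth_pol0 : smooth pol (o0, w0).
Proof. exact: (smooth_pol_diag o0). Qed.

(* FU = 0 defines implicitly u = U (o, .), the solution of the ansatz for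
   phi = pol (o, .). *)
Definition FU (z : (JO r * 'rV[R]_2) * R) : R :=
  zeta (jp (z.1.2, z.2)) - pol (z.1.1, omega (jp (z.1.2, z.2))).

Lemma smooth_FUpart z : smooth omega (jp (z.1.2, z.2)) ->
  smooth (fun z : (JO r * 'rV[R]_2) * R => omega (jp (z.1.2, z.2))) z.
Proof.
move=> s; apply: (smooth_comp (f := omega)) => //.
apply: (smooth_jp (x := fun z : (JO r * 'rV[R]_2) * R => z.1.2)); last exact: smooth_snd.
by apply: smooth_snd_comp => //; exact: smooth_fst.
Qed.

Lemma smooth_FU z : smooth zeta (jp (z.1.2, z.2)) -> smooth omega (jp (z.1.2, z.2)) ->
  smooth pol (z.1.1, omega (jp (z.1.2, z.2))) -> smooth FU z.
Proof.
move=> s1 s2 s3; apply: smooth_B.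
  apply: (smooth_comp (f := zeta)) => //.
  apply: (smooth_jp (x := fun z : (JO r * 'rV[R]_2) * R => z.1.2)); last exact: smooth_snd.
  by apply: smooth_snd_comp => //; exact: smooth_fst.
apply: (smooth_comp (f := pol)) => //; apply: smooth_pair; last exact: smooth_FUpart.
by apply: smooth_fst_comp => //; exact: smooth_fst.
Qed.

Lemma FU_base : FU ((o0, x0), u0 x0) = 0.
Proof. by rewrite /FU /= pol_base (nbhs_singleton sol) subrr. Qed.

Lemma smooth_FU0 : smooth FU ((o0, x0), u0 x0).
Proof. by apply: smooth_FU => //; exact: smooth_pol0. Qed.

Lemma derive_FU0 : 'D_(0, 1) FU ((o0, x0), u0 x0) != 0.
Proof.
rewrite derive_snd /FU /=.
have -> : (fun s => zeta (jp (x0, s)) - pol (o0, omega (jp (x0, s)))) =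
          (fun s => zeta (jp (x0, s)) - phi0 (omega (jp (x0, s)))).
  by apply: funext => s; rewrite pol_base.
have sj : smooth (fun s => jp (x0, s)) (u0 x0).
  by apply: (smooth_jp (x := fun _ => x0)); [exact: smooth_cst|exact: smooth_id].
have s1 : smooth (fun s => zeta (jp (x0, s))) (u0 x0) by apply: (smooth_comp (f := zeta)).
have s2 : smooth (fun s => omega (jp (x0, s))) (u0 x0) by apply: (smooth_comp (f := omega)).
have s3 : smooth (fun s => phi0 (omega (jp (x0, s)))) (u0 x0) by apply: (smooth_comp (f := phi0)).
rewrite derive_B; [|exact: smooth_diff|exact: smooth_diff].
rewrite (derive_comp1 (g := fun s => omega (jp (x0, s)))); [|exact: smooth_diff|exact: smooth_diff].
by rewrite !derive_vert mulrC.
Qed.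

Lemma exists_U : exists2 U : JO r * 'rV[R]_2 -> R, smooth U (o0, x0) &
  \forall z \near ((o0, x0), u0 x0), FU z = 0 <-> z.2 = U z.1.
Proof.
apply: ift => //; [exact: smooth_FU0|exact: FU_base|exact: derive_FU0].
Qed.

(** * The section from jets of phi to jets of u *)

Variable U : JO r * 'rV[R]_2 -> R.
Hypothesis sU : smooth U (o0, x0).
Hypothesis UP : \forall z \near ((o0, x0), u0 x0), FU z = 0 <-> z.2 = U z.1.

Lemma U_at : U (o0, x0) = u0 x0.
Proof. by symmetry; apply: (nbhs_singleton UP).1; exact: FU_base. Qed.

Lemma U_base : \forall y \near x0, U (o0, y) = u0 y.
Proof.
have c : {for x0, continuous (fun y => ((o0, y), u0 y))}.
  apply: smooth_continuous; apply: smooth_pair => //.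
  by apply: smooth_pair; [exact: smooth_cst|exact: smooth_id].
have := near_comp (P := fun z => FU z = 0 <-> z.2 = U z.1) c UP.
apply: filterS2 sol => y E /= [H _]; symmetry; apply: H.
by rewrite /FU /= pol_base E subrr.
Qed.

Let sUg : smooth (fun z => (z, U z)) (o0, x0).
Proof. by apply: smooth_pair => //; exact: smooth_id. Qed.

Lemma near_U (P : (JO r * 'rV[R]_2) * R -> Prop) :
  (\forall z \near ((o0, x0), u0 x0), P z) -> \forall z \near (o0, x0), P (z, U z).
Proof. by move=> H; apply: (near_comp (smooth_continuous sUg)); rewrite U_at. Qed.

Definition solves (z : JO r * 'rV[R]_2) : Prop := zeta (jp (z.2, U z)) = pol (z.1, omega (jp (z.2, U z))).
(** The condition on a whole neighbourhood: it passes from (o0, x0) to nearby points, where the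
    identity can then be differentiated. *)
Definition solves_near (z : JO r * 'rV[R]_2) : Prop := \forall z' \near z, solves z'.

Lemma U_sol : \forall z \near (o0, x0), solves z.
Proof.
apply: filterS (near_U UP) => z /= H; apply/eqP; rewrite -subr_eq0; apply/eqP.
exact: H.2.
Qed.

(* FX = 0 defines the point xsec o of the line x0 + R e where omega, evaluated
   along u = U (o, .), equals the value of omega prescribed by o. *)
Definition FX (z : JO r * R) : R := omega (jp (x0 + z.2 *: e, U (z.1, x0 + z.2 *: e))) - z.1.1.

Lemma smooth_FX0 : smooth FX (o0, 0).
Proof.
have s1 : smooth (fun z : JO r * R => x0 + z.2 *: e) (o0, 0).
  by apply: smooth_D; [exact: smooth_cst|apply: smooth_Zl; exact: smooth_snd].
have s2 : smooth (fun z : JO r * R => U (z.1, x0 + z.2 *: e)) (o0, 0).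
  apply: (smooth_comp (f := U)) => //=; first by rewrite scale0r addr0.
  by apply: smooth_pair => //; exact: smooth_fst.
apply: smooth_B; last by apply: smooth_fst_comp => //; exact: smooth_fst.
apply: (smooth_comp (f := omega)) => //=; first by rewrite scale0r addr0 U_at.
exact: smooth_jp.
Qed.

Lemma FX_base : FX (o0, 0) = 0.
Proof. by rewrite /FX /= scale0r addr0 U_at subrr. Qed.

Lemma derive_line_omega (c : R) :
  'D_1 (fun s : R => omega (jp (x0 + s *: e, u0 (x0 + s *: e))) - c) 0 != 0.
Proof.
have sg : smooth (fun y => omega (jp (y, u0 y))) x0 by exact: smooth_graph.
have sg' : smooth (fun y => omega (jp (y, u0 y))) (x0 + (0 : R) *: e) by rewrite scale0r addr0.
rewrite derive_B; last exact: differentiable_cst.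
  rewrite derive_cst subr0 (derive_comp (f := fun y => omega (jp (y, u0 y))) (g := fun s : R => x0 + s *: e)).
  - by rewrite derive_affine scale0r addr0 derive_along //; exact: smooth_diff.
  - exact/smooth_diff/smooth_affine.
  - exact: smooth_diff.
apply: (@differentiable_comp _ _ _ _ (fun s : R => x0 + s *: e) (fun y => omega (jp (y, u0 y)))).
  exact/smooth_diff/smooth_affine.
exact: smooth_diff.
Qed.

Lemma near_line (P : 'rV[R]_2 -> Prop) : (\forall y \near x0, P y) -> \forall s \near (0 : R), P (x0 + s *: e).
Proof.
move=> H; apply: (near_comp (g := fun s : R => x0 + s *: e)); last by rewrite scale0r addr0.
exact/smooth_continuous/smooth_affine.
Qed.

Lemma derive_FX0 : 'D_(0, 1) FX (o0, 0) != 0.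
Proof.
rewrite derive_snd /FX /= (near_eq_derive (g := fun s : R => omega (jp (x0 + s *: e, u0 (x0 + s *: e))) - w0)).
  exact: derive_line_omega.
by apply: filterS (near_line U_base) => s ->.
Qed.

Lemma exists_xsec : exists2 sg : JO r -> R, smooth sg o0 &
  \forall z \near (o0, 0), FX z = 0 <-> z.2 = sg z.1.
Proof.
apply: ift => //; [exact: smooth_FX0|exact: FX_base|exact: derive_FX0].
Qed.

Variable sg : JO r -> R.
Hypothesis ssg : smooth sg o0.
Hypothesis sgP : \forall z \near (o0, 0), FX z = 0 <-> z.2 = sg z.1.

Definition xsec (o : JO r) : 'rV[R]_2 := x0 + sg o *: e.
(* Section of the reduction: the r-jet at xsec o of the ansatz solution that
   corresponds to o. *)
Definition jsec (o : JO r) : J r :=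
  Defs.mkjet r (xsec o) (fun a b => iterD [seq (0, v) | v <- wd a b] U (o, xsec o)).

Lemma sg_at : sg o0 = 0.
Proof. by symmetry; apply: (nbhs_singleton sgP).1; exact: FX_base. Qed.

Lemma xsec_at : xsec o0 = x0.
Proof. by rewrite /xsec sg_at scale0r addr0. Qed.

Lemma smooth_xsec : smooth xsec o0.
Proof. by apply: smooth_D; [exact: smooth_cst|exact: smooth_Zl]. Qed.

Let sXg : smooth (fun o => (o, xsec o)) o0.
Proof. by apply: smooth_pair; [exact: smooth_id|exact: smooth_xsec]. Qed.

Lemma near_xsec (P : JO r * 'rV[R]_2 -> Prop) :
  (\forall z \near (o0, x0), P z) -> \forall o \near o0, P (o, xsec o).
Proof. by move=> H; apply: (near_comp (smooth_continuous sXg)); rewrite xsec_at. Qed.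

Lemma xsec_omega : \forall o \near o0, omega (jp (xsec o, U (o, xsec o))) = o.1.
Proof.
have c : {for o0, continuous (fun o => (o, sg o))}.
  by apply: smooth_continuous; apply: smooth_pair => //; exact: smooth_id.
have := near_comp (P := fun z => FX z = 0 <-> z.2 = sg z.1) c; rewrite sg_at => /(_ sgP).
apply: filterS => o /= H; apply/eqP; rewrite -subr_eq0; apply/eqP.
exact: H.2.
Qed.

Lemma jsecE o : jsec o = jet r (fun y => U (o, y)) (xsec o).
Proof. by rewrite jetE; apply: eq_mkjet => a b _; rewrite iterD_pairr. Qed.

Lemma smooth_jsec : smooth jsec o0.
Proof.
apply: (smooth_mkjet (c := fun a b o => iterD [seq (0, v) | v <- wd a b] U (o, xsec o))); first exact: smooth_xsec.
move=> a b _; apply: (smooth_comp (f := iterD [seq (0, v) | v <- wd a b] U)) => //.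
by rewrite xsec_at; exact: smooth_iterD.
Qed.

Lemma jsec_at : jsec o0 = j0.
Proof. by rewrite jsecE xsec_at; apply: eq_near_jet; exact: U_base. Qed.

(** The condition on omega places its value at the base point of [pol (z.1, .)], where this function
    is known to be smooth. *)
Lemma U_ansatz : \forall z \near (o0, x0), omega (jp (z.2, U z)) = z.1.1 ->
  ansatz_solution zeta omega (fun y => U (z.1, y)) (fun t => pol (z.1, t)) z.2.
Proof.
apply: filterS2 (near_join U_sol) (smooth_nbhs sU) => z; case: z => a y H sUz /= E.
split; rewrite ?jet0E.
- by apply/smooth_near_smooth; exact: smooth_slice.
- by apply/smooth_near_smooth; rewrite E; apply: smooth_slice => //; exact: smooth_pol_diag.
- by apply: filterS (near_slice H) => y' /=; rewrite !jet0E.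
Qed.

Lemma FU_slice (o : JO r) y : 
  'D_(0, 1) (fun z : 'rV[R]_2 * R => FU ((o, z.1), z.2)) y = 'D_(0, 1) FU ((o, y.1), y.2).
Proof. by case: y => y s; rewrite !derive_snd. Qed.

Lemma smooth_FU_slice (o : JO r) y : smooth FU ((o, y.1), y.2) ->
  smooth (fun z : 'rV[R]_2 * R => FU ((o, z.1), z.2)) y.
Proof.
move=> s; apply: (smooth_comp (f := FU)) => //.
apply: smooth_pair; last exact: smooth_snd.
by apply: smooth_pair; [exact: smooth_cst|exact: smooth_fst].
Qed.

Lemma near_FU : \forall z \near (o0, x0), smooth FU (z, U z) /\ 'D_(0, 1) FU (z, U z) != 0.
Proof.
apply: (@near_U (fun z => smooth FU z /\ 'D_(0, 1) FU z != 0)).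
apply: filterI; first exact: (smooth_nbhs smooth_FU0).
exact: (near_neq0 (smooth_continuous (smooth_derive ((0, 1) : (JO r * 'rV[R]_2) * R) smooth_FU0)) derive_FU0).
Qed.

Lemma pol_shift (o : JO r) (k : 'I_r.+1) (s t : R) :
  pol (o + s *: ddphi k, t) - pol (o, t) = s * pw k (t + - o.1).
Proof.
case: o => w c; have -> : (w, c) + s *: ddphi k = (w, c + s *: delta_mx 0 k).
  by congr (_, _) => /=; rewrite [_ *: 0]mulr0 addr0.
exact: tayl_shift.
Qed.

(* A change of the k-th coordinate of o changes pol by a multiple of
   (t - omega)^k, hence u by a function flat to order k - 1. *)
Lemma jsec_core : \forall z \near (o0, o0), forall (k : 'I_r.+1) (s : R), (0 < k)%N -> z.2 = z.1 + s *: ddphi k ->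
  xsec z.2 = xsec z.1 /\ jet k.-1 (fun y => U (z.2, y)) (xsec z.1) = jet k.-1 (fun y => U (z.1, y)) (xsec z.1).
Proof.
have s1 : smooth (fun z : JO r * JO r => z.1) (o0, o0) by exact: smooth_fst.
have s2 : smooth (fun z : JO r * JO r => z.2) (o0, o0) by exact: smooth_snd.
have sX1 : smooth (fun z : JO r * JO r => xsec z.1) (o0, o0).
  by apply: (smooth_compv (f := xsec)) => //; exact: smooth_xsec.
have sU1 : smooth (fun z : JO r * JO r => U (z.1, xsec z.1)) (o0, o0).
  apply: (smooth_comp (f := U)) => //=; first by rewrite xsec_at.
  exact: smooth_pair.
have sg1 : smooth (fun z : JO r * JO r => sg z.1) (o0, o0).
  by apply: (smooth_comp (f := sg)).
have n1 : \forall z \near (o0, o0), FU ((z.2, xsec z.1), U (z.1, xsec z.1)) = 0 <-> U (z.1, xsec z.1) = U (z.2, xsec z.1).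
  apply: (near_comp (g := fun z : JO r * JO r => ((z.2, xsec z.1), U (z.1, xsec z.1)))
     (P := fun z => FU z = 0 <-> z.2 = U z.1)) => /=; last by rewrite xsec_at U_at.
  by apply: smooth_continuous; apply: smooth_pair => //; apply: smooth_pair.
have n2 : \forall z \near (o0, o0), FX (z.2, sg z.1) = 0 <-> sg z.1 = sg z.2.
  apply: (near_comp (g := fun z : JO r * JO r => (z.2, sg z.1))
     (P := fun z => FX z = 0 <-> z.2 = sg z.1)) => /=; last by rewrite sg_at.
  by apply: smooth_continuous; apply: smooth_pair.
have n3 := near_fst o0 xsec_omega.
have n4 := near_fst o0 (near_xsec U_sol).
have n4' : \forall z \near (o0, o0), solves_near (z.1, xsec z.1).
  have h := near_xsec (P := solves_near) (near_join U_sol); exact: (near_fst o0 h).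
have n5 := near_fst o0 (near_xsec (smooth_nbhs sU)).
have n6 : \forall z \near (o0, o0), smooth U (z.2, xsec z.1).
  apply: (near_comp (g := fun z : JO r * JO r => (z.2, xsec z.1))) => /=.
    by apply: smooth_continuous; apply: smooth_pair.
  by rewrite xsec_at; exact: smooth_nbhs.
have n7 := near_fst o0 (near_xsec near_FU).
have n8 : \forall z \near (o0, o0), solves_near (z.2, xsec z.1).
  apply: (near_comp (g := fun z : JO r * JO r => (z.2, xsec z.1))
    (P := solves_near)) => /=.
    by apply: smooth_continuous; apply: smooth_pair.
  by rewrite xsec_at; exact: (near_join U_sol).
have n9 : \forall z \near (o0, o0), smooth omega (jp (xsec z.1, U (z.1, xsec z.1))).
  apply: (near_comp (g := fun z : JO r * JO r => jp (xsec z.1, U (z.1, xsec z.1)))) => /=.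
    by apply: smooth_continuous; apply: smooth_jp.
  by rewrite xsec_at U_at; exact: smooth_nbhs.
near=> z => k s k0 Ez.
have h1 : FU ((z.2, xsec z.1), U (z.1, xsec z.1)) = 0 <-> U (z.1, xsec z.1) = U (z.2, xsec z.1) by apply: (near n1 z).
have h2 : FX (z.2, sg z.1) = 0 <-> sg z.1 = sg z.2 by apply: (near n2 z).
have h3 : omega (jp (xsec z.1, U (z.1, xsec z.1))) = z.1.1 by apply: (near n3 z).
have h4 : solves (z.1, xsec z.1) by apply: (near n4 z).
have h4' : solves_near (z.1, xsec z.1) by apply: (near n4' z).
have h5 : smooth U (z.1, xsec z.1) by apply: (near n5 z).
have h6 : smooth U (z.2, xsec z.1) by apply: (near n6 z).
have [h7 h7'] : smooth FU ((z.1, xsec z.1), U (z.1, xsec z.1)) /\ 'D_(0, 1) FU ((z.1, xsec z.1), U (z.1, xsec z.1)) != 0 by apply: (near n7 z).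
have h8 : solves_near (z.2, xsec z.1) by apply: (near n8 z).
have h9 : smooth omega (jp (xsec z.1, U (z.1, xsec z.1))) by apply: (near n9 z).
move: Ez h1 h2 h3 h4 h4' h5 h6 h7 h7' h8 h9; move: (z.1) (z.2) => o o' Ez h1 h2 h3 h4 h4' h5 h6 h7 h7' h8 h9.
have w' : o'.1 = o.1 by rewrite Ez /= [_ *: 0]mulr0 addr0.
have c0 : o'.2 0 0 = o.2 0 0.
  by rewrite Ez !mxE /= [0 == k](_ : _ = false) ?mulr0 ?addr0 //; apply/eqP => E; move: k0; rewrite -E.
(* As k > 0, both o and o' carry the same value of omega and of phi. Uniqueness for [FU] gives both
   solutions the same value over [xsec o], and then uniqueness for [FX] gives the same point of the
   line. *)
have e1 : U (o, xsec o) = U (o', xsec o).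
  by apply/h1; rewrite /FU /= [zeta _]h4 /= h3 -{2}w' !pol_val c0 subrr.
have e2 : xsec o' = xsec o.
  rewrite /xsec; congr (_ + _ *: _); symmetry; apply/h2.
  by rewrite /FX /= -/(xsec o) -e1 h3 w' subrr.
split=> //; symmetry.
have sUo : smooth (fun y => U (o, y)) (xsec o) by exact: smooth_slice.
have sUo' : smooth (fun y => U (o', y)) (xsec o) by exact: smooth_slice.
apply: agree_jet => //.
pose Fo (z : 'rV[R]_2 * R) := FU ((o, z.1), z.2).
have A1 : smooth Fo (xsec o, U (o, xsec o)) by apply: smooth_FU_slice.
have A2 : 'D_(0, 1) Fo (xsec o, U (o, xsec o)) != 0 by rewrite FU_slice.
apply: (agree_implicit (g := fun y => U (o, y)) (g' := fun y => U (o', y)) (@findim_rV R 2) A1 A2 sUo sUo' e1).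
(* The defect of [U (o', .)] in the equation of [U (o, .)] is the change of [pol] at the value of
   omega along [U (o', .)]; this value is o.1 at [xsec o], the centre of the monomial. *)
apply: (@eq_flat _ _ _ _ (fun y => (- s) * pw k (omega (jp (y, U (o', y))) + - o.1))).
  apply: filterS2 (near_slice h4') (near_slice h8) => y H H'.
  by rewrite /Fo /FU /= [zeta _]H subrr sub0r [zeta (jp (y, U (o', y)))]H' mulNr -pol_shift -Ez.
have sw : smooth (fun y => omega (jp (y, U (o', y)))) (xsec o).
  by apply: smooth_graph => //; rewrite -e1.
have sp t : smooth (fun t : R => pw k (t + - o.1)) t.
  apply: (smooth_comp (f := pw k)) => //; first exact: smooth_pw.
  by apply: smooth_D; [exact: smooth_id|exact: smooth_cst].
apply: flat_M; first exact: smooth_cst.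
  exact: (smooth_comp (f := fun t : R => pw k (t + - o.1)) (g := fun y => omega (jp (y, U (o', y))))).
apply: (flat_comp (f := fun t : R => pw k (t + - o.1)) (g := fun y => omega (jp (y, U (o', y))))) => //.
apply: flat_shift; rewrite -e1 h3 subrr; apply: flat_pw; by rewrite prednK.
Unshelve. all: by end_near. Qed.

Lemma jsec_tri (k : 'I_r.+1) : (0 < k)%N -> \forall o \near o0, exists c : midx r -> R,
  'D_(ddphi k) jsec o = \sum_(al | (k <= mi_abs al)%N) c al *: ddu al.
Proof.
move=> k0; apply: (@triangular_pair R _ _ _ _ enum_rank (@mi_abs r) jsec) => //.
  exact: smooth_jsec.
apply: filterS jsec_core => z H s Ez; have [h1 h2] := H k s k0 Ez.
rewrite !jsecE h1; split=> // al wal.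
have al1 : (mi1 al + mi2 al <= k.-1)%N by rewrite -ltnS prednK.
rewrite -!jcoord_idx !jcoord_jet ?mi_le //.
by rewrite -!(@jcoord_jet R k.-1) // h2.
Qed.

(** * The retraction from jets of u to jets of phi *)

Definition taug (f : J 0 -> R) (z : J r * 'rV[R]_2) : R := f (jp (z.2, tay z)).

Lemma smooth_taug f z : smooth f (jp (z.2, tay z)) -> smooth tay z -> smooth (taug f) z.
Proof.
move=> sf st; apply: (smooth_comp (f := f)) => //.
by apply: (smooth_jp (x := snd)) => //; exact: smooth_snd.
Qed.

Definition line (z : J r * R) : J r * 'rV[R]_2 := (z.1, z.1.1 + z.2 *: e).

Lemma smooth_line z : smooth line z.
Proof.
have s1 : smooth (fun z : J r * R => z.1) z by exact: smooth_fst.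
apply: smooth_pair => //; apply: smooth_D; last by apply: smooth_Zl; exact: smooth_snd.
by apply: smooth_fst_comp.
Qed.

Lemma line0 j : line (j, 0) = (j, j.1).
Proof. by rewrite /line /= scale0r addr0. Qed.

Lemma tay_at : tay (j0, x0) = u0 x0.
Proof. exact: tay_base. Qed.

Lemma smooth_tau : smooth (taug omega) (j0, x0).
Proof. by apply: smooth_taug; [rewrite /= tay_at|exact: smooth_tay0]. Qed.

Lemma smooth_tauz : smooth (taug zeta) (j0, x0).
Proof. by apply: smooth_taug; [rewrite /= tay_at|exact: smooth_tay0]. Qed.

(* FW = 0 defines sigma (j, t): along the line j.1 + R e, omega takes the value t
   at the parameter sigma (j, t). *)
Definition FW (z : (J r * R) * R) : R := taug omega (line (z.1.1, z.2)) - z.1.2.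

Lemma smooth_FW z : smooth (taug omega) (line (z.1.1, z.2)) -> smooth FW z.
Proof.
move=> s; have s1 : smooth (fun z : (J r * R) * R => z.1) z by exact: smooth_fst.
apply: smooth_B; last by apply: smooth_snd_comp.
apply: (smooth_comp (f := taug omega)) => //.
apply: (smooth_compv (f := line)) => //; first exact: smooth_line.
by apply: smooth_pair; [apply: smooth_fst_comp|exact: smooth_snd].
Qed.

Lemma FW_base : FW ((j0, w0), 0) = 0.
Proof. by rewrite /FW line0 /taug /= tay_at subrr. Qed.

Lemma smooth_FW0 : smooth FW ((j0, w0), 0).
Proof. by apply: smooth_FW; rewrite line0; exact: smooth_tau. Qed.

Lemma derive_FW0 : 'D_(0, 1) FW ((j0, w0), 0) != 0.
Proof.
rewrite derive_snd /FW /= (_ : (fun s => _) = (fun s : R => omega (jp (x0 + s *: e, u0 (x0 + s *: e))) - w0)).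
  exact: derive_line_omega.
by apply: funext => s; rewrite /taug /line /= tay_base.
Qed.

Lemma exists_sigma : exists2 sigma : J r * R -> R, smooth sigma (j0, w0) &
  \forall z \near ((j0, w0), 0), FW z = 0 <-> z.2 = sigma z.1.
Proof.
apply: ift => //; [exact: smooth_FW0|exact: FW_base|exact: derive_FW0].
Qed.

Variable sigma : J r * R -> R.
Hypothesis ssi : smooth sigma (j0, w0).
Hypothesis siP : \forall z \near ((j0, w0), 0), FW z = 0 <-> z.2 = sigma z.1.

Lemma sigma_at : sigma (j0, w0) = 0.
Proof. by symmetry; apply: (nbhs_singleton siP).1; exact: FW_base. Qed.

(* The function phi with zeta = phi(omega) on the line j.1 + R e, for u = tay (j, .). *)
Definition Phi (z : J r * R) : R := taug zeta (line (z.1, sigma z)).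

Lemma smooth_Phi_at z : smooth sigma z -> smooth (taug zeta) (line (z.1, sigma z)) -> smooth Phi z.
Proof.
move=> s1 s2; apply: (smooth_comp (f := taug zeta)) => //.
apply: (smooth_compv (f := line)) => //; first exact: smooth_line.
by apply: smooth_pair => //; exact: smooth_fst.
Qed.

Lemma smooth_Phi : smooth Phi (j0, w0).
Proof. by apply: smooth_Phi_at => //; rewrite /= sigma_at line0; exact: smooth_tauz. Qed.

Definition om (j : J r) : R := taug omega (j, j.1).

Lemma smooth_om : smooth om j0.
Proof.
apply: (smooth_comp (f := taug omega)) => //; first exact: smooth_tau.
by apply: smooth_pair; [exact: smooth_id|exact: smooth_fst].
Qed.

Lemma om_at : om j0 = w0.
Proof. by rewrite /om /taug /= tay_at. Qed.

(* Retraction of J^r onto jets of phi. *)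
Definition oret (j : J r) : JO r :=
  (om j, \row_(k < r.+1) iterD [seq (0, v) | v <- nseq k (1 : R)] Phi (j, om j)).

Lemma oretE j : oret j = ojet r (fun t => Phi (j, t)) (om j).
Proof. by congr (_, _); apply/rowP => k; rewrite !mxE derive1n_iterD iterD_pairr. Qed.

Lemma smooth_oret : smooth oret j0.
Proof.
apply: smooth_pair; first exact: smooth_om.
apply: smooth_row => k; apply: (smooth_comp (f := iterD [seq (0, v) | v <- nseq k (1 : R)] Phi)) => //.
  by rewrite om_at; apply: smooth_iterD; exact: smooth_Phi.
by apply: smooth_pair; [exact: smooth_id|exact: smooth_om].
Qed.

Lemma near_sigma (P : (J r * R) * R -> Prop) :
  (\forall z \near ((j0, w0), 0), P z) -> \forall z \near (j0, w0), P (z, sigma z).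
Proof.
move=> H; apply: (near_comp (g := fun z => (z, sigma z))); last by rewrite sigma_at.
by apply: smooth_continuous; apply: smooth_pair => //; exact: smooth_id.
Qed.

Lemma sigma_sol : \forall z \near (j0, w0), taug omega (line (z.1, sigma z)) = z.2.
Proof.
apply: filterS (near_sigma siP) => z /= H; apply/eqP; rewrite -subr_eq0; apply/eqP.
exact: H.2.
Qed.

Lemma Phi_base : \forall t \near w0, Phi (j0, t) = phi0 t.
Proof.
have h1 := near_slice sigma_sol.
have h2 : \forall t \near w0, zeta (jp (x0 + sigma (j0, t) *: e, u0 (x0 + sigma (j0, t) *: e))) =
    phi0 (omega (jp (x0 + sigma (j0, t) *: e, u0 (x0 + sigma (j0, t) *: e)))).
  apply: (near_comp (g := fun t => sigma (j0, t)) (P := fun s : R => zeta (jp (x0 + s *: e, u0 (x0 + s *: e))) =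
    phi0 (omega (jp (x0 + s *: e, u0 (x0 + s *: e)))))).
    by apply: smooth_continuous; exact: smooth_slice.
  by rewrite sigma_at; apply: (near_line sol).
apply: filterS2 h1 h2 => t; rewrite /Phi /taug /line /= tay_base => E ->.
by rewrite E.
Qed.

Lemma oret_at : oret j0 = o0.
Proof.
rewrite oretE om_at; congr (_, _); apply/rowP => k; rewrite !mxE !derive1n_iterD.
exact: (nbhs_singleton (eq_near_iterD _ Phi_base)).
Qed.

(** By uniqueness for [FW], sigma also inverts omega along the line from the other side; [sigma_sol]
    is the first half. *)
Lemma sigma_line : \forall z \near (j0, 0), sigma (z.1, taug omega (line z)) = z.2.
Proof.
have sl : smooth (fun z => taug omega (line z)) (j0, 0).
  apply: (smooth_comp (f := taug omega)) => //; last exact: smooth_line.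
  by rewrite line0; exact: smooth_tau.
have : \forall z \near (j0, 0), FW ((z.1, taug omega (line z)), z.2) = 0 <-> z.2 = sigma (z.1, taug omega (line z)).
  apply: (near_comp (g := fun z : J r * R => ((z.1, taug omega (line z)), z.2))
    (P := fun z => FW z = 0 <-> z.2 = sigma z.1)) => /=.
    apply: smooth_continuous; apply: smooth_pair; last exact: smooth_snd.
    by apply: smooth_pair => //; exact: smooth_fst.
  by rewrite line0 /taug /= tay_at.
apply: filterS => z H; symmetry; apply: H.1; rewrite /FW /=.
by rewrite -surjective_pairing subrr.
Qed.

Lemma near_j0 (P : J r * R -> Prop) : (\forall z \near (j0, 0), P z) -> \forall j \near j0, P (j, 0).
Proof.
move=> H; apply: (near_comp (g := fun j => (j, 0))) => //.
by apply: smooth_continuous; apply: smooth_pair; [exact: smooth_id|exact: smooth_cst].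
Qed.

Lemma near_om (P : J r * R -> Prop) : (\forall z \near (j0, w0), P z) -> \forall j \near j0, P (j, om j).
Proof.
move=> H; apply: (near_comp (g := fun j : J r => (j, om j))); last by rewrite om_at.
by apply: smooth_continuous; apply: smooth_pair; [exact: smooth_id|exact: smooth_om].
Qed.

Lemma sigma_om : \forall j \near j0, sigma (j, om j) = 0.
Proof. by apply: filterS (near_j0 sigma_line) => j /=; rewrite line0. Qed.

Lemma oret_val : \forall j \near j0, (oret j).2 0 0 = taug zeta (j, j.1).
Proof. by apply: filterS sigma_om => j E; rewrite mxE /= /Phi /= E line0. Qed.

Lemma tay_shift (j : J r) al (s : R) y :
  tay (j + s *: ddu al, y) - tay (j, y) = s * mon (mi1 al) (mi2 al) (y + - j.1).
Proof.
case: j => x c; have -> : (x, c) + s *: ddu al = (x, c + s *: delta_mx 0 (enum_rank al)).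
  by congr (_, _) => /=; rewrite scaler0 addr0.
by rewrite /tay tayl_shift /mm enum_rankK.
Qed.

Definition pj (j : J r) : J 0 := jp (j.1, tay (j, j.1)).

Lemma smooth_tdiag : smooth (fun j : J r => tay (j, j.1)) j0.
Proof.
apply: (smooth_comp (f := tay)) => //; first exact: smooth_tay0.
by apply: smooth_pair; [exact: smooth_id|exact: smooth_fst].
Qed.

Lemma near_pj (P : J 0 -> Prop) : (\forall p \near p0, P p) -> \forall j \near j0, P (pj j).
Proof.
move=> H; apply: (near_comp (g := pj)); last by rewrite /pj tay_at.
by apply: smooth_continuous; apply: smooth_jp; [exact: smooth_fst|exact: smooth_tdiag].
Qed.

Lemma smooth_tay_slice (j : J r) : smooth (fun y => tay (j, y)) j.1.
Proof. by apply: (smooth_slice (F := tay)) => //; exact: smooth_tay_diag. Qed.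

Lemma smooth_taug_slice f (j : J r) : smooth f (pj j) -> smooth (fun y => taug f (j, y)) j.1.
Proof. by move=> sf; apply: smooth_graph => //; exact: smooth_tay_slice. Qed.

Lemma smooth_taug_line f (j : J r) : smooth f (pj j) -> smooth (fun s : R => taug f (j, j.1 + s *: e)) 0.
Proof.
move=> sf; apply: (smooth_comp (f := fun y => taug f (j, y)) (g := fun s : R => j.1 + s *: e)) => //.
  by rewrite scale0r addr0; exact: smooth_taug_slice.
exact: smooth_affine.
Qed.

Lemma Phi_line (j : J r) t : Phi (j, t) = taug zeta (j, j.1 + sigma (j, t) *: e).
Proof. by []. Qed.

Lemma smooth_Phi_slice (j : J r) : sigma (j, om j) = 0 -> smooth sigma (j, om j) -> smooth zeta (pj j) ->
  smooth (fun t => Phi (j, t)) (om j).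
Proof.
move=> s0 ss sf; apply: (smooth_comp (f := fun s : R => taug zeta (j, j.1 + s *: e)) (g := fun t => sigma (j, t))) => //.
  by rewrite s0; exact: smooth_taug_line.
exact: smooth_slice.
Qed.

(** Contact already includes the value at j.1, so both graphs pass through the same point of J^0;
    composing with f and restricting to the line keep the contact. *)
Lemma taug_agree f (j j' : J r) m : j'.1 = j.1 -> smooth f (pj j') ->
  flat m (fun y => tay (j', y) - tay (j, y)) j.1 ->
  flat m (fun s : R => taug f (j', j.1 + s *: e) - taug f (j, j.1 + s *: e)) 0.
Proof.
move=> x1 sf fl; have st := smooth_tay_slice j; have st' := smooth_tay_slice j'; rewrite x1 in st'.
have ex : tay (j', j.1) = tay (j, j.1) by apply/eqP; rewrite -subr_eq0; apply/eqP; exact: flat_val fl.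
have ep : pj j' = pj j by rewrite /pj x1 ex.
have sj : smooth (fun y => taug f (j, y)) j.1 by apply: smooth_taug_slice; rewrite -ep.
have sj' : smooth (fun y => taug f (j', y)) j.1 by rewrite -x1; apply: smooth_taug_slice.
have eg : j.1 + (0 : R) *: e = j.1 by rewrite scale0r addr0.
apply: (flat_comp (f := fun y => taug f (j', y) - taug f (j, y)) (g := fun s : R => j.1 + s *: e)) => //.
- by rewrite eg; exact: smooth_B.
- exact: smooth_affine.
have fp : smooth f (jp (j.1, tay (j', j.1))) by move: sf; rewrite /pj x1.
by rewrite eg; exact: (flat_graph (u := fun y => tay (j', y)) (u' := fun y => tay (j, y)) fp st' st fl).
Qed.

Definition line_sol (z : J r * R) : Prop := taug omega (line (z.1, sigma z)) = z.2.
Definition line_sol_near (z : J r * R) : Prop := \forall z' \near z, line_sol z'.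

Lemma near_FW : \forall j \near j0, 'D_(0, 1) FW ((j, om j), 0) != 0.
Proof.
apply: (near_comp (g := fun j => ((j, om j), 0)) (P := fun z => 'D_(0, 1) FW z != 0)).
  apply: smooth_continuous; apply: smooth_pair; last exact: smooth_cst.
  by apply: smooth_pair; [exact: smooth_id|exact: smooth_om].
rewrite om_at.
exact: (near_neq0 (smooth_continuous (smooth_derive ((0, 1) : (J r * R) * R) smooth_FW0)) derive_FW0).
Qed.

(** A change of u_al adds to [tay] a multiple of a monomial of degree |al| centred at j.1, flat to
    order m = |al| - 1. The contact passes to omega on the line, to its inverse sigma by
    [agree_implicit], and to Phi, which is zeta on the line composed with sigma. *)
Lemma oret_core : \forall z \near (j0, j0), forall (al : midx r) (s : R), (0 < mi_abs al)%N ->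
  z.2 = z.1 + s *: ddu al ->
  om z.2 = om z.1 /\ forall k, (k < mi_abs al)%N ->
    iterD (nseq k (1 : R)) (fun t => Phi (z.2, t)) (om z.1) = iterD (nseq k (1 : R)) (fun t => Phi (z.1, t)) (om z.1).
Proof.
have n1 := near_fst j0 sigma_om; have n1' := near_snd j0 sigma_om.
have n2 := near_fst j0 (near_om (smooth_nbhs ssi)); have n2' := near_snd j0 (near_om (smooth_nbhs ssi)).
have n3 := near_fst j0 (near_pj (smooth_nbhs so)); have n3' := near_snd j0 (near_pj (smooth_nbhs so)).
have n4 := near_fst j0 (near_pj (smooth_nbhs sz)); have n4' := near_snd j0 (near_pj (smooth_nbhs sz)).
have hs := near_om (P := line_sol_near) (near_join sigma_sol).
have n5 := near_fst j0 hs; have n5' := near_snd j0 hs.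
have n6 := near_snd j0 near_FW.
near=> z => al s al0 Ez.
have h1 := near n1 z; have h1' := near n1' z.
have h2 := near n2 z; have h2' := near n2' z.
have h3 := near n3 z; have h3' := near n3' z.
have h4 := near n4 z; have h4' := near n4' z.
have h5 := near n5 z; have h5' := near n5' z.
have h6 := near n6 z.
have {}h1 : sigma (z.1, om z.1) = 0 by apply: h1.
have {}h1' : sigma (z.2, om z.2) = 0 by apply: h1'.
have {}h2 : smooth sigma (z.1, om z.1) by apply: h2.
have {}h2' : smooth sigma (z.2, om z.2) by apply: h2'.
have {}h3 : smooth omega (pj z.1) by apply: h3.
have {}h3' : smooth omega (pj z.2) by apply: h3'.
have {}h4 : smooth zeta (pj z.1) by apply: h4.
have {}h4' : smooth zeta (pj z.2) by apply: h4'.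
have {}h5 : line_sol_near (z.1, om z.1) by apply: h5.
have {}h5' : line_sol_near (z.2, om z.2) by apply: h5'.
have {}h6 : 'D_(0, 1) FW ((z.2, om z.2), 0) != 0 by apply: h6.
move: Ez h1 h1' h2 h2' h3 h3' h4 h4' h5 h5' h6; move: (z.1) (z.2) => j j' Ez h1 h1' h2 h2' h3 h3' h4 h4' h5 h5' h6.
have x1 : j'.1 = j.1 by rewrite Ez /= scaler0 addr0.
pose m := (mi_abs al).-1.
have fl : flat m (fun y => tay (j', y) - tay (j, y)) j.1.
  have smn y : smooth (fun y => mon (mi1 al) (mi2 al) (y + - j.1)) y.
    apply: (smooth_comp (f := @mon R (mi1 al) (mi2 al))) => //; first exact: smooth_mon.
    by apply: smooth_D; [exact: smooth_id|exact: smooth_cst].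
  apply: (@eq_flat _ _ _ _ (fun y => s * mon (mi1 al) (mi2 al) (y + - j.1))).
    by near=> y; rewrite Ez tay_shift.
  apply: flat_M => //; first exact: smooth_cst.
  by apply: flat_shift; rewrite subrr; apply: flat_mon; rewrite -[(_ + _)%N]/(mi_abs al) prednK.
have ex : tay (j', j.1) = tay (j, j.1) by apply/eqP; rewrite -subr_eq0; apply/eqP; exact: flat_val fl.
have ew : om j' = om j by rewrite /om /taug /= x1 ex.
split=> // k km.
rewrite ew in h1' h2' h5' h6.
have fo := taug_agree x1 h3' fl; have fz := taug_agree x1 h4' fl.
have ssj : smooth (fun t => sigma (j, t)) (om j) by exact: smooth_slice.
have ssj' : smooth (fun t => sigma (j', t)) (om j) by exact: smooth_slice.
have soj := smooth_taug_line h3; have soj' := smooth_taug_line h3'.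
have szj := smooth_taug_line h4; have szj' := smooth_taug_line h4'.
rewrite x1 in soj' szj'.
have fs : flat m (fun t => sigma (j', t) - sigma (j, t)) (om j).
  pose Fo (z : R * R) := FW ((j', z.1), z.2).
  have A1 : smooth Fo (om j, sigma (j', om j)).
    rewrite h1'; apply: (smooth_comp (f := FW)) => //=.
      apply: smooth_FW; rewrite /= line0; apply: smooth_taug; first by [].
      by apply: smooth_tay_diag.
    apply: smooth_pair; last exact: smooth_snd.
    by apply: smooth_pair; [exact: smooth_cst|exact: smooth_fst].
  have A2 : 'D_(0, 1) Fo (om j, sigma (j', om j)) != 0.
    by rewrite h1' derive_snd /Fo /=; move: h6; rewrite derive_snd.
  have e0 : sigma (j', om j) = sigma (j, om j) by rewrite h1 h1'.
  apply: (agree_implicit (g := fun t => sigma (j', t)) (g' := fun t => sigma (j, t)) (@findimR R) A1 A2 ssj' ssj e0).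
  (* The change of omega on the line: evaluated at [sigma (j, t)] it is the defect of [sigma (j, .)]
     in the equation of [sigma (j', .)]. *)
  pose D (s : R) := taug omega (j', j.1 + s *: e) - taug omega (j, j.1 + s *: e).
  have sD : smooth D (sigma (j, om j)) by rewrite h1; exact: smooth_B.
  apply: (@eq_flat _ _ _ _ (fun t => - D (sigma (j, t)))).
    apply: filterS2 (near_slice h5) (near_slice h5') => t H H'.
    rewrite /Fo /D /FW /= [taug omega (line (j', sigma (j', t)))]H' /= subrr sub0r opprB.
    rewrite -[taug omega (j, _)]/(taug omega (line (j, sigma (j, t)))) [taug omega (line (j, _))]H /=.
    by rewrite /line /= x1 opprB.
  apply: flat_N; first by apply: (smooth_comp (f := D)).
  by apply: (flat_comp (f := D)) => //; rewrite h1.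
have sPj := smooth_Phi_slice h1 h2 h4.
have sPj' : smooth (fun t => Phi (j', t)) (om j).
  by rewrite -ew; apply: smooth_Phi_slice; rewrite ?ew.
suff fP : flat m (fun t => Phi (j', t) - Phi (j, t)) (om j).
  apply/eqP; rewrite -subr_eq0 -(nbhs_singleton (iterD_B _ sPj' sPj)); apply/eqP; apply: fP.
  by rewrite size_nseq -ltnS /m prednK.
pose Z (s : R) := taug zeta (j', j.1 + s *: e).
pose D (s : R) := taug zeta (j', j.1 + s *: e) - taug zeta (j, j.1 + s *: e).
have sZ0 : smooth Z (sigma (j', om j)) by rewrite h1'.
have sZ1 : smooth Z (sigma (j, om j)) by rewrite h1.
have sD : smooth D (sigma (j, om j)) by rewrite h1; exact: smooth_B.
(* The change of Phi splits into the effect of the changed parameter sigma and the change of zeta at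
   a fixed parameter. *)
apply: (@eq_flat _ _ _ _ (fun t => (Z (sigma (j', t)) - Z (sigma (j, t))) + D (sigma (j, t)))).
  by near=> t; rewrite !Phi_line x1 /Z /D addrA subrK.
have sZs : smooth (fun t => Z (sigma (j, t))) (om j) by apply: (smooth_comp (f := Z)).
have sZs' : smooth (fun t => Z (sigma (j', t))) (om j) by apply: (smooth_comp (f := Z)).
have sDs : smooth (fun t => D (sigma (j, t))) (om j) by apply: (smooth_comp (f := D)).
apply: flat_D => //; first exact: smooth_B.
  by apply: (agree_comp (f := Z)).
by apply: (flat_comp (f := D)) => //; rewrite h1.
Unshelve. all: by end_near. Qed.

Lemma oret_tri (al : midx r) : (0 < mi_abs al)%N -> \forall j \near j0, exists c : 'I_r.+1 -> R,
  'D_(ddu al) oret j = \sum_(k : 'I_r.+1 | (mi_abs al <= k)%N) c k *: ddphi k.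
Proof.
move=> k0; apply: (@triangular_pair R _ _ _ _ id (fun k : 'I_r.+1 => k : nat) oret) => //.
- by exists id.
- exact: smooth_oret.
apply: filterS oret_core => z H s Ez; have [h1 h2] := H al s k0 Ez.
split=> [|k kal]; first exact: h1.
by rewrite !mxE h1; have := h2 k kal; rewrite !iterD_pairr.
Qed.

(** * The invariant surface condition on sections and jets *)

Hypothesis sQ : smooth_vfield Q p0.
Hypothesis iz : \forall q \near p0, 'D_(vfield_dir Q q) zeta q = 0.
Hypothesis io : \forall q \near p0, 'D_(vfield_dir Q q) omega q = 0.
Hypothesis xi0 : xi Q i' p0 != 0.

Definition integral_near (f : J 0 -> R) (p : J 0) : Prop := \forall q \near p, 'D_(vfield_dir Q q) f q = 0.
Definition sigma_line_near (z : J r * R) : Prop := \forall z' \near z, sigma (z'.1, taug omega (line z')) = z'.2.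

Lemma near_WU (P : JO r * 'rV[R]_2 -> Prop) : (\forall z \near (o0, x0), P z) -> \forall j \near j0, P (oret j, j.1).
Proof.
move=> H; apply: (near_comp (g := fun j : J r => (oret j, j.1))); last by rewrite oret_at.
by apply: smooth_continuous; apply: smooth_pair; [exact: smooth_oret|exact: smooth_fst].
Qed.

(** Over j.1 the value of u in j gives omega the value at which phi is expanded and zeta the value
    of phi there, so it solves [FU] = 0 and local uniqueness applies. *)
Lemma U_tay : \forall j \near j0, tay (j, j.1) = U (oret j, j.1).
Proof.
have n1 : \forall j \near j0, FU ((oret j, j.1), tay (j, j.1)) = 0 <-> tay (j, j.1) = U (oret j, j.1).
  apply: (near_comp (g := fun j => ((oret j, j.1), tay (j, j.1))) (P := fun z => FU z = 0 <-> z.2 = U z.1)).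
    apply: smooth_continuous; apply: smooth_pair; last exact: smooth_tdiag.
    by apply: smooth_pair; [exact: smooth_oret|exact: smooth_fst].
  by rewrite oret_at tay_at.
apply: filterS2 n1 oret_val => j H E; apply: H.1.
by rewrite /FU /= -[omega _]/(om j) -[om j]/((oret j).1) pol_val E /taug /= subrr.
Qed.

Lemma Phi_pol (j : J r) : sigma (j, om j) = 0 -> smooth sigma (j, om j) -> smooth zeta (pj j) ->
  flat r (fun t => Phi (j, t) - pol (oret j, t)) (om j).
Proof.
move=> h1 h2 h3; have sP := smooth_Phi_slice h1 h2 h3.
have sp : smooth (fun t => pol (oret j, t)) (om j).
  by apply: (smooth_slice (F := pol)) => //; exact: (smooth_pol_diag (oret j)).
apply: flat_line; first exact: smooth_B.
move=> k kr; have kr' : (k < r.+1)%N by [].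
rewrite (nbhs_singleton (iterD_B _ sP sp)).
have := pol_jet (oret j) (Ordinal kr'); rewrite -[(oret j).1]/(om j) /= => ->.
by rewrite mxE /= iterD_pairr subrr.
Qed.

Lemma smooth_defect (j : J r) : smooth zeta (pj j) -> smooth omega (pj j) ->
  smooth (fun y => taug zeta (j, y) - pol (oret j, taug omega (j, y))) j.1.
Proof.
move=> h1 h2; apply: smooth_B; first exact: smooth_taug_slice.
apply: (smooth_comp (f := fun t => pol (oret j, t)) (g := fun y => taug omega (j, y))) => //; last exact: smooth_taug_slice.
by apply: (smooth_slice (F := pol)) => //; exact: (smooth_pol_diag (oret j)).
Qed.

(** With t = omega as parameter of the line, the defect zeta - phi(omega) becomes Phi - pol, flat to
    order r by the choice of [oret j]. *)
Lemma defect_line (j : J r) : sigma (j, om j) = 0 -> smooth sigma (j, om j) -> smooth zeta (pj j) ->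
  smooth omega (pj j) -> sigma_line_near (j, 0) ->
  forall k, (k <= r)%N -> iterD (nseq k e) (fun y => taug zeta (j, y) - pol (oret j, taug omega (j, y))) j.1 = 0.
Proof.
move=> h1 h2 h3 h4 h5 k kr; set G := fun y => _.
have fG : flat r (fun s : R => G (j.1 + s *: e)) 0.
  have sh := smooth_taug_line h4.
  have hw : taug omega (j, j.1 + (0 : R) *: e) = om j by rewrite scale0r addr0.
  apply: (@eq_flat _ _ _ _ (fun s : R => Phi (j, taug omega (j, j.1 + s *: e)) - pol (oret j, taug omega (j, j.1 + s *: e)))).
    apply: filterS (near_slice h5) => s /= H.
    by rewrite /G Phi_line -[taug omega (j, _)]/(taug omega (line (j, s))) H.
  have sP := smooth_Phi_slice h1 h2 h3.
  have sp : smooth (fun t => pol (oret j, t)) (om j).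
    by apply: (smooth_slice (F := pol)) => //; exact: (smooth_pol_diag (oret j)).
  apply: (flat_comp (f := fun t => Phi (j, t) - pol (oret j, t)) (g := fun s : R => taug omega (j, j.1 + s *: e))) => //.
    by rewrite hw; exact: smooth_B.
  by rewrite hw; exact: Phi_pol.
have := fG (nseq k (1 : R)); rewrite size_nseq => /(_ kr).
by rewrite iterD_line scale0r addr0.
Qed.

Lemma defect_derive (a : JO r) u x k : smooth u x -> smooth zeta (jp (x, u x)) -> smooth omega (jp (x, u x)) ->
  smooth (fun t => pol (a, t)) (omega (jp (x, u x))) ->
  \forall y \near x, 'D_(ee k) (fun y => zeta (jp (y, u y)) - pol (a, omega (jp (y, u y)))) y =
    (dx k zeta (jp (y, u y)) + 'D_(ee k) u y * du zeta (jp (y, u y))) -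
    (dx k omega (jp (y, u y)) + 'D_(ee k) u y * du omega (jp (y, u y))) *
      'D_1 (fun t => pol (a, t)) (omega (jp (y, u y))).
Proof.
move=> sT h1 h2 sp.
have sP : smooth (fun y => jp (y, u y)) x by apply: (smooth_jp (x := id)) => //; exact: smooth_id.
have s1 := near_comp (smooth_continuous sP) (smooth_nbhs h1).
have s2 := near_comp (smooth_continuous sP) (smooth_nbhs h2).
have so1 := smooth_graph h2 sT; have sz1 := smooth_graph h1 sT.
have s3 := near_comp (P := fun t => smooth (fun t => pol (a, t)) t) (smooth_continuous so1) (smooth_nbhs sp).
have s4 := smooth_nbhs sT.
have s5 := smooth_nbhs so1; have s6 := smooth_nbhs sz1.
apply: filterS3 (filterI s1 s2) (filterI s3 s4) (filterI s5 s6) => y [a1 a2] [a3 a4] [a5 a6].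
rewrite derive_B; [|exact: smooth_diff|]; last first.
  by apply: smooth_diff; apply: (smooth_comp (f := fun t => pol (a, t)) (g := fun y => omega (jp (y, u y)))).
rewrite (derive_comp1 (f := fun t => pol (a, t)) (g := fun y => omega (jp (y, u y)))); [|exact: smooth_diff|exact: smooth_diff].
by rewrite !(derive_along (u := u)) //; exact: smooth_diff.
Qed.

Lemma charfunE u y : charfun Q u y =
  Defs.eta Q (jp (y, u y)) - xi Q i (jp (y, u y)) * 'D_(ee i) u y - xi Q i' (jp (y, u y)) * 'D_(ee i') u y.
Proof. by rewrite /charfun; case: ii => -[-> ->]; [reflexivity|exact: addrAC]. Qed.

Lemma span_ii (u : 'rV[R]_2) : exists a b, u = a *: ee i + b *: ee i'.
Proof.
have [a [b E]] := span2 u; case: ii => -[-> ->]; first by exists a, b.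
by exists b, a; rewrite addrC.
Qed.

(** The transport identity serves both ways. For a jet in Q_(r), flatness of Q[u] makes the
    transported defect flat. For an exact ansatz solution the defect is zero, and Q[u] = 0 follows
    where K does not vanish. *)
Lemma defect_field (a : JO r) u x : smooth u x -> smooth zeta (jp (x, u x)) -> smooth omega (jp (x, u x)) ->
  smooth (fun t => pol (a, t)) (omega (jp (x, u x))) ->
  integral_near zeta (jp (x, u x)) -> integral_near omega (jp (x, u x)) ->
  let G y := zeta (jp (y, u y)) - pol (a, omega (jp (y, u y))) in
  let K y := 'D_1 (fun t => pol (a, t)) (omega (jp (y, u y))) * du omega (jp (y, u y)) - du zeta (jp (y, u y)) in
  smooth K x /\ \forall y \near x,
    xi Q i (jp (y, u y)) * 'D_(ee i) G y + xi Q i' (jp (y, u y)) * 'D_(ee i') G y = K y * charfun Q u y.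
Proof.
move=> sT h3 h4 sp h8 h9 G K; split.
  apply: smooth_B; last by apply: (smooth_graph (f := du zeta)) => //; exact: smooth_derive.
  apply: smooth_M; last by apply: (smooth_graph (f := du omega)) => //; exact: smooth_derive.
  apply: (smooth_comp (f := 'D_(1 : R) (fun t => pol (a, t))) (g := fun y => omega (jp (y, u y)))) => //.
    by apply: smooth_derive.
  exact: smooth_graph.
have sP : smooth (fun y => jp (y, u y)) x by apply: (smooth_jp (x := id)) => //; exact: smooth_id.
have d1 := defect_derive i sT h3 h4 sp; have d2 := defect_derive i' sT h3 h4 sp.
have m1 := near_comp (smooth_continuous sP) h8; have m2 := near_comp (smooth_continuous sP) h9.
have m3 := near_comp (smooth_continuous sP) (smooth_diff_nbhs h3).
have m4 := near_comp (smooth_continuous sP) (smooth_diff_nbhs h4).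
apply: filterS3 (filterI d1 d2) (filterI m1 m2) (filterI m3 m4) => y [a1 a2] [a3 a4] [a5 a6].
rewrite /G a1 a2 charfunE /K.
rewrite (derive_vfield Q ii a5) in a3; rewrite (derive_vfield Q ii a6) in a4.
exact: transport_algebra.
Qed.

Lemma defect_flat (j : J r) : sigma (j, om j) = 0 -> smooth sigma (j, om j) -> smooth zeta (pj j) ->
  smooth omega (pj j) -> sigma_line_near (j, 0) -> smooth_vfield Q (pj j) -> xi Q i' (pj j) != 0 ->
  integral_near zeta (pj j) -> integral_near omega (pj j) -> invariant_set Q j ->
  flat r (fun y => taug zeta (j, y) - pol (oret j, taug omega (j, y))) j.1.
Proof.
move=> h1 h2 h3 h4 h5 h6 h7 h8 h9 inv.
have sT := smooth_tay_slice j.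
have sx k : smooth (fun y => xi Q k (jp (y, tay (j, y)))) j.1.
  by apply: smooth_graph => //; exact: (h6.1 k).
apply: (flat_transport (v := ee i) (w := ee i') (X := fun y => xi Q i (jp (y, tay (j, y))))
  (Y := fun y => xi Q i' (jp (y, tay (j, y))))) => //.
- exact: span_ii.
- exact: smooth_defect.
- exact: defect_line.
move=> n nr.
have fc : flat n (charfun Q (fun y => tay (j, y))) j.1.
  by apply: (invariant_flat (r := r)) => //; [rewrite jet0E|rewrite jet_tay].
have sp : smooth (fun t => pol (oret j, t)) (om j).
  by apply: (smooth_slice (F := pol)) => //; exact: (smooth_pol_diag (oret j)).
have [sK HK] := defect_field sT h3 h4 sp h8 h9.
have sc : smooth (charfun Q (fun y => tay (j, y))) j.1.
  have se : smooth (fun y => Defs.eta Q (jp (y, tay (j, y)))) j.1 by apply: smooth_graph => //; exact: h6.2.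
  by apply: smooth_B; [apply: smooth_B => //|]; apply: smooth_M => //; exact: smooth_derive.
apply: eq_flat (flat_M sK sc fc).
by apply: filterS HK => y E; exact: esym.
Qed.

(* On Q_(r), zeta - phi(omega) is flat along the line by the choice of phi = pol (oret j, .)
   and satisfies X D_i + Y D_i' = 0 to order r - 1, hence is flat to order r. *)
Lemma oret_real : \forall j \near j0, invariant_set Q j -> jet r (fun y => U (oret j, y)) j.1 = j.
Proof.
have sxi k : smooth (xi Q k) p0 := sQ.1 k.
have n1 := sigma_om; have n2 := near_om (smooth_nbhs ssi).
have n3 := near_pj (smooth_nbhs sz); have n4 := near_pj (smooth_nbhs so).
have n5 := near_j0 (P := sigma_line_near) (near_join sigma_line).
have n6 : \forall j \near j0, smooth_vfield Q (pj j).
  have a0 := near_pj (smooth_nbhs (sxi 0)); have a1 := near_pj (smooth_nbhs (sxi 1)).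
  have a2 := near_pj (smooth_nbhs (sQ.2 : smooth (Defs.eta Q) p0)).
  by apply: filterS3 a0 a1 a2 => j b0 b1 b2; split=> // k; have [->|->] := I2 k.
have n7 := near_pj (near_neq0 (smooth_continuous (sxi i')) xi0).
have n8 := near_pj (P := integral_near zeta) (near_join iz).
have n9 := near_pj (P := integral_near omega) (near_join io).
have n10 := U_tay.
have n11 := near_WU (smooth_nbhs sU).
have n12 := near_WU near_FU.
have n13 := near_WU (P := solves_near) (near_join U_sol).
apply: filterS2 (filterI (filterI (filterI n1 n2) (filterI n3 n4)) (filterI n5 n6))
  (filterI (filterI (filterI n7 n8) (filterI n9 n10)) (filterI n11 (filterI n12 n13))).
move=> j [[[h1 h2] [h3 h4]] [h5 h6]] [[[h7 h8] [h9 h10]] [h11 [[h12 h12'] h13]]] inv.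
have fG := defect_flat h1 h2 h3 h4 h5 h6 h7 h8 h9 inv.
have sT := smooth_tay_slice j.
have sUj : smooth (fun y => U (oret j, y)) j.1 by exact: smooth_slice.
rewrite -[in RHS](jet_tay j); apply: agree_jet => //.
pose Fo (z : 'rV[R]_2 * R) := FU ((oret j, z.1), z.2).
have A1 : smooth Fo (j.1, U (oret j, j.1)) by apply: smooth_FU_slice.
have A2 : 'D_(0, 1) Fo (j.1, U (oret j, j.1)) != 0 by rewrite FU_slice.
(* [tay (j, .)] solves the equation of [U (oret j, .)] up to a defect flat to order r, so the two
   functions have the same r-jet at j.1. *)
apply: (agree_implicit (g := fun y => U (oret j, y)) (g' := fun y => tay (j, y)) (@findim_rV R 2) A1 A2 sUj sT (esym h10)).
have sG := smooth_defect h3 h4.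
apply: eq_flat (flat_N sG fG).
apply: filterS (near_slice h13) => y H.
by rewrite /Fo /FU /= [zeta (jp (y, U (oret j, y)))]H /= subrr sub0r /taug.
Qed.

Lemma derive_FU z : smooth zeta (jp (z.1.2, z.2)) -> smooth omega (jp (z.1.2, z.2)) ->
  smooth (fun t => pol (z.1.1, t)) (omega (jp (z.1.2, z.2))) ->
  'D_(0, 1) FU z = du zeta (jp (z.1.2, z.2)) -
    du omega (jp (z.1.2, z.2)) * 'D_1 (fun t => pol (z.1.1, t)) (omega (jp (z.1.2, z.2))).
Proof.
case: z => -[a x] s /= h1 h2 h3; rewrite derive_snd /FU /=.
have sj : smooth (fun s => jp (x, s)) s.
  by apply: (smooth_jp (x := fun _ => x)); [exact: smooth_cst|exact: smooth_id].
have s1 : smooth (fun s => zeta (jp (x, s))) s by apply: (smooth_comp (f := zeta)).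
have s2 : smooth (fun s => omega (jp (x, s))) s by apply: (smooth_comp (f := omega)).
have s3 : smooth (fun s => pol (a, omega (jp (x, s)))) s by apply: (smooth_comp (f := fun t => pol (a, t))).
rewrite derive_B; [|exact: smooth_diff|exact: smooth_diff].
rewrite (derive_comp1 (f := fun t => pol (a, t)) (g := fun s => omega (jp (x, s)))); [|exact: smooth_diff|exact: smooth_diff].
by rewrite !derive_vert.
Qed.

Definition pX (a : JO r) : J 0 := jp (xsec a, U (a, xsec a)).

Lemma smooth_pX : smooth pX o0.
Proof.
apply: smooth_jp; first exact: smooth_xsec.
by apply: (smooth_comp (f := U)) => //; rewrite xsec_at.
Qed.

Lemma pX_at : pX o0 = p0.
Proof. by rewrite /pX xsec_at U_at. Qed.

Lemma near_pX (P : J 0 -> Prop) : (\forall p \near p0, P p) -> \forall a \near o0, P (pX a).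
Proof.
move=> H; apply: (near_comp (g := pX)); last by rewrite pX_at.
exact/smooth_continuous/smooth_pX.
Qed.

(** The defect vanishes identically along [U (a, .)], so the transport identity reads K Q[u] = 0. At
    the base point K is - D_(0,1) FU, which is nonzero, and it stays so nearby. *)
Lemma jsec_inv : \forall a \near o0, invariant_set Q (jsec a).
Proof.
have sxi k : smooth (xi Q k) p0 := sQ.1 k.
have n1 := near_xsec (smooth_nbhs sU).
have n2 := near_pX (smooth_nbhs sz); have n3 := near_pX (smooth_nbhs so).
have n4 := near_pX (P := integral_near zeta) (near_join iz).
have n5 := near_pX (P := integral_near omega) (near_join io).
have n6 : \forall a \near o0, smooth_vfield Q (pX a).
  have a0 := near_pX (smooth_nbhs (sxi 0)); have a1 := near_pX (smooth_nbhs (sxi 1)).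
  have a2 := near_pX (smooth_nbhs (sQ.2 : smooth (Defs.eta Q) p0)).
  by apply: filterS3 a0 a1 a2 => j b0 b1 b2; split=> // k; have [->|->] := I2 k.
have n7 := near_xsec near_FU.
have n8 := near_xsec (P := solves_near) (near_join U_sol).
apply: filterS3 (filterI (filterI n1 n2) (filterI n3 n4)) (filterI n5 n6) (filterI xsec_omega (filterI n7 n8)).
move=> a [[h1 h2] [h3 h4]] [h5 h6] [h9 [[h7 h7'] h8]].
have sUa : smooth (fun y => U (a, y)) (xsec a) by exact: smooth_slice.
have sp : smooth (fun t => pol (a, t)) (omega (pX a)).
  by rewrite /pX h9; apply: (smooth_slice (F := pol)) => //; exact: smooth_pol_diag.
have [sK HK] := defect_field sUa h2 h3 sp h4 h5.
rewrite jsecE; apply: invariant_of_zero => //; first by rewrite jet0E.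
have K0 := h7'; rewrite derive_FU // in K0.
have Kn : 'D_1 (fun t => pol (a, t)) (omega (pX a)) * du omega (pX a) - du zeta (pX a) != 0.
  by rewrite -oppr_eq0 opprB mulrC.
have n9 := near_neq0 (smooth_continuous sK) Kn.
have G0 : \forall y \near xsec a, zeta (jp (y, U (a, y))) - pol (a, omega (jp (y, U (a, y)))) = 0.
  by apply: filterS (near_slice h8) => y H; rewrite [zeta _]H subrr.
have D0 k : \forall y \near xsec a, 'D_(ee k) (fun y => zeta (jp (y, U (a, y))) - pol (a, omega (jp (y, U (a, y))))) y = 0.
  have := @eq_near_derive R _ _ _ (fun _ => 0) (xsec a) (ee k) G0.
  by apply: filterS => y ->; rewrite derive_cst.
apply: filterS3 (filterI (D0 i) (D0 i')) HK n9 => y [d1 d2] E N.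
by move: E; rewrite d1 d2 !mulr0 addr0 => /esym/eqP; rewrite mulf_eq0 (negbTE N) => /eqP.
Qed.

(** * Comparison of the orders *)

Section Reduced.
Variables (L : J r -> R) (theta : J 0 -> R) (Lc : JO r -> R) (lam1 : R * JO r -> R).
Hypothesis sth : smooth theta p0.
Hypothesis sLc : smooth Lc o0.
Hypothesis slam1 : smooth lam1 (theta p0, o0).
Hypothesis lam10 : lam1 (theta p0, o0) != 0.
Hypothesis subst : \forall z \near (j0, o0), forall u phi x,
  ansatz_solution zeta omega u phi x -> jet r u x = z.1 -> ojet r phi (omega (jet 0 u x)) = z.2 ->
  L z.1 = lam1 (theta (jet 0 u x), z.2) * Lc z.2.
Hypothesis minimal : forall mu Lc' : JO r -> R,
  smooth mu o0 -> mu o0 != 0 -> smooth Lc' o0 ->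
  (\forall a \near o0, Lc a = mu a * Lc' a) -> odiff_order Lc o0 <= odiff_order Lc' o0.

Lemma near_UX : \forall a \near o0,
  ansatz_solution zeta omega (fun y => U (a, y)) (fun t => pol (a, t)) (xsec a).
Proof. by apply: filterS2 (near_xsec U_ansatz) xsec_omega => a H E; exact: H. Qed.

Lemma L_jsec : \forall a \near o0, L (jsec a) = lam1 (theta (pX a), a) * Lc a.
Proof.
have n1 : \forall a \near o0, forall u phi x,
    ansatz_solution zeta omega u phi x -> jet r u x = jsec a -> ojet r phi (omega (jet 0 u x)) = a ->
    L (jsec a) = lam1 (theta (jet 0 u x), a) * Lc a.
  apply: (near_comp (g := fun a => (jsec a, a)) (P := fun z => forall u phi x,
    ansatz_solution zeta omega u phi x -> jet r u x = z.1 -> ojet r phi (omega (jet 0 u x)) = z.2 ->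
    L z.1 = lam1 (theta (jet 0 u x), z.2) * Lc z.2)); last by rewrite jsec_at.
  by apply: smooth_continuous; apply: smooth_pair; [exact: smooth_jsec|exact: smooth_id].
apply: filterS3 n1 near_UX xsec_omega => a H1 H2 H3.
have := H1 _ _ _ H2; rewrite -jsecE jet0E H3 ojet_pol; exact.
Qed.

(** Along the section the parameter theta becomes the function [theta (pX a)] of a. The quotient of
    the multipliers of the two factorizations of L is then a smooth nonvanishing function of jets of
    phi alone, as minimality of Lc requires. *)
Lemma lower_bound (lam Lt : J r -> R) : smooth lam j0 -> lam j0 != 0 -> smooth Lt j0 ->
  (\forall j \near j0, invariant_set Q j -> L j = lam j * Lt j) ->
  odiff_order Lc o0 <= diff_order Lt j0.
Proof.
move=> sl l0 sLt H.
have sS := smooth_jsec.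
have s1 : smooth (fun a => lam1 (theta (pX a), a)) o0.
  apply: (smooth_comp (f := lam1)) => //; first by rewrite pX_at.
  apply: smooth_pair; last exact: smooth_id.
  by apply: (smooth_comp (f := theta)) => //; [rewrite pX_at|exact: smooth_pX].
have v0 : lam1 (theta (pX o0), o0) != 0 by rewrite pX_at.
have sLtS : smooth (fun a => Lt (jsec a)) o0 by apply: (smooth_comp (f := Lt)) => //; rewrite jsec_at.
apply: (@le_trans _ _ (odiff_order (fun a => Lt (jsec a)) o0)).
  apply: (minimal (mu := fun a => lam (jsec a) * (lam1 (theta (pX a), a))^-1)).
  - apply: smooth_M; last exact: smooth_V.
    by apply: (smooth_comp (f := lam)) => //; rewrite jsec_at.
  - by rewrite jsec_at mulf_neq0 // invr_eq0.
  - by [].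
  have n1 : \forall a \near o0, invariant_set Q (jsec a) -> L (jsec a) = lam (jsec a) * Lt (jsec a).
    by apply: (near_comp (g := jsec) (P := fun j => invariant_set Q j -> L j = lam j * Lt j)); [exact: smooth_continuous|rewrite jsec_at].
  have n2 := near_neq0 (smooth_continuous s1) v0.
  apply: filterS3 (filterI n1 n2) jsec_inv L_jsec => a [a1 a2] a3 a4.
  by rewrite mulrAC -(a1 a3) a4 mulrAC divff // mul1r.
rewrite -jsec_at; apply: germ_order_comp => //; first by rewrite jsec_at.
exact: jsec_tri.
Qed.

Lemma coorder : weak_singularity_coorder Q L j0 (odiff_order Lc o0).
Proof.
have sW := smooth_oret.
have sLW : smooth (fun j => Lc (oret j)) j0 by apply: (smooth_comp (f := Lc)) => //; rewrite oret_at.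
have spj : smooth pj j0 by apply: smooth_jp; [exact: smooth_fst|exact: smooth_tdiag].
have pj_at : pj j0 = p0 by rewrite /pj tay_at.
have sl : smooth (fun j => lam1 (theta (pj j), oret j)) j0.
  apply: (smooth_comp (f := lam1)) => //; first by rewrite oret_at pj_at.
  by apply: smooth_pair => //; apply: (smooth_comp (f := theta)) => //; rewrite pj_at.
have l0 : lam1 (theta (pj j0), oret j0) != 0 by rewrite oret_at pj_at.
(* The substitution identity is used at j itself, for the solution [U (oret j, .)] at the point j.1;
   theta is therefore evaluated at [pj j], the point of J^0 under j. *)
have HL : \forall j \near j0, invariant_set Q j -> L j = lam1 (theta (pj j), oret j) * Lc (oret j).
  have n1 : \forall j \near j0, forall u phi x,
      ansatz_solution zeta omega u phi x -> jet r u x = j -> ojet r phi (omega (jet 0 u x)) = oret j ->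
      L j = lam1 (theta (jet 0 u x), oret j) * Lc (oret j).
    apply: (near_comp (g := fun j => (j, oret j)) (P := fun z => forall u phi x,
      ansatz_solution zeta omega u phi x -> jet r u x = z.1 -> ojet r phi (omega (jet 0 u x)) = z.2 ->
      L z.1 = lam1 (theta (jet 0 u x), z.2) * Lc z.2)); last by rewrite oret_at.
    by apply: smooth_continuous; apply: smooth_pair; [exact: smooth_id|].
  apply: filterS3 (filterI n1 U_tay) (near_WU U_ansatz) oret_real => j [h1 h2] h3 h4 inv.
  have E : omega (jp (j.1, U (oret j, j.1))) = (oret j).1 by rewrite -h2.
  have := h1 _ _ _ (h3 E) (h4 inv).
  by rewrite jet0E E ojet_pol -h2; exact.
(* The lower bound, valid for every factorization, applies in particular to the one just found; with
   triangularity of [oret] it pins the order of [Lc] composed with [oret]. *)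
have le := lower_bound sl l0 sLW HL.
have ge : diff_order (fun j => Lc (oret j)) j0 <= odiff_order Lc o0.
  rewrite -oret_at; apply: germ_order_comp => //; first by rewrite oret_at.
  exact: oret_tri.
split.
  exists (fun j => lam1 (theta (pj j), oret j)), (fun j => Lc (oret j)); split=> //.
  by apply/eqP; rewrite eq_le ge le.
by move=> k [lam [Lt [s1 s2 s3 <- s4]]]; exact: (lower_bound s1 s2 s3 s4).
Qed.

End Reduced.

End Main.

Theorem proposition4 (R : realType) (r : nat) (L : J r -> R) (Q : vfield)
    (zeta omega theta : J 0 -> R) (Lc : JO r -> R)
    (u0 : 'rV[R]_2 -> R) (phi0 : R -> R) (x0 : 'rV[R]_2) :
  let p0 : J 0 := jet 0 u0 x0 in
  let j0 : J r := jet r u0 x0 in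
  let o0 : JO r := ojet r phi0 (omega p0) in
  smooth_near L j0 ->
  diff_order L j0 = r%:Z ->
  smooth_vfield Q p0 ->
  (exists i, xi Q i p0 != 0) ->
  reduction_operator Q L j0 ->
  is_ansatz Q zeta omega p0 ->
  smooth_near theta p0 ->
  functionally_independent [:: zeta; omega; theta] p0 ->
  ansatz_solution zeta omega u0 phi0 x0 ->
  reduced_equation zeta omega theta L Lc j0 o0 ->
  weak_singularity_coorder Q L j0 (odiff_order Lc o0).
Proof.
move=> p0 j0 o0 _ _ sQ [i' xi0] _ [[sz so] iz io ind zu0] sth _ [su sphi sol] [sLc [lam1 [slam1 lam10 sub]] mini].
have ep : p0 = jp (x0, u0 x0) by exact: jet0E.
rewrite /o0 in sLc slam1 lam10 sub mini *.
rewrite /j0 !trunc_jet // in slam1 lam10 sub mini *.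
rewrite -/p0 in slam1 lam10.
rewrite jet0E in sphi.
rewrite ep in sQ xi0 sz so iz io ind zu0 sth sLc slam1 lam10 sub mini *.
have sol' : \forall y \near x0, zeta (jp (y, u0 y)) = phi0 (omega (jp (y, u0 y))).
  by apply: filterS sol => y; rewrite jet0E.
have [i ii] : exists i : 'I_2, (i = 0 /\ i' = 1) \/ (i = 1 /\ i' = 0).
  by have [->|->] := I2 i'; [exists 1; right|exists 0; left].
rewrite mkjet0E in zu0.
have tru := transversal_u sz so su sphi sol' ind.
have tro := transversal_omega sz so su sphi sol' (nbhs_singleton iz) (nbhs_singleton io) ind zu0 ii xi0.
(* The implicit functions are fixed in the order of dependence: [sg] refers to U, while sigma is
   built from [tay] and omega. *)
have [U sU UP] := exists_U r sz so sphi sol' tru.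
have [sg ssg sgP] := exists_xsec so su sol' tro sU UP.
have [sigma ssi siP] := exists_sigma r so su tro.
apply: (coorder sz so su sphi sol' tru ii tro sU UP ssg sgP ssi siP sQ iz io xi0 sth sLc slam1 lam10 _ mini).
by [].
Qed.
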